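(* Let $f$ have compact support and be a distributional solution of the relativistic Vlasov--Maxwell system. Then $f$ conserves total energy, i.e. $\frac{dH}{dt}=0$, where $$H=\int f\,(\gamma(\bm u)-1)\,mc^2\,dx\,du+\frac1{8\pi}\int\big(\bm E^2+\bm B^2\big)\,dx .$$
   Context: Here $\bm x\in\Omega_x\subset\mathbb R^3$ is position, $\bm u\in\Omega_u\subset\mathbb R^3$ is momentum, $t\in(0,T)$ is time, $\Omega=\Omega_u\times\Omega_x\times(0,T)$, $dV=dt\,dx\,du$; $\nabla$ and $\nabla_u$ are the gradients in $\bm x$ and $\bm u$. The constants are the mass $m$, the charge $e$, the speed of light $c$ and the constant neutralizing background density $n_0$; $\gamma(\bm u)=\sqrt{1+|\bm u|^2/(m^2c^2)}$; $\bm E^2=|\bm E|^2$ and $\bm B^2=|\bm B|^2$. The relativistic Vlasov--Maxwell system (Gauss units) for the density $f(\bm u,\bm x,t)$, the electric field $\bm E(\bm x,t)$ and the magnetic field $\bm B(\bm x,t)$ is $$\partial_t f+\nabla\cdot\Big(\frac{\bm u}{m\gamma(\bm u)}f\Big)+\nabla_u\cdot\Big(e\Big(\bm E+\frac{\bm u}{cm\gamma(\bm u)}\times\bm B\Big)f\Big)=0,$$ coupled to the Maxwell equations $$-\frac1c\partial_t\bm E+\nabla\times\bm B=\frac{4\pi}{c}\bm J,\quad \frac1c\partial_t\bm B+\nabla\times\bm E=0,\quad \nabla\cdot\bm E=4\pi e(n-n_0),\quad\nabla\cdot\bm B=0,$$ with $n=\int f\,du$ and $\bm J=\frac em\int\frac{\bm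 u}{\gamma(\bm u)}f\,du$. That $f$ is a distributional solution means that, with $\bm E,\bm B$ determined from the Maxwell equations, the Vlasov equation holds in the sense of distributions: $$\int_\Omega \partial_t f\,\phi\,dV=-\int_\Omega\nabla\cdot\Big(\frac{\bm u}{m\gamma(\bm u)}f\Big)\phi\,dV-\int_\Omega\nabla_u\cdot\Big(e\Big(\bm E+\frac{\bm u}{cm\gamma(\bm u)}\times\bm B\Big)f\Big)\phi\,dV\quad\text{for all }\phi\in C_0^\infty(\Omega),$$ where $C_0^\infty(\Omega)$ is the space of smooth test functions with compact support in $\Omega$. The advection coefficients $\frac{\bm u}{m\gamma(\bm u)}$ and $e\big(\bm E+\frac{\bm u}{cm\gamma(\bm u)}\times\bm B\big)$ are assumed to be smooth on $\Omega$.
   Formalization: Added: E²+B² is integrable over Ω_x, locally in time; and, if Ω_x≠R³, ∇·(E×B) is likewise integrable with zero integral over Ω_x (no net Poynting flux), as otherwise a vacuum wave with f=0 is a counterexample. f is a locally integrable density and dH/dt=0 is distributional in t. *)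

(* Defs.v *)
From HB Require Import structures.
From mathcomp Require Import all_boot all_order all_algebra.
From mathcomp Require Import all_classical all_reals all_analysis.
Set Implicit Arguments.
Unset Strict Implicit.
Unset Printing Implicit Defensive.
Import Order.TTheory GRing.Theory Num.Theory.
Import numFieldNormedType.Exports.
Local Open Scope classical_set_scope.
Local Open Scope ring_scope.

(* Three-space is the product R * R * R, because products carry both the
   product Lebesgue measure and the normed-space structure of the library.
   The library norm on it is the sup norm, so Euclidean lengths are always
   written with [dot]. *)
Notation vec3 R := (R * R * R)%type.

(* points (x, t) and (u, x, t) respectively *)
Notation spacetime R := (vec3 R * R)%type.
Notation phase R := (vec3 R * vec3 R * R)%type.

(* the same triples, tagged with the Borel sigma-algebra *)
Notation mvec3 R :=
  (measurableTypeR R * measurableTypeR R * measurableTypeR R)%type.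

Section product_measure.
Context d1 d2 (T1 : measurableType d1) (T2 : measurableType d2) (R : realType).
Variables (m1 : {sigma_finite_measure set T1 -> \bar R})
          (m2 : {sigma_finite_measure set T2 -> \bar R}).

(* m1 \x m2, for which the library infers a sigma-finite measure only when
   m1 and m2 are subprobabilities *)
Definition prodm : set (T1 * T2) -> \bar R := (m1 \x m2)%E.

HB.instance Definition _ := Measure.on prodm.

Lemma prodm_sigma_finite : sigma_finite setT prodm.
Proof.
have /sigma_finiteP[F [TF ndF Foo]] := sigma_finiteT m1.
have /sigma_finiteP[G [TG ndG Goo]] := sigma_finiteT m2.
exists (fun n => F n `*` G n).
  rewrite -setXTT TF TG predeqE => -[x y]; split.
    move=> [/= [n _ Fnx] [k _ Gky]]; exists (maxn n k) => //; split.
    - by move: x Fnx; exact/subsetPset/ndF/leq_maxl.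
    - by move: y Gky; exact/subsetPset/ndG/leq_maxr.
  by move=> [n _ []/= ? ?]; split; exists n.
move=> k; have [? ?] := Foo k; have [? ?] := Goo k.
split; first exact: measurableX.
by rewrite /prodm product_measure1E// lte_mul_pinfty// ge0_fin_numE.
Qed.

HB.instance Definition _ :=
  Measure_isSigmaFinite.Build _ _ _ prodm prodm_sigma_finite.

End product_measure.

Section calculus.
Context {R : realType}.

Definition iter_derive (V W : normedModType R) (vs : seq V) (F : V -> W) :
  V -> W := foldr (fun v G => fun x => 'D_v G x) F vs.

(* C^oo on a set D, meant for open D *)
Definition smooth (V W : normedModType R) (D : set V) (F : V -> W) : Prop :=
  forall (vs : seq V) (x : V), D x -> differentiable (iter_derive vs F) x.

(* C^oo_0(D), extended by zero outside D *)
Definition test_function (V : normedModType R) (D : set V) (phi : V -> R) :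
    Prop :=
  let supp := closure [set x | phi x != 0] in
  [/\ smooth setT phi, compact supp & supp `<=` D].

(* g' = h on D in the sense of distributions *)
Definition is_weak_derivative (D : set R) (g h : R -> R) : Prop :=
  [/\ locally_integrable D g, locally_integrable D h &
      forall psi : R -> R, test_function D psi ->
        \int[lebesgue_measure]_(t in D) (g t * (psi^`())%classic t) =
        - \int[lebesgue_measure]_(t in D) (h t * psi t)].

Definition component (i : 'I_3) (v : vec3 R) : R := [:: v.1.1; v.1.2; v.2]`_i.

Definition unit_vec (i : 'I_3) : vec3 R :=
  ((i == 0)%:R, (i == 1)%:R, (i == 2)%:R).

Definition dot (v w : vec3 R) : R := \sum_(i < 3) component i v * component i w.

Definition cross (v w : vec3 R) : vec3 R :=
  (v.1.2 * w.2 - v.2 * w.1.2,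
   v.2 * w.1.1 - v.1.1 * w.2,
   v.1.1 * w.1.2 - v.1.2 * w.1.1).

Implicit Type F : spacetime R -> vec3 R.

Definition dt F (y : spacetime R) : vec3 R :=
  'D_((0, 1) : spacetime R) F y.

(* the derivative of the i-th component of F along the j-th space direction *)
Definition partial F (i j : 'I_3) (y : spacetime R) : R :=
  'D_((unit_vec j, 0) : spacetime R) (component i \o F) y.

Definition divergence F (y : spacetime R) : R := \sum_(i < 3) partial F i i y.

Definition curl F (y : spacetime R) : vec3 R :=
  (partial F 2 1 y - partial F 1 2 y,
   partial F 0 2 y - partial F 2 0 y,
   partial F 1 0 y - partial F 0 1 y).

(* Lebesgue measure in dimensions 3, 4, 6 and 7 *)
Definition leb3 : {sigma_finite_measure set (mvec3 R) -> \bar R} :=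
  prodm (prodm (@lebesgue_measure R) (@lebesgue_measure R))
        (@lebesgue_measure R).

Definition leb4 : {sigma_finite_measure
    set (mvec3 R * measurableTypeR R)%type -> \bar R} :=
  prodm leb3 (@lebesgue_measure R).

Definition leb6 : {sigma_finite_measure
    set (mvec3 R * mvec3 R)%type -> \bar R} :=
  prodm leb3 leb3.

Definition leb7 : {sigma_finite_measure
    set (mvec3 R * mvec3 R * measurableTypeR R)%type -> \bar R} :=
  prodm leb6 (@lebesgue_measure R).

End calculus.

Section vlasov_maxwell.
Context {R : realType}.
Variables (m e c n0 T : R) (Omu Omx : set (vec3 R)).

Implicit Types (f phi : phase R -> R) (E B : spacetime R -> vec3 R).

Definition gamma (u : vec3 R) : R :=
  Num.sqrt (1 + dot u u / (m ^+ 2 * c ^+ 2)).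

Definition Omega : set (phase R) := Omu `*` Omx `*` `]0, T[.

(* the advection coefficients of the Vlasov equation in x and in u *)
Definition velocity (w : phase R) : vec3 R := (m * gamma w.1.1)^-1 *: w.1.1.

Definition force E B (w : phase R) : vec3 R :=
  let: (u, x, t) := w in
  e *: (E (x, t) + cross ((c * m * gamma u)^-1 *: u) (B (x, t))).

Definition density f (y : spacetime R) : R :=
  \int[leb3]_(u in Omu) f (u, y.1, y.2).

Definition current f (y : spacetime R) : vec3 R :=
  let J i := e / m * \int[leb3]_(u in Omu)
    (component i u / gamma u * f (u, y.1, y.2)) in
  (J 0, J 1, J 2).

(* The equations hold almost everywhere because the moments of a locally
   integrable f are only defined almost everywhere. *)
Definition maxwell f E B : Prop :=
  {ae leb4, forall y : spacetime R, (Omx `*` `]0, T[) y ->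
    [/\ - c^-1 *: dt E y + curl B y = (4 * pi / c) *: current f y,
        c^-1 *: dt B y + curl E y = 0,
        divergence E y = 4 * pi * e * (density f y - n0) &
        divergence B y = 0]}.

Definition phase_locally_integrable f : Prop :=
  forall K : set (phase R), compact K -> K `<=` Omega ->
    leb7.-integrable K (EFin \o f).

(* the pairing of the distributional derivative of g along v with phi,
   i.e. the integral of (d_v g) phi over Omega *)
Definition weak_pairing (g : phase R -> R) (v : phase R) phi : R :=
  - \int[leb7]_(w in Omega) (g w * 'D_v phi w).

Definition vlasov f E B : Prop :=
  forall phi, test_function Omega phi ->
    weak_pairing f (0, 0, 1) phi =
    - (\sum_(i < 3) weak_pairing
         (fun w => component i (velocity w) * f w) (0, unit_vec i, 0) phi)
    - (\sum_(i < 3) weak_pairing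
         (fun w => component i (force E B w) * f w) (unit_vec i, 0, 0) phi).

Definition distributional_solution f E B : Prop :=
  [/\ phase_locally_integrable f,
      smooth Omega velocity, smooth Omega (force E B),
      maxwell f E B & vlasov f E B].

(* f, as a class of functions modulo null sets, is supported in a compact set
   of phase space Omu * Omx, uniformly in time. *)
Definition compactly_supported f : Prop :=
  exists K : set (vec3 R * vec3 R),
    [/\ compact K, K `<=` Omu `*` Omx &
        {ae leb7, forall w : phase R, Omega w -> ~ K w.1 -> f w = 0}].

Definition field_square E B (y : spacetime R) : R :=
  dot (E y) (E y) + dot (B y) (B y).

Definition energy f E B (t : R) : R :=
  \int[leb6]_(z in Omu `*` Omx)
    (f (z, t) * (gamma z.1 - 1) * m * c ^+ 2) +
  (8 * pi)^-1 * \int[leb3]_(x in Omx) field_square E B (x, t).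

(* integrability over Omx, locally in time *)
Definition time_locally_integrable (g : spacetime R -> R) : Prop :=
  forall a b : R, 0 < a -> b < T ->
    leb4.-integrable (Omx `*` `[a, b]) (EFin \o g).

Definition finite_field_energy E B : Prop :=
  time_locally_integrable (field_square E B).

(* No net electromagnetic energy leaves Omx: the flux of E x B through the
   boundary of Omx, written as the integral of its divergence since no regularity
   of the boundary is assumed.  On a domain with boundary the energy is not
   conserved without such a condition, e.g. for f = 0 and a vacuum wave; on the
   whole space finiteness of the field energy already excludes a flux. *)
Definition no_net_poynting_flux E B : Prop :=
  let divS := divergence (fun y => cross (E y) (B y)) in
  time_locally_integrable divS /\
  {ae @lebesgue_measure R, forall t : R, `]0, T[%classic t ->
    \int[leb3]_(x in Omx) divS (x, t) = 0}.

End vlasov_maxwell.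

(* Main.v *)
Require Import Defs.
From HB Require Import structures.
From mathcomp Require Import finmap.
From mathcomp Require Import all_boot all_order all_algebra.
From mathcomp Require Import all_classical all_reals all_analysis.
From mathcomp Require Import measurable_realfun.
From mathcomp Require Import ring lra.
Import Order.TTheory GRing.Theory Num.Theory.
Import numFieldNormedType.Exports.
Local Open Scope classical_set_scope.
Local Open Scope ring_scope.
Set Implicit Arguments.
Unset Strict Implicit.
Unset Printing Implicit Defensive.

(* Test the Vlasov equation with (gamma(u) - 1) m c^2 chi(u, x) psi(t), where the
   cutoff chi is 1 near the support of f: the transport term in x drops out and,
   as u x B does no work, the kinetic energy K satisfies
   int K psi' = - int int (E . J) psi.
   Smoothness of the force makes E and B continuously differentiable, so that
   Maxwell's equations give Poynting's identity
   d_t (|E|^2 + |B|^2) = - 2 c div (E x B) - 8 pi E . J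
   almost everywhere.  Multiplying by psi and integrating by parts in time, the
   field energy compensates K exactly, provided that the divergence integrates to
   zero.  When Omx is not the whole space this is the flux hypothesis.  On the
   whole space the identity is first multiplied by a cutoff chi(x / n): since
   |E x B| is at most |E|^2 + |B|^2, the divergence then contributes O(1 / n), and
   dominated convergence removes the cutoff. *)

(** * Borel sets of products of lines *)

(** The force is smooth only as a single function on phase space, so the fields have to be extracted
    from it. This works because u / gamma(u) is not linear in u: comparing two momenta on one ray
    separates the magnetic part from the electric part. One continuous derivative of the fields is
    then what counts. The time derivative of the field energy density must be continuous along every
    time line, so that the fundamental theorem of calculus applies there; Maxwell's equations, known
    only almost everywhere, enter afterwards under the integral sign. No integrability is available
    up to the times 0 and T, hence every integral lives on a window [a, b] around the support of
    psi. The Vlasov equation integrates over ((u, x), t) but the current over u at fixed (x, t), so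
    Fubini's theorem is needed for both groupings. On the whole space div (E x B) is not known to be
    integrable; only its products with cutoffs are, which is why the estimate has to bear on E x B
    itself. *)

Section base.
Implicit Types T : topologicalType.

(* Sets of M playing the role of a base: they make every open set at once a
   countable union of sets of M and sigma-compact. *)
Definition compact_base T (M : set_system T) := exists B : nat -> set T,
  (forall n, M (B n) /\ compact (B n)) /\
  (forall U x, open U -> U x -> exists n, B n x /\ B n `<=` U).

Lemma compact_base_prod (T1 T2 : topologicalType) (M1 : set_system T1)
    (M2 : set_system T2) (M : set_system (T1 * T2)) :
  (forall A B, M1 A -> M2 B -> M (A `*` B)) ->
  compact_base M1 -> compact_base M2 -> compact_base M.
Proof.
move=> MM [B1 [MB1 B1P]] [B2 [MB2 B2P]].
(* Pairs of indices are enumerated through [pickle]; the default (0, 0) serves numbers that decode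
   to nothing, and its box is a legitimate member as well. *)
exists (fun n : nat => let: (i, j) :=
  odflt (0, 0)%N (unpickle n : option (nat * nat)) in B1 i `*` B2 j).
split=> [n|U [x y] oU Uxy].
  case: (odflt _ _) => i j; have [? ?] := MB1 i; have [? ?] := MB2 j.
  by split; [exact: MM|exact: compact_setX].
have : nbhs (x, y) U by exact: open_nbhs_nbhs.
move=> [[V W] /= [Vx Wy] VWU].
have [G1 [G1o G1x G1V]] : exists G, [/\ open G, G x & G `<=` V].
  by move: Vx; rewrite nbhsE => -[G [? ?] ?]; exists G.
have [G2 [G2o G2y G2W]] : exists G, [/\ open G, G y & G `<=` W].
  by move: Wy; rewrite nbhsE => -[G [? ?] ?]; exists G.
have [i [Bix BiG]] := B1P _ _ G1o G1x.
have [j [Bjy BjG]] := B2P _ _ G2o G2y.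
exists (pickle (i, j)); rewrite pickleK /=; split=> // -[a b] [/= Ba Bb].
by apply: VWU; split=> /=; [exact/G1V/BiG|exact/G2W/BjG].
Qed.

Lemma compact_base_open_bigcup T (M : set_system T) (U : set T) :
  compact_base M -> open U -> U !=set0 ->
  exists K : nat -> set T, (forall n, [/\ M (K n), compact (K n) & K n `<=` U])
    /\ U = \bigcup_n K n.
Proof.
move=> [B [MB BP]] oU [x0 Ux0]; have [n0 [_ Bn0]] := BP _ _ oU Ux0.
(* Base sets that leave [U] are replaced by [B n0], one that lies inside; its existence is why [U]
   must be nonempty. *)
exists (fun n => if `[< B n `<=` U >] then B n else B n0); split=> [n|].
  have [? ?] := MB n; have [? ?] := MB n0.
  by case: asboolP => BU.
rewrite predeqE => x; split=> [Ux|[n _]]; last by case: asboolP => BU; auto.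
have [n [Bnx BnU]] := BP _ _ oU Ux; exists n => //.
by case: asboolP.
Qed.

Lemma open_gt_continuous T (R : realType) (U : set T) (f : T -> R) (r : R) :
  open U -> (forall x, U x -> {for x, continuous f}) ->
  open (U `&` [set x | r < f x]).
Proof.
rewrite !openE => oU cf x [Ux rfx]; apply: filterI; first exact: oU.
exact: cvgr_gt _ (cf _ Ux) r rfx.
Qed.

End base.

(** The base consists of the closed intervals with rational endpoints: closed, so that they are
    compact, and rational, so that they are countable. *)
Lemma compact_base_R (R : realType) :
  @compact_base R (@measurable _ (measurableTypeR R)).
Proof.
exists (fun n : nat => let: (p, q) :=
  odflt (0, 0) (unpickle n : option (rat * rat)) in
  `[ratr p, ratr q]%classic); split=> [n|U x].
  by case: (odflt _ _) => p q; split; [exact: measurable_itv|exact: segment_compact].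
rewrite openE => /[apply]; rewrite /interior -nbhs_ballE => -[e /= e0 xeU].
have [p] := @rat_in_itvoo R (x - e) x ltac:(lra).
have [q] := @rat_in_itvoo R x (x + e) ltac:(lra).
rewrite !in_itv/= => /andP[xq qe] /andP[ep px].
exists (pickle (p, q)); rewrite pickleK /= in_itv/= !ltW//; split=> // y /=.
rewrite in_itv/= => /andP[py yq]; apply: xeU; rewrite /ball/= ltr_norml.
by apply/andP; split; lra.
Qed.

(* The topology is passed as a class on the carrier of X because the library
   attaches the Borel sigma-algebra to a tagged copy of R that carries no
   topology. *)
Section borel.
Context d (X : measurableType d) (cX : Topological.axioms_ X) (R : realType).
Let T : topologicalType := Topological.Pack cX.
Hypothesis XB : @compact_base T (@measurable d X).
Implicit Types (U K : set X) (f : X -> R).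

Lemma borel_open_sigma_compact U : @open T U -> U !=set0 ->
  exists K : nat -> set X,
    (forall n, [/\ measurable (K n), @compact T (K n) & K n `<=` U]) /\
    U = \bigcup_n K n.
Proof. exact: (compact_base_open_bigcup XB). Qed.

Lemma borel_open_measurable U : @open T U -> measurable U.
Proof.
move=> oU; have [->//|/set0P U0] := eqVneq U set0.
have [K [KP ->]] := borel_open_sigma_compact oU U0.
by apply: bigcupT_measurable => n; have [] := KP n.
Qed.

Lemma borel_closed_measurable U : @closed T U -> measurable U.
Proof.
by move=> cU; rewrite -(setCK U); exact/measurableC/borel_open_measurable/closed_openC.
Qed.

(** Local integrability speaks of compact subsets only; sigma-compactness of [U] carries the
    measurability that it yields to the whole of [U]. *)
Lemma borel_measurable_fun_local U f : @open T U ->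
  (forall K, @compact T K -> measurable K -> K `<=` U -> measurable_fun K f) ->
  measurable_fun U f.
Proof.
move=> oU mf; have [->|/set0P U0] := eqVneq U set0.
  exact: measurable_fun_set0.
have [K [KP ->]] := borel_open_sigma_compact oU U0.
apply/measurable_fun_bigcup => n; first by have [] := KP n.
by have [? ? ?] := KP n; exact: mf.
Qed.

Lemma borel_continuous_measurable U f : @open T U ->
  (forall x : T, U x -> {for x, continuous (f : T -> R)}) -> measurable_fun U f.
Proof.
move=> oU cf.
apply: (measurability _ (RGenOInfty.measurableE R)) => //.
move=> /= _ [_ [r ->] <-]; apply: borel_open_measurable.
by rewrite set_itvoy; exact: (@open_gt_continuous T).
Qed.

End borel.

(** * Fubini for real-valued integrals *)

Section fine_integral.
Context d (X : measurableType d) (R : realType) (mu : {measure set X -> \bar R}).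

(** Inner integrals in Fubini's theorem are extended reals. An integrable [G] is infinite on a null
    set at most, so passing to [fine] changes neither integrability nor the integral. *)
Lemma integrable_fine (D : set X) (G : X -> \bar R) : measurable D ->
  mu.-integrable D G ->
  mu.-integrable D (EFin \o (fine \o G)) /\
  (\int[mu]_(x in D) G x)%E = (\int[mu]_(x in D) (fine (G x))%:E)%E.
Proof.
move=> mD iG; have mG := measurable_int _ iG.
have mfG : measurable_fun D (EFin \o (fine \o G)).
  by apply/measurable_EFinP; apply: measurableT_comp => //.
split.
  apply: le_integrable mfG _ iG => // x Dx /=.
  by case: (G x) => [r||] /=; rewrite ?normr0 ?leey.
apply: ae_eq_integral => //.
have := integrable_ae mD iG; apply: filterS => x h Dx.
by rewrite fineK//; exact: h.
Qed.

Lemma Rintegral_ae_eq (D : set X) (g h : X -> R) : measurable D ->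
  measurable_fun D g -> measurable_fun D h ->
  {ae mu, forall x, D x -> g x = h x} ->
  \int[mu]_(x in D) g x = \int[mu]_(x in D) h x.
Proof.
move=> mD mg mh gh; rewrite /Rintegral; congr fine.
apply: ae_eq_integral => //; [exact/measurable_EFinP|exact/measurable_EFinP|].
by apply: filterS gh => x gh Dx; rewrite gh.
Qed.

Lemma integrable_ae_eq (D : set X) (g h : X -> R) : measurable D ->
  measurable_fun D h ->
  {ae mu, forall x, D x -> g x = h x} ->
  mu.-integrable D (EFin \o g) -> mu.-integrable D (EFin \o h).
Proof.
move=> mD mh gh ig; have mg := measurable_int _ ig.
have mh' : measurable_fun D (EFin \o h) by exact/measurable_EFinP.
apply/integrableP; split=> //; move/integrableP : ig => [_].
rewrite (@ge0_ae_eq_integral _ _ _ mu D (abse \o (EFin \o g)) (abse \o (EFin \o h)))//=.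
- exact: measurableT_comp.
- exact: measurableT_comp.
- by apply: filterS gh => x gh Dx /=; rewrite gh.
Qed.

End fine_integral.

Section slices.
Context d1 d2 (X1 : measurableType d1) (X2 : measurableType d2) (R : realType).
Variables (m1 : {sigma_finite_measure set X1 -> \bar R})
          (m2 : {sigma_finite_measure set X2 -> \bar R}).
Variables (A : set X1) (B : set X2) (g : X1 * X2 -> R).
Hypotheses (mA : measurable A) (mB : measurable B).
Hypothesis ig : (prodm m1 m2).-integrable (A `*` B) (EFin \o g).

Let h : X1 * X2 -> \bar R := (EFin \o g) \_ (A `*` B).

Let ih : (m1 \x m2)%E.-integrable setT h.
Proof. by apply/(integrable_mkcond _ _).1 => //; exact: measurableX. Qed.

Let hE x y : h (x, y) = if (x \in A) && (y \in B) then (g (x, y))%:E else 0%E.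
Proof. by rewrite /h patchE in_setX. Qed.

Let intE : (\int[prodm m1 m2]_(z in A `*` B) (g z)%:E = \int[(m1 \x m2)%E]_z h z)%E.
Proof. by rewrite integral_mkcond. Qed.

(** Setting [g] to zero off the rectangle reduces the claim to Fubini's theorem on the full product.
    The real integral of a slice that is not integrable carries no information, but such slices form
    a null set. *)
Lemma prodm_slice2 :
  [/\ m2.-integrable B (EFin \o (fun y => \int[m1]_(x in A) g (x, y))),
      {ae m2, forall y, B y -> m1.-integrable A (EFin \o (fun x => g (x, y)))} &
      \int[prodm m1 m2]_(z in A `*` B) g z =
      \int[m2]_(y in B) \int[m1]_(x in A) g (x, y)].
Proof.
pose G y := (\int[m1]_x h (x, y))%E.
have iG : m2.-integrable setT G.
  have mh := measurable_int _ ih.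
  have mah : measurable_fun setT (abse \o h) by exact: measurableT_comp.
  apply/integrableP; split; first exact: (measurable_fubini_G ih).
  (* By Tonelli the iterated integral of the absolute value of [h] is finite, and it dominates the
     integral of the absolute value of [G]. *)
  have hlt : (\int[m2]_y \int[m1]_x `|h (x, y)| < +oo)%E.
    exact: (proj1 (integrable21ltyP m1 m2 mh) ih).
  apply: le_lt_trans hlt.
  apply: ge0_le_integral => //.
  - by apply: measurableT_comp => //; exact: (measurable_fubini_G ih).
  - by apply: (measurable_fun_fubini_tonelli_G (abse \o h)) => // z; exact: abse_ge0.
  - move=> y _; apply: le_abse_integral => //.
    by apply: (measurableT_comp mh); apply: measurable_fun_pair => //; exact: measurable_cst.
have GB y : B y -> G y = (\int[m1]_(x in A) (g (x, y))%:E)%E.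
  move=> By; rewrite /G [RHS]integral_mkcond; apply: eq_integral => x _.
  by rewrite hE (mem_set By) andbT patchE.
have GNB y : ~ B y -> G y = 0%E.
  move=> By; rewrite /G integral0_eq// => x _.
  by rewrite hE (memNset By) andbF.
have iGB : m2.-integrable B G by exact: integrableS iG.
have [iGf GE] := integrable_fine mB iGB.
split.
- apply: eq_integrable iGf => // y /set_mem By.
  by rewrite /= GB.
- have := ae_integrable2 ih; apply: filterS => y hy By.
  apply/(integrable_mkcond _ _).2 => //.
  apply: eq_integrable hy => // x _.
  by rewrite hE (mem_set By) andbT patchE.
- rewrite [LHS]/Rintegral intE -integral21_prod_meas1//.
  have -> : (\int[m2]_y fubini_G m1 h y = \int[m2]_(y in B) G y)%E.
    rewrite [RHS]integral_mkcond; apply: eq_integral => y _.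
    rewrite patchE; case: ifPn => //; rewrite notin_setE => /GNB.
    by rewrite -/(G y).
  rewrite GE /Rintegral; congr fine; apply: eq_integral => y /set_mem By.
  by rewrite GB.
Qed.

Lemma prodm_slice1 :
  [/\ m1.-integrable A (EFin \o (fun x => \int[m2]_(y in B) g (x, y))),
      {ae m1, forall x, A x -> m2.-integrable B (EFin \o (fun y => g (x, y)))} &
      \int[prodm m1 m2]_(z in A `*` B) g z =
      \int[m1]_(x in A) \int[m2]_(y in B) g (x, y)].
Proof.
pose G x := (\int[m2]_y h (x, y))%E.
have iG : m1.-integrable setT G by exact: (integrable_fubini_F ih).
have GA x : A x -> G x = (\int[m2]_(y in B) (g (x, y))%:E)%E.
  move=> Ax; rewrite /G [RHS]integral_mkcond; apply: eq_integral => y _.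
  by rewrite hE (mem_set Ax) andTb patchE.
have GNA x : ~ A x -> G x = 0%E.
  move=> Ax; rewrite /G integral0_eq// => y _.
  by rewrite hE (memNset Ax).
have iGA : m1.-integrable A G by exact: integrableS iG.
have [iGf GE] := integrable_fine mA iGA.
split.
- apply: eq_integrable iGf => // x /set_mem Ax.
  by rewrite /= GA.
- have := ae_integrable1 ih; apply: filterS => x hx Ax.
  apply/(integrable_mkcond _ _).2 => //.
  apply: eq_integrable hx => // y _.
  by rewrite hE (mem_set Ax) andTb patchE.
- rewrite [LHS]/Rintegral intE -integral12_prod_meas1//.
  have -> : (\int[m1]_x fubini_F m2 h x = \int[m1]_(x in A) G x)%E.
    rewrite [RHS]integral_mkcond; apply: eq_integral => x _.
    rewrite patchE; case: ifPn => //; rewrite notin_setE => /GNA.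
    by rewrite -/(G x).
  rewrite GE /Rintegral; congr fine; apply: eq_integral => x /set_mem Ax.
  by rewrite GA.
Qed.

End slices.

Section associativity.
Context d1 d2 d3 (X1 : measurableType d1) (X2 : measurableType d2)
  (X3 : measurableType d3) (R : realType).
Variables (m1 : {sigma_finite_measure set X1 -> \bar R})
          (m2 : {sigma_finite_measure set X2 -> \bar R})
          (m3 : {sigma_finite_measure set X3 -> \bar R}).

Let assoc (w : X1 * X2 * X3) : X1 * (X2 * X3) := (w.1.1, (w.1.2, w.2)).

Let unassoc (w : X1 * (X2 * X3)) : X1 * X2 * X3 := ((w.1, w.2.1), w.2.2).

Let massoc : measurable_fun setT assoc.
Proof.
apply: measurable_fun_pair; first exact: measurableT_comp.
by apply: measurable_fun_pair => //; exact: measurableT_comp.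
Qed.

Let munassoc : measurable_fun setT unassoc.
Proof.
apply: measurable_fun_pair; last exact: measurableT_comp.
by apply: measurable_fun_pair => //; exact: measurableT_comp.
Qed.

(** Uniqueness of product measures: it suffices to compare on [P] times [C] with [P] an arbitrary
    measurable subset of the first two factors. There the regrouped slice at x is [xsection P x]
    times [C], so the factor [m3 C] leaves the integral over x. *)
Lemma prodmA (S : set (X1 * X2 * X3)) : measurable S ->
  (prodm (prodm m1 m2) m3 S = prodm m1 (prodm m2 m3) (unassoc @^-1` S))%E.
Proof.
pose mu : {measure set (X1 * X2 * X3) -> \bar R} :=
  pushforward (prodm m1 (prodm m2 m3)) unassoc.
have := @product_measure_unique _ _ _ _ _ (prodm m1 m2) m3 (mu munassoc).
apply => P C mP mC.
rewrite /mu /= /pushforward /=.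
have mPC : measurable (unassoc @^-1` (P `*` C)).
  by rewrite -[X in measurable X]setTI; apply: munassoc => //; exact: measurableX.
rewrite /prodm /product_measure1 /=.
rewrite -ge0_integralZr//; last exact: measurable_fun_xsection.
apply: eq_integral => x _ /=.
rewrite [X in prodm _ _ X](_ : _ = xsection P x `*` C).
  by rewrite [LHS]product_measure1E//; exact: measurable_xsection.
by apply/seteqP; split=> -[y z]; rewrite /xsection/= !inE.
Qed.

Variables (A : set X1) (B : set X2) (C : set X3) (g : X1 * X2 * X3 -> R).
Hypotheses (mA : measurable A) (mB : measurable B) (mC : measurable C).
Hypothesis ig : (prodm (prodm m1 m2) m3).-integrable (A `*` B `*` C) (EFin \o g).

(** Density and current integrate over the momentum at fixed (x, t), whereas the seven-dimensional
    measure pairs momentum with position first. Transporting the integral along [assoc] brings the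
    first factor alone to the inside. *)
Lemma prodmA_slice2 :
  [/\ (prodm m2 m3).-integrable (B `*` C)
        (EFin \o (fun y => \int[m1]_(x in A) g (x, y.1, y.2))),
      {ae prodm m2 m3, forall y, (B `*` C) y ->
         m1.-integrable A (EFin \o (fun x => g (x, y.1, y.2)))} &
      \int[prodm (prodm m1 m2) m3]_(z in A `*` B `*` C) g z =
      \int[prodm m2 m3]_(y in B `*` C) \int[m1]_(x in A) g (x, y.1, y.2)].
Proof.
have mABC : measurable (A `*` B `*` C) by do 2 apply: measurableX => //.
have mBC : measurable (B `*` C) by exact: measurableX.
pose h := (EFin \o g) \_ (A `*` B `*` C).
have ih : (prodm (prodm m1 m2) m3).-integrable setT h.
  exact/(integrable_mkcond _ _).1.
have mh := measurable_int _ ih.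
pose mu' : {measure set (X1 * (X2 * X3)) -> \bar R} :=
  pushforward (prodm (prodm m1 m2) m3) assoc.
pose mu := mu' massoc.
have muE S : measurable S -> mu S = prodm m1 (prodm m2 m3) S.
  move=> mS; rewrite /mu /= /pushforward prodmA.
    by congr (prodm _ _ _); apply/seteqP; split=> -[? [? ?]].
  by rewrite -[X in measurable X]setTI; exact: massoc.
have hE : h \o unassoc = (EFin \o (g \o unassoc)) \_ (A `*` (B `*` C)).
  apply/funext => -[x [y z]]; rewrite /h /= !patchE.
  by rewrite !in_setX /= andbA.
have mhu : measurable_fun setT (h \o unassoc) by exact: measurableT_comp.
have hK : (h \o unassoc) \o assoc = h by apply/funext => -[[]].
have ihu : (prodm m1 (prodm m2 m3)).-integrable setT (h \o unassoc).
  apply/integrableP; split=> //.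
  rewrite (eq_measure_integral mu); last by move=> S mS _; rewrite muE.
  have : mu.-integrable setT (h \o unassoc).
    by apply: integrable_pushforward => //; rewrite hK.
  by move/integrableP => -[].
have igu : (prodm m1 (prodm m2 m3)).-integrable (A `*` (B `*` C))
    (EFin \o (g \o unassoc)).
  by apply/integrable_mkcond; [exact: measurableX|rewrite -hE].
have [iG aeG GE] := prodm_slice2 mA mBC igu.
split.
- by apply: eq_integrable iG => // -[y z] _.
- by apply: filterS aeG => -[y z].
- rewrite -[RHS]GE {1}/Rintegral integral_mkcond -/h.
  rewrite [RHS](_ : _ = fine (\int[mu]_z (h \o unassoc) z)%E).
    by rewrite integral_pushforward// ?hK// preimage_setT.
  rewrite /Rintegral integral_mkcond.
  rewrite (eq_measure_integral mu); last by move=> S mS _; rewrite muE.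
  by congr fine; apply: eq_integral => z _; rewrite hE.
Qed.

End associativity.

(** * Smooth functions and cutoffs *)

Section smooth_functions.
Context {R : realType}.

(** The recursion on the order lets product and chain rules go by induction, which lists of
    directions do not. Level [n] means that all derivatives up to order [n] are differentiable, so
    level 0 already gives differentiability. *)
Fixpoint Ck (V : normedModType R) (n : nat) (F : V -> R) : Prop :=
  (forall x, differentiable F x) /\
  (if n is n'.+1 then forall v, Ck n' (fun x => 'D_v F x) else True).

Section general.
Context (V : normedModType R).
Implicit Types (F G : V -> R) (n : nat).

Lemma Ck_diff n F x : Ck n F -> differentiable F x.
Proof. by case: n => [|n] -[]. Qed.

Lemma CkW n F : Ck n.+1 F -> Ck n F.
Proof.
elim: n F => [|n IH] F [dF FD]; split=> //.
by move=> v; apply: IH; exact: FD.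
Qed.

Lemma smooth_Ck F : smooth setT F <-> forall n, Ck n F.
Proof.
(* Under [foldr] the last direction of the list is differentiated first, so lists have to be peeled
   from the right. *)
have rconsE vs v G : iter_derive (rcons vs v) G = iter_derive vs (fun x => 'D_v G x).
  by rewrite /iter_derive foldr_rcons.
split=> [sF n|].
  elim: n F sF => [|n IH] F sF; split=> //.
  - by move=> x; exact: (sF [::]).
  - by move=> x; exact: (sF [::]).
  - by move=> v; apply: IH => vs x _; rewrite -rconsE; exact: sF.
move=> CF vs x _; elim/last_ind: vs F CF => [|vs v IH] F CF.
  exact: Ck_diff (CF 0%N).
by rewrite rconsE; apply: IH => n; have [_] := CF n.+1; exact.
Qed.

Lemma derive_differentiableM F G v x : differentiable F x -> differentiable G x ->
  'D_v (fun y => F y * G y) x = F x * 'D_v G x + G x * 'D_v F x.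
Proof. by move=> dF dG; rewrite deriveM//; exact: diff_derivable. Qed.

Lemma Ck_cst n (r : R) : Ck n (fun _ : V => r).
Proof.
elim: n r => [|n IH] r; split=> // v.
rewrite (_ : (fun x => 'D_v _ x) = fun=> 0) //.
by apply/funext => x; exact: derive_cst.
Qed.

Lemma Ck_add n F G : Ck n F -> Ck n G -> Ck n (fun x => F x + G x).
Proof.
elim: n F G => [|n IH] F G [dF CF] [dG CG]; split=> //.
- by move=> x; apply: differentiableD.
- by move=> x; apply: differentiableD.
- move=> v; rewrite (_ : (fun x => 'D_v _ x) = fun x => 'D_v F x + 'D_v G x).
    apply: (IH (fun x => 'D_v F x) (fun x => 'D_v G x)); [exact: CF|exact: CG].
  by apply/funext => x; rewrite deriveD//; exact: diff_derivable.
Qed.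

Lemma Ck_mul n F G : Ck n F -> Ck n G -> Ck n (fun x => F x * G x).
Proof.
elim: n F G => [|n IH] F G CF CG.
  have [dF _] := CF; have [dG _] := CG.
  by split=> // x; apply: differentiableM.
have [dF CF'] := CF; have [dG CG'] := CG.
split=> [x|v]; first by apply: differentiableM.
rewrite (_ : (fun x => 'D_v _ x) = fun x => F x * 'D_v G x + G x * 'D_v F x).
  by apply: Ck_add; (apply: IH; first exact: CkW); [exact: CG'|exact: CF'].
by apply/funext => x; rewrite derive_differentiableM.
Qed.

Lemma Ck_opp n F : Ck n F -> Ck n (fun x => - F x).
Proof.
move=> CF; rewrite (_ : (fun x => _) = fun x => -1 * F x).
  by apply: Ck_mul => //; exact: Ck_cst.
by apply/funext => x; rewrite mulN1r.
Qed.

(** The derivative of 1 / F is a polynomial in 1 / F and the derivative of F, so the induction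
    hypothesis at the lower order applies to it. *)
Lemma Ck_inv n F : (forall x, F x != 0) -> Ck n F -> Ck n (fun x => (F x)^-1).
Proof.
move=> F0; elim: n => [|n IH] CF.
  by have [dF _] := CF; split=> // x; apply: differentiableV.
have [dF CF'] := CF; split=> [x|v]; first by apply: differentiableV.
rewrite (_ : (fun x => 'D_v _ x) = fun x => - ((F x)^-1 * (F x)^-1 * 'D_v F x)).
  apply: Ck_opp; apply: Ck_mul; last exact: CF'.
  by apply: Ck_mul; apply: IH; exact: CkW.
apply/funext => x; rewrite deriveV//; last exact: diff_derivable.
by rewrite -exprVn expr2 scaleNr.
Qed.

Lemma linear_derive (W : normedModType R) (F : {linear V -> W}) x v :
  continuous F -> 'D_v F x = F v.
Proof.
move=> cF; rewrite deriveE; last exact: linear_differentiable.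
by rewrite diff_lin.
Qed.

Lemma Ck_linear n (F : {linear V -> R}) : continuous F -> Ck n F.
Proof.
move=> cF; case: n => [|n]; split=> //; try (move=> x; exact: linear_differentiable).
move=> v; rewrite (_ : (fun x => 'D_v _ x) = fun=> F v); first exact: Ck_cst.
by apply/funext => x; exact: linear_derive.
Qed.

Lemma derive_comp1 (h : R -> R) F x v :
  differentiable F x -> differentiable h (F x) ->
  'D_v (fun y => h (F y)) x = 'D_v F x * 'D_1 h (F x).
Proof.
move=> dF dh; have dhF : differentiable (h \o F) x by exact: differentiable_comp.
rewrite -[LHS]/('D_v (h \o F) x) deriveE// diff_comp//= !deriveE//.
by rewrite -{1}[('d F x) v]mulr1 -/('d F x v *: 1) linearZ.
Qed.

Lemma Ck_comp n (h : R -> R) F : Ck n h -> Ck n F -> Ck n (fun x => h (F x)).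
Proof.
elim: n h => [|n IH] h Ch CF.
  have [dF _] := CF; have [dh _] := Ch.
  by split=> // x; exact: differentiable_comp.
have [dF CF'] := CF; have [dh Ch'] := Ch.
split=> [x|v]; first exact: differentiable_comp.
rewrite (_ : (fun x => 'D_v _ x) = fun x => 'D_v F x * 'D_1 h (F x)).
  apply: Ck_mul; first exact: CF'.
  by apply: (IH ('D_1 h)); [exact: Ch'|exact: CkW].
by apply/funext => x; rewrite derive_comp1.
Qed.

End general.
End smooth_functions.

(** * Smooth cutoffs built from exp(-1/x) *)

Section cutoff.
Context {R : realType}.

(* The family is closed under differentiation up to linear combinations, which is
   why the power is included. *)
Definition flat_exp (k : nat) (x : R) : R :=
  if 0 < x then x^-1 ^+ k * expR (- x^-1) else 0.

Lemma flat_exp_gt0 k x : 0 < x -> 0 < flat_exp k x.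
Proof.
by move=> x0; rewrite /flat_exp x0 mulr_gt0 ?expR_gt0// exprn_gt0// invr_gt0.
Qed.

Lemma flat_exp_le0 k x : x <= 0 -> flat_exp k x = 0.
Proof. by move=> x0; rewrite /flat_exp ltNge x0. Qed.

Lemma flat_exp_ge0 k x : 0 <= flat_exp k x.
Proof.
by have [x0|x0] := ltP 0 x; [exact/ltW/flat_exp_gt0|rewrite flat_exp_le0].
Qed.

(** With y = 1/x, one term of the exponential series gives exp(y) >= y^(k+2) / (k+2)!. The exponent
    k + 2 leaves two powers of x to spare, as differentiability at 0 demands. *)
Lemma flat_exp_le_sqr k x : flat_exp k x <= k.+2`!%:R * x ^+ 2.
Proof.
have [x0|x0] := ltP 0 x; last by rewrite flat_exp_le0// mulr_ge0 ?ler0n ?sqr_ge0.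
rewrite /flat_exp x0 expRN ler_pdivrMr ?expR_gt0//.
have y0 : 0 <= x^-1 by rewrite invr_ge0 ltW.
have := expR_ge1Dxn k.+1 y0; set y := x^-1 => le1.
have fk : 0 < k.+2`!%:R :> R by rewrite ltr0n fact_gt0.
have le2 : y ^+ k.+2 <= k.+2`!%:R * expR y.
  by rewrite -ler_pdivrMl// mulrC; apply: le_trans le1; rewrite lerDr.
rewrite mulrAC (le_trans _ (ler_wpM2r (sqr_ge0 x) le2))//.
by rewrite -addn2 exprD -mulrA -exprMn mulVf ?gt_eqF// expr1n mulr1.
Qed.

Lemma flat_exp_is_derive (k : nat) (x : R) :
  is_derive x 1 (flat_exp k) (flat_exp k.+2 x - k%:R * flat_exp k.+1 x).
Proof.
have [x0|x0|<-] := ltgtP 0 x.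
- have xnear : \forall y \near x, y^-1 ^+ k * expR (- y^-1) = flat_exp k y.
    by apply: filterS (lt_nbhsr x0) => y y0; rewrite /flat_exp y0.
  apply: (near_eq_is_derive xnear).
  have xn0 : x != 0 by rewrite gt_eqF.
  have dV : is_derive x 1 (fun y : R => y^-1) (- x^-1 ^+ 2).
    have := is_deriveV xn0 (is_derive_id x 1).
    by move=> d; apply: (is_derive_eq d); rewrite /GRing.scale/= mulr1 exprVn.
  have dN : is_derive x 1 (fun y : R => - y^-1) (x^-1 ^+ 2).
    by apply: is_derive_eq; rewrite opprK.
  have dE : is_derive x 1 (fun y : R => expR (- y^-1)) (x^-1 ^+ 2 * expR (- x^-1)).
    have de := is_derive_expR (- x^-1).
    have /is_derive_eq := @is_derive1_comp R expR (fun y => - y^-1) x _ _ de dN.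
    by apply; rewrite mulrC.
  have dX : is_derive x 1 (fun y : R => y^-1 ^+ k) (- (k%:R * x^-1 ^+ k.+1)).
    case: k {xnear} => [|k].
      by rewrite mul0r oppr0; exact: is_derive_cst.
    rewrite (_ : (fun y : R => _) = (fun y : R => y^-1) ^+ k.+1); last first.
      by apply/funext => y; rewrite exprfctE.
    apply: (is_derive_eq (is_deriveX k.+1 dV)).
    by rewrite /GRing.scale/= mulrN -mulrA -exprD addn2.
  apply: (is_derive_eq (is_deriveM dX dE)).
  rewrite /flat_exp x0 /GRing.scale/= !exprS.
  by ring.
- rewrite !flat_exp_le0 ?ltW// mulr0 subr0.
  have xnear : \forall y \near x, cst 0 y = flat_exp k y.
    by apply: filterS (lt_nbhsl x0) => y /ltW y0; rewrite flat_exp_le0.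
  by apply: (near_eq_is_derive xnear); exact: is_derive_cst.
(* At 0 the formula breaks off, and the difference quotient is estimated directly: by the quadratic
   bound it is at most (k+2)! |h|. *)
- rewrite !flat_exp_le0// mulr0 subr0.
  suff c : (fun h : R => h^-1 *: (flat_exp k (h *: 1 + 0) - flat_exp k 0)) @ 0^' --> (0 : R).
    by apply: DeriveDef; [exact: (cvgP _ c)|exact: (cvg_lim _ c)].
  apply/cvgr0Pnorm_lt => e e0.
  have fk : 0 < k.+2`!%:R :> R by rewrite ltr0n fact_gt0.
  near=> h.
  have h0 : h != 0 by near: h; exact: nbhs_dnbhs_neq.
  have he : `|h| < e / k.+2`!%:R.
    near: h; apply: dnbhs0_lt; exact: divr_gt0.
  rewrite (flat_exp_le0 _ (lexx 0)) subr0 addr0 normrZ normfV.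
  rewrite (ger0_norm (flat_exp_ge0 _ _)) /GRing.scale/= mulr1.
  rewrite mulrC ltr_pdivrMr ?normr_gt0//.
  apply: le_lt_trans (flat_exp_le_sqr k h) _.
  rewrite -[h ^+ 2]real_normK ?num_real// expr2 mulrA ltr_pM2r ?normr_gt0//.
  by rewrite mulrC -ltr_pdivlMr.
Unshelve. all: by end_near. Qed.

Lemma derive_R (h : R -> R) (x v : R) : differentiable h x ->
  'D_v h x = v * 'D_1 h x.
Proof.
by move=> dh; rewrite !deriveE// -{1}[v]mulr1 -[v * 1]/(v *: 1) linearZ.
Qed.

Lemma Ck_flat_exp n k : Ck n (flat_exp k).
Proof.
have dif i x : differentiable (flat_exp i) x.
  by apply/derivable1_diffP; have [] := flat_exp_is_derive i x.
elim: n k => [|n IH] k; split=> // v.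
rewrite (_ : (fun x => 'D_v _ x) =
    fun x => v * (flat_exp k.+2 x + - (k%:R * flat_exp k.+1 x))).
  apply: Ck_mul; first exact: Ck_cst.
  apply: Ck_add => //; apply: Ck_opp; apply: Ck_mul => //; exact: Ck_cst.
apply/funext => x; rewrite derive_R//; congr (v * _).
by have [] := flat_exp_is_derive k x.
Qed.

(** The standard smooth transition between 0 and 1. Its denominator is positive because [x] and
    [1 - x] are never both nonpositive. *)
Definition step (x : R) : R := flat_exp 0 x / (flat_exp 0 x + flat_exp 0 (1 - x)).

Let step_denom_gt0 x : 0 < flat_exp 0 x + flat_exp 0 (1 - x).
Proof.
have [x0|x0] := ltP 0 x.
  by rewrite ltr_pwDl ?flat_exp_gt0 ?flat_exp_ge0.
by rewrite ltr_wpDl ?flat_exp_gt0 ?flat_exp_ge0//; lra.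
Qed.

Lemma Ck_affine n (a b : R) : Ck n (fun x : R => a * x + b).
Proof.
apply: Ck_add; last exact: Ck_cst.
apply: Ck_mul; first exact: Ck_cst.
have /= := @Ck_linear R R n idfun; apply; by move=> ?; exact: cvg_id.
Qed.

Lemma Ck_step n : Ck n step.
Proof.
apply: Ck_mul; first exact: Ck_flat_exp.
apply: Ck_inv => [x|]; first by rewrite gt_eqF.
apply: Ck_add; first exact: Ck_flat_exp.
rewrite (_ : (fun x => _) = fun x => flat_exp 0 (-1 * x + 1)).
  by apply: (Ck_comp (Ck_flat_exp n 0) (Ck_affine n _ _)).
by apply/funext => x; congr flat_exp; ring.
Qed.

Lemma step_le0 x : x <= 0 -> step x = 0.
Proof. by move=> x0; rewrite /step flat_exp_le0// mul0r. Qed.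

Lemma step_ge1 x : 1 <= x -> step x = 1.
Proof.
move=> x1; rewrite /step [flat_exp 0 (1 - x)]flat_exp_le0 ?subr_le0// addr0.
by rewrite divff// gt_eqF// flat_exp_gt0//; lra.
Qed.

Lemma step_ge0 x : 0 <= step x.
Proof. by rewrite divr_ge0 ?flat_exp_ge0// ltW. Qed.

Lemma step_le1 x : step x <= 1.
Proof. by rewrite ler_pdivrMr// mul1r lerDl flat_exp_ge0. Qed.

Definition cutoff (x : R) : R := step (2 + x) * step (2 - x).

Lemma Ck_cutoff n : Ck n cutoff.
Proof.
apply: Ck_mul.
  rewrite (_ : (fun x => _) = fun x => step (1 * x + 2)).
    by apply: (Ck_comp (Ck_step n) (Ck_affine n _ _)).
  by apply/funext => x; congr step; ring.
rewrite (_ : (fun x => _) = fun x => step (-1 * x + 2)).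
  by apply: (Ck_comp (Ck_step n) (Ck_affine n _ _)).
by apply/funext => x; congr step; ring.
Qed.

Lemma cutoff_eq1 x : `|x| <= 1 -> cutoff x = 1.
Proof. by rewrite ler_norml => ?; rewrite /cutoff !step_ge1 ?mulr1//; lra. Qed.

Lemma cutoff_eq0 x : 2 <= `|x| -> cutoff x = 0.
Proof.
rewrite ler_normr /cutoff => /orP[?|?].
  by rewrite [step (2 - x)]step_le0 ?mulr0//; lra.
by rewrite step_le0 ?mul0r//; lra.
Qed.

Lemma cutoff_ge0 x : 0 <= cutoff x.
Proof. by rewrite mulr_ge0 ?step_ge0. Qed.

Lemma cutoff_le1 x : cutoff x <= 1.
Proof. by rewrite mulr_ile1 ?step_ge0 ?step_le1. Qed.

End cutoff.

Section bumps.
Context {R : realType}.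

Lemma derive_comp_linear (V W : normedModType R) (L : {linear V -> W})
    (F : W -> R) x v : continuous L -> differentiable F (L x) ->
  'D_v (fun y => F (L y)) x = 'D_(L v) F (L x).
Proof.
move=> cL dF; have dL : differentiable L x by exact: linear_differentiable.
rewrite -[LHS]/('D_v (F \o L) x) deriveE; last exact: differentiable_comp.
by rewrite diff_comp//= deriveE// diff_lin.
Qed.

Lemma Ck_comp_linear (V W : normedModType R) n (L : {linear V -> W})
    (F : W -> R) : continuous L -> Ck n F -> Ck n (fun x => F (L x)).
Proof.
move=> cL; elim: n F => [|n IH] F CF.
  have [dF _] := CF; split=> // x.
  by apply: (differentiable_comp (f := L)) => //; exact: linear_differentiable.
have [dF CF'] := CF; split=> [x|v].
  by apply: (differentiable_comp (f := L)) => //; exact: linear_differentiable.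
rewrite (_ : (fun x => 'D_v _ x) = fun x => 'D_(L v) F (L x)).
  by apply: (IH (fun y => 'D_(L v) F y)); exact: CF'.
by apply/funext => x; rewrite derive_comp_linear.
Qed.

Lemma Ck_fst (V W : normedModType R) n (F : V -> R) :
  Ck n F -> Ck n (fun x : V * W => F x.1).
Proof.
by apply: (@Ck_comp_linear (V * W)%type V n fst F) => x; exact: cvg_fst.
Qed.

Lemma Ck_snd (V W : normedModType R) n (F : W -> R) :
  Ck n F -> Ck n (fun x : V * W => F x.2).
Proof.
by apply: (@Ck_comp_linear (V * W)%type W n snd F) => x; exact: cvg_snd.
Qed.

(** The value 1 is required on an open neighbourhood of [A] so that the derivatives of the cutoff
    vanish on [A]; being 1 on [A] alone would not give this. *)
Definition smooth_cutoff (V : normedModType R) (A U : set V) :=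
  exists chi : V -> R, [/\ forall n, Ck n chi,
    exists G, [/\ open G, A `<=` G & forall x, G x -> chi x = 1] &
    exists C, [/\ compact C, C `<=` U & forall x, ~ C x -> chi x = 0]].

Definition has_bumps (V : normedModType R) :=
  forall (p : V) (U : set V), open U -> U p -> smooth_cutoff [set p] U.

Lemma has_bumps_R : has_bumps R.
Proof.
move=> p U; rewrite openE => /[apply]; rewrite /interior -nbhs_ballE.
move=> -[e /= e0 eU].
(* [cutoff] vanishes beyond 2, so the bump vanishes beyond distance 2 / k = 2e / 3, safely inside
   the ball of radius e. *)
pose k := 3 / e; have k0 : 0 < k by exact: divr_gt0.
have kE (x : R) : `|k * x + - (k * p)| = k * `|x - p|.
  by rewrite -mulrBr normrM gtr0_norm.
exists (fun x => cutoff (k * x + - (k * p))); split.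
- by move=> n; apply: (Ck_comp (Ck_cutoff n) (Ck_affine n _ _)).
- exists (ball p k^-1); split; first by apply: ball_open; rewrite invr_gt0.
    by move=> _ ->; apply: ballxx; rewrite invr_gt0.
  move=> x; rewrite /ball/= distrC => /ltW h; apply: cutoff_eq1; rewrite kE.
  by rewrite -ler_pdivlMl// mulr1.
- exists `[p - 2 / k, p + 2 / k]%classic; split; first exact: segment_compact.
    move=> x /=; rewrite in_itv/= => /andP[h1 h2]; apply: eU; rewrite /ball/=.
    have ek : 2 / k < e by rewrite /k invf_div mulrA ltr_pdivrMr// mulrC ltr_pM2l//; lra.
    by rewrite ltr_norml; apply/andP; split; lra.
  move=> x /= /negP; rewrite in_itv/= negb_and -!ltNge => h.
  apply: cutoff_eq0; rewrite kE -ler_pdivrMl// mulrC ler_normr.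
  by case/orP: h => h; apply/orP; [right|left]; lra.
Qed.

Lemma has_bumps_prod (V W : normedModType R) :
  has_bumps V -> has_bumps W -> has_bumps (V * W)%type.
Proof.
move=> bV bW [p q] U oU Upq.
have : nbhs (p, q) U by exact: open_nbhs_nbhs.
move=> [[P Q] /= [Pp Qq] PQU].
have [G1 [G1o G1p G1P]] : exists G, [/\ open G, G p & G `<=` P].
  by move: Pp; rewrite nbhsE => -[G [? ?] ?]; exists G.
have [G2 [G2o G2q G2Q]] : exists G, [/\ open G, G q & G `<=` Q].
  by move: Qq; rewrite nbhsE => -[G [? ?] ?]; exists G.
have [f [Cf [A [oA Ap Af]] [B [cB BG fB]]]] := bV p _ G1o G1p.
have [g [Cg [A' [oA' A'q A'g]] [B' [cB' B'G gB']]]] := bW q _ G2o G2q.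
exists (fun x => f x.1 * g x.2); split.
- by move=> n; apply: Ck_mul; [apply: Ck_fst|apply: Ck_snd].
- exists (A `*` A'); split.
    rewrite openE => -[x y] [/= Ax A'y]; exists (A, A') => //=.
    by split; exact: open_nbhs_nbhs.
    by move=> _ ->; split => /=; [exact: Ap|exact: A'q].
  by move=> [x y] [/= Ax A'y]; rewrite Af// A'g// mulr1.
- exists (B `*` B'); split; first exact: compact_setX.
    by move=> [x y] [/= Bx B'y]; apply: PQU; split=> /=; [exact/G1P/BG|exact/G2Q/B'G].
  move=> [x y] /= /not_andP[Bx|By]; first by rewrite fB ?mul0r.
  by rewrite gB' ?mulr0.
Qed.

Lemma smooth_cutoff_setU (V : normedModType R) (A B U : set V) :
  smooth_cutoff A U -> smooth_cutoff B U -> smooth_cutoff (A `|` B) U.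
Proof.
move=> [f [Cf [G [oG AG fG]] [C [cC CU fC]]]].
move=> [g [Cg [G' [oG' BG' gG']] [C' [cC' CU' gC']]]].
(* This is 1 - (1 - f)(1 - g): equal to 1 where either factor is 1, to 0 where both vanish, and
   smooth, unlike a maximum. *)
exists (fun x => f x + (g x + - (f x * g x))); split.
- by move=> n; do 2 (apply: Ck_add => //); apply: Ck_opp; exact: Ck_mul.
- exists (G `|` G'); split; [exact: openU|exact: setUSS|].
  by move=> x [/fG ->|/gG' ->]; ring.
- exists (C `|` C'); split; first exact: compactU.
    by move=> x [/CU|/CU'].
  by move=> x /not_orP[/fC -> /gC' ->]; ring.
Qed.

Lemma smooth_cutoff_compact (V : normedModType R) (K U : set V) :
  has_bumps V -> compact K -> open U -> K `<=` U -> smooth_cutoff K U.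
Proof.
move=> bV cK oU KU.
(* Points outside [K] receive the empty set, so that [choice] yields a family indexed by the whole
   space. *)
have loc p : exists G, open G /\ (K p -> G p /\ smooth_cutoff G U).
  have [Kp|nKp] := pselect (K p); last by exists set0; split=> //; exact: open0.
  have [f [Cf [G [oG pG fG]] fC]] := bV p U oU (KU _ Kp).
  exists G; split=> // _; split; first exact: pG.
  by exists f; split=> //; exists G; split.
have [G GP] := choice loc.
move: cK; rewrite compact_cover => /(_ V K G).
case=> [p _|p Kp|D DK KD]; first by have [] := GP p.
  by exists p => //; have [_ /(_ Kp)[]] := GP p.
have [f [Cf [G' [oG' DG' fG']] fC]] : smooth_cutoff (cover [set` D] G) U.
  have : forall p, p \in finmap.enum_fset D -> K p by move=> p pD; exact/set_mem/DK.
  rewrite /cover bigcup_fset.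
  elim: (finmap.enum_fset D) => [_|p s IH sK].
    rewrite big_nil; exists (fun=> 0); split; first by move=> n; exact: Ck_cst.
      by exists set0; split=> //; exact: open0.
    by exists set0; split=> //; exact: compact0.
  rewrite big_cons; apply: smooth_cutoff_setU.
    by have [_ /(_ (sK _ (mem_head _ _)))[]] := GP p.
  by apply: IH => q qs; apply: sK; rewrite inE qs orbT.
exists f; split=> //; exists G'; split=> //.
exact: subset_trans DG'.
Qed.

End bumps.

(** * The Lorentz factor *)

Section gamma_factor.
Context {R : realType}.
Implicit Types u v w : vec3 R.

Lemma dotE v w : dot v w = v.1.1 * w.1.1 + v.1.2 * w.1.2 + v.2 * w.2.
Proof. by rewrite /dot !big_ord_recl big_ord0 /= addr0 /component /= addrA. Qed.

Lemma Ck_id n : Ck n (fun x : R => x).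
Proof.
rewrite (_ : (fun x : R => x) = (fun x => 1 * x + 0)); first exact: Ck_affine.
by apply/funext => x; ring.
Qed.

Lemma ord3P (P : 'I_3 -> Prop) : P 0 -> P 1 -> P 2 -> forall i, P i.
Proof.
move=> P0 P1 P2 [[|[|[|//]]] i].
- by rewrite (_ : Ordinal i = 0)//; exact/val_inj.
- by rewrite (_ : Ordinal i = 1)//; exact/val_inj.
- by rewrite (_ : Ordinal i = 2)//; exact/val_inj.
Qed.

Lemma Ck_component n i : Ck n (@component R i).
Proof.
elim/ord3P: i.
- exact: (@Ck_fst R (R * R)%type R n (fun y => y.1) (@Ck_fst R R R n id (Ck_id n))).
- exact: (@Ck_fst R (R * R)%type R n (fun y => y.2) (@Ck_snd R R R n id (Ck_id n))).
- exact: (@Ck_snd R (R * R)%type R n id (Ck_id n)).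
Qed.

Let derive_id (x v : R) : 'D_v (fun y : R => y) x = v.
Proof. exact: derive_id. Qed.

Lemma derive_fst (V W : normedModType R) (F : V -> R) (x v : V * W) :
  differentiable F x.1 -> 'D_v (fun y : V * W => F y.1) x = 'D_(v.1) F x.1.
Proof.
move=> dF.
by apply: (@derive_comp_linear R (V * W)%type V fst) => // y; exact: cvg_fst.
Qed.

Lemma derive_snd (V W : normedModType R) (F : W -> R) (x v : V * W) :
  differentiable F x.2 -> 'D_v (fun y : V * W => F y.2) x = 'D_(v.2) F x.2.
Proof.
move=> dF.
by apply: (@derive_comp_linear R (V * W)%type W snd) => // y; exact: cvg_snd.
Qed.

Lemma derive_component i u v : 'D_v (@component R i) u = component i v.
Proof.
have d1 x : differentiable (@idfun R) x by exact: Ck_diff (Ck_id 0).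
have Cf := @Ck_fst R R R 0 id (Ck_id 0).
have Cs := @Ck_snd R R R 0 id (Ck_id 0).
elim/ord3P: i.
- rewrite -[LHS]/('D_v (fun y : vec3 R => y.1.1) u).
  rewrite (@derive_fst (R * R)%type R (fun y => y.1)); last exact: Ck_diff Cf.
  by rewrite (@derive_fst R R id) ?derive_id//; exact: d1.
- rewrite -[LHS]/('D_v (fun y : vec3 R => y.1.2) u).
  rewrite (@derive_fst (R * R)%type R (fun y => y.2)); last exact: Ck_diff Cs.
  by rewrite (@derive_snd R R id) ?derive_id//; exact: d1.
- rewrite -[LHS]/('D_v (fun y : vec3 R => y.2) u).
  by rewrite (@derive_snd (R * R)%type R id) ?derive_id//; exact: d1.
Qed.

Lemma Ck_dotl n v : Ck n (fun u => dot u v).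
Proof.
rewrite (_ : (fun u => _) = (fun u => component 0 u * v.1.1 +
   (component 1 u * v.1.2 + component 2 u * v.2))); last first.
  by apply/funext => u; rewrite dotE addrA.
by do ?apply: Ck_add; apply: Ck_mul; by [exact: Ck_component|exact: Ck_cst].
Qed.

Lemma Ck_dotd n : Ck n (fun u => dot u u).
Proof.
rewrite (_ : (fun u => _) = (fun u => component 0 u * component 0 u +
   (component 1 u * component 1 u + component 2 u * component 2 u))); last first.
  by apply/funext => u; rewrite dotE addrA.
by do ?apply: Ck_add; apply: Ck_mul; exact: Ck_component.
Qed.

Lemma derive_dotd u v : 'D_v (fun u => dot u u) u = 2 * dot u v.
Proof.
rewrite (_ : (fun u => _) = (fun u => component 0 u * component 0 u) +
   ((fun u => component 1 u * component 1 u) +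
    (fun u => component 2 u * component 2 u))); last first.
  by apply/funext => w; rewrite dotE /= -addrA.
have dc i x : differentiable (@component R i) x by exact: Ck_diff (Ck_component 0 i).
have dcc i x : derivable (fun u => component i u * component i u) x v.
  by apply: diff_derivable; exact: differentiableM.
have dcc2 i j x : derivable ((fun u => component i u * component i u) +
    (fun u => component j u * component j u)) x v.
  by apply: derivableD.
rewrite deriveD// deriveD// !derive_differentiableM//.
by rewrite !derive_component dotE /component /=; ring.
Qed.

Lemma dot_ge0 u : 0 <= dot u u.
Proof. by rewrite dotE -!expr2 !addr_ge0// sqr_ge0. Qed.

Variables (m c : R) (hm : 0 < m) (hc : 0 < c).
Let k := m ^+ 2 * c ^+ 2.
Let k_gt0 : 0 < k. Proof. by rewrite mulr_gt0// exprn_gt0. Qed.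

Lemma gamma_arg_gt0 u : 0 < 1 + dot u u / (m ^+ 2 * c ^+ 2).
Proof. by rewrite ltr_pwDl// divr_ge0 ?dot_ge0// ltW. Qed.

Lemma gamma_gt0 u : 0 < gamma m c u.
Proof. by rewrite sqrtr_gt0 gamma_arg_gt0. Qed.

Lemma gamma_neq0 u : gamma m c u != 0.
Proof. by rewrite gt_eqF// gamma_gt0. Qed.

Lemma gamma_sqr u : gamma m c u ^+ 2 = 1 + dot u u / (m ^+ 2 * c ^+ 2).
Proof. by rewrite sqr_sqrtr// ltW// gamma_arg_gt0. Qed.

Let Ck_arg n : Ck n (fun u => 1 + dot u u / k).
Proof.
apply: Ck_add; first exact: Ck_cst.
by apply: Ck_mul; [exact: Ck_dotd|exact: Ck_cst].
Qed.

Let dsqrt u : differentiable (@Num.sqrt R) (1 + dot u u / k).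
Proof.
apply/derivable1_diffP.
by have [] := is_derive1_sqrt (gamma_arg_gt0 u).
Qed.

Lemma differentiable_gamma u : differentiable (gamma m c) u.
Proof.
apply: (@differentiable_comp _ _ _ _ (fun u => 1 + dot u u / k) Num.sqrt) => //.
exact: Ck_diff (Ck_arg 0).
Qed.

Lemma derive_gamma u v :
  'D_v (gamma m c) u = dot u v / (m ^+ 2 * c ^+ 2) * (gamma m c u)^-1.
Proof.
rewrite (@derive_comp1 _ _ Num.sqrt (fun u => 1 + dot u u / k))//; last first.
  exact: Ck_diff (Ck_arg 0).
rewrite derive_sqrt ?gamma_arg_gt0// -/(gamma m c u).
rewrite (_ : (fun u => _) = cst 1 + (k^-1 \*: (fun u => dot u u))); last first.
  by apply/funext => w /=; rewrite mulrC.
have dd : derivable (fun u => dot u u) u v.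
  by apply: diff_derivable; exact: Ck_diff (Ck_dotd 0).
rewrite deriveD//; last exact: derivableZ.
rewrite derive_cst add0r deriveZ// derive_dotd /GRing.scale/= /k.
by field; rewrite gamma_neq0 !gt_eqF.
Qed.

(** The reciprocal is treated before [gamma] itself: its derivative is the linear form [dot u v]
    times a constant times the cube of 1 / gamma, so the induction closes without differentiating
    the square root again. *)
Lemma Ck_gamma_inv n : Ck n (fun u => (gamma m c u)^-1).
Proof.
have dg u : differentiable (fun u => (gamma m c u)^-1) u.
  by apply: differentiableV; [exact: differentiable_gamma|exact: gamma_neq0].
elim: n => [|n IH]; split=> // v.
rewrite (_ : (fun x => 'D_v _ x) = fun u => - ((gamma m c u)^-1 * (gamma m c u)^-1 *
    (dot u v * k^-1 * (gamma m c u)^-1))).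
  apply: Ck_opp; apply: Ck_mul; first exact: Ck_mul.
  by apply: Ck_mul => //; apply: Ck_mul; [exact: Ck_dotl|exact: Ck_cst].
apply/funext => u; rewrite deriveV ?gamma_neq0//; last first.
  by apply: diff_derivable; exact: differentiable_gamma.
by rewrite derive_gamma -exprVn expr2 scaleNr.
Qed.

Lemma Ck_gamma n : Ck n (gamma m c).
Proof.
case: n => [|n]; split=> //; try exact: differentiable_gamma.
move=> v; rewrite (_ : (fun x => 'D_v _ x) = fun u =>
    dot u v * k^-1 * (gamma m c u)^-1).
  apply: Ck_mul; last exact: Ck_gamma_inv.
  by apply: Ck_mul; [exact: Ck_dotl|exact: Ck_cst].
by apply/funext => u; rewrite derive_gamma.
Qed.

End gamma_factor.

(** * Regularity of the fields *)

Section continuously_differentiable.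
Context {R : realType}.

(** A local notion, since the fields are controlled only inside the open cylinder. Continuity of the
    directional derivatives serves both the fundamental theorem of calculus and measurability. *)
Definition c1_on (V : normedModType R) (D : set V) (F : V -> R) := forall x, D x ->
  differentiable F x /\ forall v, {for x, continuous (fun y => 'D_v F y)}.

Lemma near_eq_continuous (V W : topologicalType) (f g : V -> W) x :
  (\forall y \near x, f y = g y) -> {for x, continuous f} -> {for x, continuous g}.
Proof.
move=> fg cf; rewrite /prop_for /continuous_at -(nbhs_singleton fg).
exact: cvg_trans (near_eq_cvg fg) cf.
Qed.

Lemma open_near (V : topologicalType) (D : set V) x (P : V -> Prop) :
  open D -> D x -> (forall y, D y -> P y) -> \forall y \near x, P y.
Proof.
by move=> oD Dx DP; apply: (filterS DP); exact: open_nbhs_nbhs.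
Qed.

Section closure_properties.
Variables (V : normedModType R) (D : set V).
Hypothesis oD : open D.
Implicit Types F G : V -> R.

Lemma c1_on_ext F G : F =1 G -> c1_on D F -> c1_on D G.
Proof. by move=> /funext ->. Qed.

Lemma c1_onD F G : c1_on D F -> c1_on D G -> c1_on D (fun x => F x + G x).
Proof.
move=> cF cG x Dx; have [dF dF'] := cF x Dx; have [dG dG'] := cG x Dx.
split; first exact: differentiableD.
move=> v.
apply: (@near_eq_continuous _ _ (fun y => 'D_v F y + 'D_v G y)).
  apply: (open_near oD Dx) => y Dy; have [? _] := cF y Dy; have [? _] := cG y Dy.
  by rewrite deriveD//; exact: diff_derivable.
by apply: continuousD; [exact: dF'|exact: dG'].
Qed.

Lemma c1_onZ k F : c1_on D F -> c1_on D (fun x => k * F x).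
Proof.
move=> cF x Dx; have [dF dF'] := cF x Dx.
split; first exact: (differentiableZ k dF).
move=> v.
apply: (@near_eq_continuous _ _ (fun y => k * 'D_v F y)).
  apply: (open_near oD Dx) => y Dy; have [? _] := cF y Dy.
  by rewrite -[LHS]/(k *: 'D_v F y) -deriveZ//; exact: diff_derivable.
by apply: continuousM; [exact: cvg_cst|exact: dF'].
Qed.

Lemma c1_onN F : c1_on D F -> c1_on D (fun x => - F x).
Proof. by move=> /(c1_onZ (-1)); apply: c1_on_ext => x; rewrite mulN1r. Qed.

Lemma c1_onB F G : c1_on D F -> c1_on D G -> c1_on D (fun x => F x - G x).
Proof. by move=> cF /c1_onN; exact: c1_onD. Qed.

End closure_properties.

Lemma component_linear i : linear (@component R i).
Proof.
by move=> k u v; elim/ord3P: i.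
Qed.

HB.instance Definition _ i := GRing.isLinear.Build R (vec3 R) R _
  (@component R i) (component_linear i).

Lemma component_continuous i : continuous (@component R i).
Proof.
by move=> x; apply: differentiable_continuous; exact: Ck_diff (Ck_component 0 i).
Qed.

Lemma derive_component_comp (V : normedModType R) (F : V -> vec3 R) i x v :
  differentiable F x -> 'D_v (component i \o F) x = component i ('D_v F x).
Proof.
move=> dF; have dc : differentiable (@component R i) (F x).
  exact: Ck_diff (Ck_component 0 i).
rewrite deriveE; last exact: differentiable_comp.
by rewrite diff_comp//= -deriveE// derive_component deriveE.
Qed.

Lemma smooth_component_c1 (V : normedModType R) (D : set V) (F : V -> vec3 R) i :
  open D -> smooth D F -> c1_on D (component i \o F).
Proof.
move=> oD sF x Dx; split.
  apply: differentiable_comp; first exact: (sF [::]).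
  exact: Ck_diff (Ck_component 0 i).
move=> v; apply: (@near_eq_continuous _ _ (fun y => component i ('D_v F y))).
  apply: (open_near oD Dx) => y Dy.
  by rewrite derive_component_comp//; exact: (sF [::]).
apply: (@continuous_comp _ _ _ (fun y => 'D_v F y) (component i)).
  apply: differentiable_continuous.
  exact: (sF [:: v] x Dx).
exact: component_continuous.
Qed.

(** At fixed momentum the map from (x, t) to (u, x, t) is affine, so the difference quotients of the
    slice are those of [F] along directions with zero momentum part. *)
Lemma c1_on_slice (F : phase R -> R) (Omu Omx : set (vec3 R)) (I : set R) u :
  c1_on (Omu `*` Omx `*` I) F -> Omu u ->
  c1_on (Omx `*` I) (fun y : spacetime R => F (u, y.1, y.2)).
Proof.
move=> cF Ou [x t] [/= Ox It].
have [] := cF (u, x, t) => // dF dF'.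
pose iota (y : spacetime R) : phase R := (u, y.1, y.2).
have diota y : differentiable iota y.
  have d1 : differentiable (fun y : spacetime R => (u, y.1)) y.
    apply: (@differentiable_pair R (spacetime R) _ _ (cst u) fst) => //.
    by apply: (@linear_differentiable R (spacetime R) _ fst) => ?; exact: cvg_fst.
  apply: (@differentiable_pair R (spacetime R) _ _ (fun y => (u, y.1)) snd) => //.
  by apply: (@linear_differentiable R (spacetime R) _ snd) => ?; exact: cvg_snd.
have iotaE v y : 'D_v (F \o iota) y = 'D_((0, v.1, v.2) : phase R) F (iota y).
  rewrite /derive; set f1 := (X in X @ _); set f2 := (X in _ = lim (X @ _)).
  suff -> : f1 = f2 by [].
  apply/funext => h; rewrite /f1 /f2 /=.
  have -> : iota (h *: v + y) = h *: (0, v.1, v.2) + iota y; last by [].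
  rewrite /iota -[RHS]/(h *: 0 + u, h *: v.1 + y.1, h *: v.2 + y.2).
  by rewrite scaler0 add0r.
split; first by apply: (@differentiable_comp _ _ _ _ iota F).
move=> v; rewrite (_ : (fun y => _) = fun y => 'D_((0, v.1, v.2) : phase R) F (iota y)).
  have ci : {for (x, t), continuous iota} by exact: differentiable_continuous (diota _).
  exact: (@continuous_comp _ _ _ iota (fun w => 'D_((0, v.1, v.2) : phase R) F w) _ ci (dF' _)).
by apply/funext => y; exact: (iotaE v y).
Qed.

End continuously_differentiable.

Section fields_c1.
Context {R : realType}.
Variables (m e c T : R) (Omu Omx : set (vec3 R)) (E B : spacetime R -> vec3 R).
Hypotheses (hm : 0 < m) (he : e != 0) (hc : 0 < c).
Hypotheses (openu : open Omu) (openx : open Omx) (neu : Omu !=set0).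
Hypothesis sF : smooth (Omega T Omu Omx) (force m e c E B).

Let D : set (spacetime R) := Omx `*` `]0, T[.

Lemma open_setX (V W : topologicalType) (P : set V) (Q : set W) :
  open P -> open Q -> open (P `*` Q).
Proof.
move=> oP oQ; rewrite openE => -[x y] [/= Px Qy]; exists (P, Q) => //=.
by split; exact: open_nbhs_nbhs.
Qed.

Let oD : open D. Proof. by apply: open_setX => //; exact: itv_open. Qed.

Let oOmega : open (Omega T Omu Omx).
Proof. by do 2 apply: open_setX => //; exact: itv_open. Qed.

Let rho u : R := (c * m * gamma m c u)^-1.

Lemma crossZl k u b : cross (k *: u) b = k *: cross u b :> vec3 R.
Proof. by rewrite /cross /= -!mulrA -!mulrBr. Qed.

Lemma crossDl u v b : cross (u + v) b = cross u b + cross v b :> vec3 R.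
Proof.
rewrite /cross /= -[RHS]/(_ + _, _ + _, _ + _).
by congr (_, _, _) => /=; ring.
Qed.

Let c1_force i u : Omu u ->
  c1_on D (fun y => e * (component i (E y) + rho u * component i (cross u (B y)))).
Proof.
move=> Ou; have := c1_on_slice (smooth_component_c1 i oOmega sF) Ou.
apply: c1_on_ext => -[x t] /=.
by rewrite crossZl linearZ/= linearD/= linearZ.
Qed.

Let c1_force' i u : Omu u ->
  c1_on D (fun y => component i (E y) + rho u * component i (cross u (B y))).
Proof.
move=> Ou; have := c1_onZ oD e^-1 (c1_force i Ou).
by apply: c1_on_ext => y; rewrite mulKf.
Qed.

(* Along a ray the relativistic velocity is strictly monotone, so two forces at
   parallel momenta determine the magnetic contribution. *)
Let rho_scale u s : u != 0 -> 0 < s -> s != 1 -> rho (s *: u) * s != rho u.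
Proof.
move=> u0 s0 s1; rewrite /rho; apply/eqP => h.
have g0 := gamma_gt0 hm hc u; have g1 := gamma_gt0 hm hc (s *: u).
(* Equality would mean s gamma(u) = gamma(su). Squaring cancels the terms in |u|^2 and leaves s^2 =
   1, impossible for a positive s other than 1. *)
have h2 : s * gamma m c u = gamma m c (s *: u).
  move: h; have cm0 : c * m != 0 by rewrite mulf_neq0 ?gt_eqF.
  rewrite !invfM => /(congr1 (fun x => x * (c * m * gamma m c u * gamma m c (s *: u)))).
  have -> : c^-1 / m / gamma m c (s *: u) * s *
     (c * m * gamma m c u * gamma m c (s *: u)) = s * gamma m c u.
    by field; rewrite !gt_eqF.
  move=> ->; by field; rewrite !gt_eqF.
have : s ^+ 2 * gamma m c u ^+ 2 = gamma m c (s *: u) ^+ 2.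
  by rewrite -h2 exprMn.
rewrite !gamma_sqr//.
have -> : dot (s *: u) (s *: u) = s ^+ 2 * dot u u.
  by rewrite !dotE /= /GRing.scale/=; ring.
rewrite mulrDr mulr1 mulrA => /addIr /eqP.
rewrite sqrf_eq1 (negbTE s1)/= => /eqP s1'.
by move: s0; rewrite s1' oppr_gt0 ltr10.
Qed.

Let near_momentum (u w : vec3 R) : Omu u -> exists h : R, 0 < h /\ Omu (u + h *: w).
Proof.
move=> Ou.
have ch : {for 0, continuous (fun h : R => u + h *: w)}.
  by move=> ?; apply: cvgD; [exact: cvg_cst|apply: cvgZl; exact: cvg_id].
have := ch Omu; rewrite scale0r addr0 => /(_ (open_nbhs_nbhs (conj openu Ou))).
rewrite /= -nbhs_ballE => -[r /= r0 rP].
exists (r / 2); split; first exact: divr_gt0.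
apply: rP; rewrite /ball/= sub0r normrN gtr0_norm ?divr_gt0//; lra.
Qed.

Let c1_cross i u : Omu u -> c1_on D (fun y => component i (cross u (B y))).
Proof.
move=> Ou; have [->|u0] := eqVneq u 0.
  apply: (@c1_on_ext _ _ _ (fun=> 0)).
    by move=> y; rewrite /cross /= !mul0r subr0; elim/ord3P: i.
  by move=> x Dx; split=> // v; rewrite (_ : (fun y => 'D_v _ y) = cst 0);
    [exact: cst_continuous|apply/funext => y; exact: derive_cst].
have [h [h0 Osu]] := near_momentum u Ou.
have su : u + h *: u = (1 + h) *: u by rewrite scalerDl scale1r.
rewrite su in Osu.
have s0 : 0 < 1 + h by lra.
have s1 : 1 + h != 1 by rewrite gt_eqF//; lra.
have k0 : rho ((1 + h) *: u) * (1 + h) - rho u != 0.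
  by rewrite subr_eq0 rho_scale.
(* The electric field cancels in the difference of the two forces, which leaves a nonzero multiple
   of u x B. *)
have := c1_onZ oD (rho ((1 + h) *: u) * (1 + h) - rho u)^-1
  (c1_onB oD (c1_force' i Osu) (c1_force' i Ou)).
apply: c1_on_ext => y; rewrite crossZl linearZ/=.
rewrite mulrA [X in _ * X](_ : _ = (rho ((1 + h) *: u) * (1 + h) - rho u) *
   component i (cross u (B y))); first by rewrite mulKf.
by ring.
Qed.

(** The basis vector need not lie in [Omu]. But u x B is linear in u, so the difference between the
    momenta [u + h *: unit_vec j] and [u], both in the open set [Omu], provides its cross product
    with B. *)
Let c1_cross_unit i j : c1_on D (fun y => component i (cross (unit_vec j) (B y))).
Proof.
have [u Ou] := neu; have [h [h0 Ouh]] := near_momentum (unit_vec j) Ou.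
have := c1_onZ oD h^-1 (c1_onB oD (c1_cross i Ouh) (c1_cross i Ou)).
apply: c1_on_ext => y.
rewrite crossDl crossZl.
by rewrite linearD/= linearZ/= addrAC subrr add0r mulKf// gt_eqF.
Qed.

Lemma c1_magnetic i : c1_on D (component i \o B).
Proof.
elim/ord3P: i.
- apply: c1_on_ext (c1_onN oD (c1_cross_unit 2 1)) => y.
  by rewrite /cross /component /=; ring.
- apply: c1_on_ext (c1_cross_unit 2 0) => y.
  by rewrite /cross /component /=; ring.
- apply: c1_on_ext (c1_onN oD (c1_cross_unit 1 0)) => y.
  by rewrite /cross /component /=; ring.
Qed.

Lemma c1_electric i : c1_on D (component i \o E).
Proof.
have [u Ou] := neu.
have := c1_onB oD (c1_force' i Ou) (c1_onZ oD (rho u) (c1_cross i Ou)).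
by apply: c1_on_ext => y /=; ring.
Qed.

End fields_c1.

(** * Balance of the kinetic energy *)

Lemma ae_sub d (X : measurableType d) (R : realType)
    (mu : {measure set X -> \bar R}) (P Q : X -> Prop) :
  {ae mu, forall x, P x} -> (forall x, P x -> Q x) -> {ae mu, forall x, Q x}.
Proof. by move=> aP PQ; exact: filterS PQ aP. Qed.

Section borel_euclidean.
Context {R : realType}.

Lemma compact_base_vec3 : @compact_base (vec3 R) (@measurable _ (mvec3 R)).
Proof.
by do 2 (apply: compact_base_prod; [exact: measurableX| |exact: compact_base_R]);
  exact: compact_base_R.
Qed.

Lemma compact_base_spacetime :
  @compact_base (spacetime R) (@measurable _ (mvec3 R * measurableTypeR R)%type).
Proof.
apply: compact_base_prod; [exact: measurableX|exact: compact_base_vec3|].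
exact: compact_base_R.
Qed.

Lemma compact_base_vec6 :
  @compact_base (vec3 R * vec3 R)%type (@measurable _ (mvec3 R * mvec3 R)%type).
Proof.
by apply: compact_base_prod; [exact: measurableX|exact: compact_base_vec3..].
Qed.

Lemma compact_base_phase : @compact_base (phase R)
  (@measurable _ (mvec3 R * mvec3 R * measurableTypeR R)%type).
Proof.
apply: compact_base_prod; [exact: measurableX|exact: compact_base_vec6|].
exact: compact_base_R.
Qed.

Lemma vec3_open_measurable (U : set (vec3 R)) : open U -> measurable (U : set (mvec3 R)).
Proof. exact: (@borel_open_measurable _ (mvec3 R) (Topological.class (vec3 R)) compact_base_vec3). Qed.

Lemma vec6_compact_measurable (K : set (vec3 R * vec3 R)) : compact K ->
  measurable (K : set (mvec3 R * mvec3 R)).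
Proof.
move=> /(compact_closed (@norm_hausdorff _ _)).
exact: (@borel_closed_measurable _ (mvec3 R * mvec3 R)%type
  (Topological.class (vec3 R * vec3 R)%type) compact_base_vec6).
Qed.

Lemma phase_continuous_measurable (U : set (phase R)) (g : phase R -> R) :
  open U -> (forall w, U w -> {for w, continuous g}) ->
  measurable_fun (U : set (mvec3 R * mvec3 R * measurableTypeR R)) g.
Proof.
exact: (@borel_continuous_measurable _ (mvec3 R * mvec3 R * measurableTypeR R)%type
  (Topological.class (phase R)) R compact_base_phase).
Qed.

Lemma spacetime_continuous_measurable (U : set (spacetime R)) (g : spacetime R -> R) :
  open U -> (forall y, U y -> {for y, continuous g}) ->
  measurable_fun (U : set (mvec3 R * measurableTypeR R)) g.
Proof.
exact: (@borel_continuous_measurable _ (mvec3 R * measurableTypeR R)%type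
  (Topological.class (spacetime R)) R compact_base_spacetime).
Qed.

Lemma continuous_compact_bounded (V : normedModType R) (K : set V) (g : V -> R) :
  compact K -> (forall x, K x -> {for x, continuous g}) -> [bounded g x | x in K].
Proof.
move=> cK cg.
have cgK : {within K, continuous g}.
  apply/subspace_continuousP => x Kx; apply: cvg_within_filter.
  exact: cg.
have /compact_bounded[M [Mr Mg]] := continuous_compact cgK cK.
by exists M; split=> // N MN x Kx; apply: Mg => //; exists x.
Qed.

End borel_euclidean.

Section matter.
Context {R : realType}.
Variables (T : R) (Omu Omx : set (vec3 R)) (f : phase R -> R).
Hypotheses (openu : open Omu) (openx : open Omx).
Hypothesis floc : phase_locally_integrable T Omu Omx f.
Hypothesis fsupp : compactly_supported T Omu Omx f.

Let Om := Omega T Omu Omx.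
Let Z := Omu `*` Omx.

Lemma open_Omega : open Om.
Proof. by do 2 apply: open_setX => //; exact: itv_open. Qed.

Lemma measurable_phase_space : measurable (Z : set (mvec3 R * mvec3 R)).
Proof. by apply: measurableX; exact: vec3_open_measurable. Qed.

Lemma measurable_Omega : measurable (Om : set (mvec3 R * mvec3 R * measurableTypeR R)).
Proof. by apply: measurableX; [exact: measurable_phase_space|exact: measurable_itv]. Qed.

Lemma measurable_density :
  measurable_fun (Om : set (mvec3 R * mvec3 R * measurableTypeR R)) f.
Proof.
apply: (@borel_measurable_fun_local _ (mvec3 R * mvec3 R * measurableTypeR R)%type
  (Topological.class (phase R)) R compact_base_phase); first exact: open_Omega.
move=> K cK mK KO; apply/measurable_EFinP.
exact: measurable_int (floc cK KO).
Qed.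

Lemma slab_subset (a b : R) : 0 < a -> b < T -> `[a, b] `<=` `]0, T[.
Proof.
move=> a0 bT x /=; rewrite !in_itv/= => /andP[ax xb].
by rewrite (lt_le_trans a0 ax) (le_lt_trans xb bT).
Qed.

(** On [K] times [a, b], a compact subset of [Omega], local integrability controls [f] and
    continuity bounds [g]. Elsewhere on the slab [f] vanishes almost everywhere, so no bound on [g]
    near the boundary or at infinity is required. *)
Lemma integrable_moment (g : phase R -> R) (a b : R) : 0 < a -> b < T ->
  (forall w, Om w -> {for w, continuous g}) ->
  leb7.-integrable (Z `*` `[a, b]) (EFin \o (fun w => f w * g w)).
Proof.
move=> a0 bT cg; have [K [cK KZ K0]] := fsupp.
have abT := slab_subset a0 bT.
have mZ := measurable_phase_space.
have mK := vec6_compact_measurable cK.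
have mZI : measurable (Z `*` `[a, b] : set (mvec3 R * mvec3 R * measurableTypeR R)).
  by apply: measurableX => //; exact: measurable_itv.
have mKI : measurable (K `*` `[a, b] : set (mvec3 R * mvec3 R * measurableTypeR R)).
  by apply: measurableX => //; exact: measurable_itv.
have cKI : compact (K `*` `[a, b]) by apply: compact_setX => //; exact: segment_compact.
have KIO : K `*` `[a, b] `<=` Om by move=> [z t] [/= /KZ ? /abT].
have ZIO : Z `*` `[a, b] `<=` Om by move=> [z t] [/= ? /abT].
have mg := phase_continuous_measurable open_Omega cg.
have mfg : measurable_fun (Z `*` `[a, b] : set (mvec3 R * mvec3 R * measurableTypeR R))
    (fun w => f w * g w).
  apply: measurable_funM.
    exact: measurable_funS measurable_Omega ZIO measurable_density.
  exact: measurable_funS measurable_Omega ZIO mg.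
have iK : leb7.-integrable (K `*` `[a, b]) (EFin \o (fun w => f w * g w)).
  have bg : [bounded g w | w in K `*` `[a, b]].
    by apply: continuous_compact_bounded => // w /KIO; exact: cg.
  have := integrableMl mKI (floc cKI KIO)
    (measurable_funS measurable_Omega KIO mg) bg.
  by apply: eq_integrable.
have sub : K `*` `[a, b] `<=` Z `*` `[a, b] by move=> [z t] [/KZ].
pose h := (fun w => f w * g w) \_ (K `*` `[a, b]).
apply: (@integrable_ae_eq _ _ _ leb7 _ h) => //.
  apply: (ae_sub K0) => w Kw Zw; rewrite /h patchE; case: ifPn => //.
  rewrite notin_setE => nK; rewrite Kw ?mul0r//; first exact: ZIO.
  by move=> Kw1; apply: nK; split=> //; case: Zw.
rewrite /h -restrict_EFin.
have := @integrable_restrict _ _ R leb7 _ mKI _ mZI (EFin \o (fun w => f w * g w)).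
by case=> + _; apply; rewrite setIC setIidl.
Qed.

End matter.

Lemma Rintegral_subset d (X : measurableType d) (R : realType)
    (mu : {measure set X -> \bar R}) (D' D : set X) (h : X -> R) :
  D' `<=` D -> (forall x, D x -> ~ D' x -> h x = 0) ->
  \int[mu]_(x in D) h x = \int[mu]_(x in D') h x.
Proof.
move=> sub h0; rewrite Rintegral_mkcond [RHS]Rintegral_mkcond; congr Rintegral.
apply/funext => x; rewrite !patchE.
have [Dx|nDx] := boolP (x \in D); have [D'x|nD'x] := boolP (x \in D') => //.
  by apply: h0; [exact: set_mem|rewrite notin_setE in nD'x].
by move/set_mem/sub/mem_set : D'x; rewrite (negbTE nDx).
Qed.

Lemma compact_in_oo (R : realType) (T : R) (K : set R) : 0 < T -> compact K ->
  K `<=` `]0, T[ -> exists a b, [/\ 0 < a, a < b, b < T & K `<=` `]a, b[].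
Proof.
move=> T0 cK KT; have [/eqP K0|/set0P[t0 Kt0]] := boolP (K == set0).
  by exists (T / 3), (T / 2); split; [lra|lra|lra|rewrite K0].
have [M KM Mmax] := @compact_EVT_max R R id K (ex_intro _ _ Kt0) cK
  (continuous_subspaceT (fun x => cvg_id)).
have [N KN Nmin] := @compact_EVT_min R R id K (ex_intro _ _ Kt0) cK
  (continuous_subspaceT (fun x => cvg_id)).
have /= := KT _ (set_mem KM); have /= := KT _ (set_mem KN).
rewrite !in_itv/= => /andP[N0 NT] /andP[M0 MT].
have NM : N <= M by exact: Nmin.
(* Midpoints between the extreme points of [K] and the ends of the interval make all the
   inequalities strict. *)
exists (N / 2), ((M + T) / 2); split; [lra|lra|lra|].
move=> t Kt; rewrite /= in_itv/=.
have := Mmax t (mem_set Kt); have := Nmin t (mem_set Kt) => /= h1 h2.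
by apply/andP; split; lra.
Qed.

Section test_functions.
Context {R : realType}.

Lemma near_zero_derive (V : normedModType R) (F : V -> R) (k : R) x v :
  (\forall y \near x, F y = k) -> 'D_v F x = 0.
Proof.
move=> F0; rewrite (@near_eq_derive _ _ _ _ (cst k)); first exact: derive_cst.
exact: F0.
Qed.

Lemma test_function_support (T : R) (psi : R -> R) : 0 < T ->
  test_function `]0, T[ psi ->
  exists a b, [/\ 0 < a, a < b, b < T & forall t, ~ `]a, b[%classic t -> psi t = 0].
Proof.
move=> T0 [_ cK KT]; have [a [b [a0 ab bT Kab]]] := compact_in_oo T0 cK KT.
exists a, b; split=> // t nt; apply/eqP; apply/negPn/negP => pt; apply: nt.
by apply: Kab; exact: subset_closure.
Qed.

Lemma test_function_Ck (V : normedModType R) (D : set V) (psi : V -> R) n :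
  test_function D psi -> Ck n psi.
Proof. by move=> [sp _ _]; exact: (smooth_Ck psi).1. Qed.

Lemma test_function_derive_out (psi : R -> R) (a b t : R) :
  (forall t, ~ `]a, b[%classic t -> psi t = 0) ->
  ~ `[a, b]%classic t -> 'D_1 psi t = 0.
Proof.
move=> psi0 /= /negP; rewrite in_itv/= negb_and -!ltNge => h.
apply: (@near_zero_derive _ _ 0).
case/orP: h => h.
  apply: filterS (lt_nbhsl h) => y ya; apply: psi0 => /=.
  by apply/negP; rewrite in_itv/= negb_and -!leNgt (ltW ya).
apply: filterS (lt_nbhsr h) => y ya; apply: psi0 => /=.
by apply/negP; rewrite in_itv/= negb_and -!leNgt (ltW ya) orbT.
Qed.

End test_functions.

Section kinetic.
Context {R : realType}.
Variables (m e c T : R) (Omu Omx : set (vec3 R)) (f : phase R -> R)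
  (E B : spacetime R -> vec3 R).
Hypotheses (hm : 0 < m) (hc : 0 < c).
Hypotheses (openu : open Omu) (openx : open Omx).
Hypothesis floc : phase_locally_integrable T Omu Omx f.
Hypothesis fsupp : compactly_supported T Omu Omx f.
Hypothesis sF : smooth (Omega T Omu Omx) (force m e c E B).
Hypothesis sv : smooth (Omega T Omu Omx) (velocity m c).
Hypothesis vl : vlasov m e c T Omu Omx f E B.

Let Om := Omega T Omu Omx.
Let Z := Omu `*` Omx.

Definition kinetic_energy (u : vec3 R) : R := (gamma m c u - 1) * (m * c ^+ 2).

Lemma Ck_kinetic_energy n : Ck n kinetic_energy.
Proof.
apply: Ck_mul; last exact: Ck_cst.
by apply: Ck_add; [exact: Ck_gamma|exact: Ck_cst].
Qed.

(** The gradient of the kinetic energy is the relativistic velocity; this is what turns the force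
    term of the Vlasov equation into the power of the force. *)
Lemma derive_kinetic_energy u v :
  'D_v kinetic_energy u = dot u v / (m * gamma m c u).
Proof.
have dg : derivable (gamma m c) u v.
  by apply: diff_derivable; exact: differentiable_gamma.
rewrite (_ : kinetic_energy = (m * c ^+ 2) \*: (gamma m c - cst 1)); last first.
  by apply/funext => w; rewrite /kinetic_energy mulrC.
rewrite deriveZ; last exact: derivableB.
rewrite deriveB// derive_cst subr0 derive_gamma// /GRing.scale/=.
by field; rewrite gamma_neq0// !gt_eqF.
Qed.

Variables (psi : R -> R) (a b : R).
Hypotheses (tpsi : test_function `]0, T[ psi).
Hypotheses (a0 : 0 < a) (ab : a < b) (bT : b < T).
Hypothesis psi0 : forall t, ~ `]a, b[%classic t -> psi t = 0.

Let Cpsi n : Ck n psi. Proof. exact: test_function_Ck tpsi. Qed.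

(* The derivative along v of chi(u, x) * kinetic_energy u * psi t where the
   cutoff chi is locally 1, in particular on the support of f. *)
Definition tested_derivative (v w : phase R) : R :=
  kinetic_energy w.1.1 * (v.2 * 'D_1 psi w.2) +
  psi w.2 * (dot w.1.1 v.1.1 / (m * gamma m c w.1.1)).

Lemma tested_derivative_continuous v : continuous (tested_derivative v).
Proof.
move=> w; apply: differentiable_continuous.
apply: (@Ck_diff _ _ 0).
apply: Ck_add.
  apply: Ck_mul.
    exact: (@Ck_fst R (vec3 R * vec3 R)%type R 0 _ (@Ck_fst R (vec3 R) (vec3 R) 0 _ (Ck_kinetic_energy 0))).
  apply: Ck_mul; first exact: Ck_cst.
  have [_ C1] := Cpsi 1.
  exact: (@Ck_snd R (vec3 R * vec3 R)%type R 0 _ (C1 1)).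
apply: Ck_mul; first exact: (@Ck_snd R (vec3 R * vec3 R)%type R 0 _ (Cpsi 0)).
apply: (@Ck_fst R (vec3 R * vec3 R)%type R 0 (fun z => dot z.1 v.1.1 / (m * gamma m c z.1))).
apply: (@Ck_fst R (vec3 R) (vec3 R) 0 (fun u => dot u v.1.1 / (m * gamma m c u))).
apply: Ck_mul; first exact: Ck_dotl.
apply: Ck_inv.
  by move=> u; rewrite mulf_neq0 ?gamma_neq0// gt_eqF.
by apply: Ck_mul; [exact: Ck_cst|exact: Ck_gamma].
Qed.

Lemma tested_derivative_out v w : ~ `[a, b]%classic w.2 -> tested_derivative v w = 0.
Proof.
move=> nw; rewrite /tested_derivative (test_function_derive_out psi0 nw) !mulr0 add0r psi0 ?mul0r//.
by move=> /= h; apply: nw; exact: subset_itv_oo_cc h.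
Qed.

(** The weight has compact support in time thanks to psi, and in (u, x) thanks to a cutoff around
    the support of [f]. On [K] the cutoff is locally constant, and off [K] the density vanishes
    almost everywhere, so the cutoff leaves no trace in the pairings. One [phi] must serve every [g]
    and [v], since all terms of the Vlasov equation use the same test function. *)
Lemma localized_test : exists phi : phase R -> R, test_function Om phi /\
  (forall (g : phase R -> R) (v : phase R), (forall w, Om w -> {for w, continuous g}) ->
    weak_pairing T Omu Omx (fun w => g w * f w) v phi =
    - \int[leb7]_(w in Z `*` `[a, b]) (f w * (g w * tested_derivative v w))).
Proof.
have [K [cK KZ K0]] := fsupp.
have bV3 : has_bumps (vec3 R).
  by do 2 (apply: has_bumps_prod; last exact: has_bumps_R); exact: has_bumps_R.
have oZ : open Z by exact: open_setX.
have [chi [Cchi [G [oG KG chi1]] [C [cC CZ chi0]]]] :=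
  smooth_cutoff_compact (has_bumps_prod bV3 bV3) cK oZ KZ.
have [sp cs sT] := tpsi.
set S := closure _ in cs sT.
have CX n : Ck n (fun w : phase R => chi w.1).
  exact: (@Ck_fst R (vec3 R * vec3 R)%type R n _ (Cchi n)).
have CP n : Ck n (fun w : phase R => psi w.2).
  exact: (@Ck_snd R (vec3 R * vec3 R)%type R n _ (Cpsi n)).
have Ck1 n : Ck n (fun z : vec3 R * vec3 R => kinetic_energy z.1).
  exact: (@Ck_fst R (vec3 R) (vec3 R) n _ (Ck_kinetic_energy n)).
have CK n : Ck n (fun w : phase R => kinetic_energy w.1.1).
  exact: (@Ck_fst R (vec3 R * vec3 R)%type R n _ (Ck1 n)).
have CKP n : Ck n (fun w : phase R => kinetic_energy w.1.1 * psi w.2).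
  exact: Ck_mul.
have Cphi n : Ck n (fun w : phase R => chi w.1 * (kinetic_energy w.1.1 * psi w.2)).
  exact: Ck_mul.
pose phi (w : phase R) := chi w.1 * (kinetic_energy w.1.1 * psi w.2).
have dphiE v w : K w.1 -> 'D_v phi w = tested_derivative v w.
  move=> Kw.
  have chi_near : \forall z \near w.1, chi z = 1.
    by apply: (filterS chi1); apply: open_nbhs_nbhs; split=> //; exact: KG.
  have dchi : 'D_(v.1) chi w.1 = 0 by exact: near_zero_derive chi_near.
  rewrite /phi derive_differentiableM; [|exact: Ck_diff (CX 0%N)|exact: Ck_diff (CKP 0%N)].
  rewrite (@derive_fst R (vec3 R * vec3 R)%type R chi); last exact: Ck_diff (Cchi 0%N).
  rewrite dchi mulr0 addr0 (nbhs_singleton chi_near) mul1r.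
  rewrite derive_differentiableM; [|exact: Ck_diff (CK 0%N)|exact: Ck_diff (CP 0%N)].
  rewrite (@derive_snd R (vec3 R * vec3 R)%type R psi); last exact: Ck_diff (Cpsi 0%N).
  rewrite (@derive_fst R (vec3 R * vec3 R)%type R (fun z => kinetic_energy z.1)); last first.
    exact: Ck_diff (Ck1 0%N).
  rewrite (@derive_fst R (vec3 R) (vec3 R) kinetic_energy); last first.
    exact: Ck_diff (Ck_kinetic_energy 0%N).
  rewrite derive_kinetic_energy /tested_derivative; congr (_ * _ + _).
  by apply: derive_R; exact: Ck_diff (Cpsi 0%N).
exists phi; split.
  have sub : closure [set w | phi w != 0] `<=` C `*` S.
    have cCS : closed (C `*` S).
      apply: (compact_closed (@norm_hausdorff _ _)); exact: compact_setX.
    rewrite ((closure_id _).1 cCS); apply: closure_subset => w /= pw.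
    split=> /=; first by apply: contrapT => /chi0 h; move: pw; rewrite /phi h mul0r eqxx.
    apply: subset_closure => /=; apply: contra_neq pw => h.
    by rewrite /phi h !mulr0.
  split; first exact/smooth_Ck.
    apply: (subclosed_compact _ _ sub); first exact: closed_closure.
    exact: compact_setX.
  by move=> w /sub [/= /CZ ? /sT].
move=> g v cg; rewrite /weak_pairing; congr (- _).
have mg := phase_continuous_measurable (open_Omega openu openx) cg.
have mf := measurable_density openu openx floc.
have mO := measurable_Omega T openu openx.
rewrite (@Rintegral_ae_eq _ _ _ leb7 _ _ (fun w => f w * (g w * tested_derivative v w)))//.
- apply: Rintegral_subset.
    by move=> [z t] [/= Zz /(slab_subset a0 bT)].
  move=> [z t] [/= Zz tT] nZ; rewrite tested_derivative_out ?mulr0// => tab.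
  by apply: nZ; split.
- apply: measurable_funM; first exact: measurable_funM.
  apply: phase_continuous_measurable; first exact: open_Omega.
  move=> w _; apply: differentiable_continuous.
  by have [_ C1] := Cphi 1%N; exact: (@Ck_diff R (phase R) 0 _ w (C1 v)).
- apply: measurable_funM => //; apply: measurable_funM => //.
  apply: phase_continuous_measurable; first exact: open_Omega.
  by move=> w _; exact: tested_derivative_continuous.
- apply: (ae_sub K0) => w Kw Ow.
  have [Kw1|nKw1] := pselect (K w.1); first by rewrite dphiE//; ring.
  by rewrite Kw// !mulr0 !mul0r.
Qed.
End kinetic.

(** * Work of the electric field on the current *)

Section energy_exchange.
Context {R : realType}.
Variables (m e c T : R) (Omu Omx : set (vec3 R)) (f : phase R -> R)
  (E B : spacetime R -> vec3 R).
Hypotheses (hm : 0 < m) (hc : 0 < c).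
Hypotheses (openu : open Omu) (openx : open Omx).
Hypothesis floc : phase_locally_integrable T Omu Omx f.
Hypothesis fsupp : compactly_supported T Omu Omx f.

Let Om := Omega T Omu Omx.
Let Z := Omu `*` Omx.
Let D : set (spacetime R) := Omx `*` `]0, T[.
Let J (i : 'I_3) (y : spacetime R) := component i (current m e c Omu f y).

Let momentum_ratio (i : 'I_3) (u : vec3 R) : R := component i u / gamma m c u.

Let ratio_continuous i (w : phase R) :
  {for w, continuous (fun w : phase R => momentum_ratio i w.1.1)}.
Proof.
have C0 : Ck 0 (momentum_ratio i).
  by apply: Ck_mul; [exact: Ck_component|exact: Ck_gamma_inv].
have C1 := @Ck_fst R (vec3 R) (vec3 R) 0 _ C0.
exact: differentiable_continuous (Ck_diff w (@Ck_fst R (vec3 R * vec3 R)%type R 0 _ C1)).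
Qed.

Let currentE i y :
  J i y = e / m * \int[leb3]_(u in Omu) (f (u, y.1, y.2) * momentum_ratio i u).
Proof.
rewrite /J /current; elim/ord3P: i; congr (_ * _);
  by apply: eq_Rintegral => u _; rewrite mulrC.
Qed.

Lemma spacetime_to_phase_continuous (q : spacetime R -> R) (w : phase R) :
  {for (w.1.2, w.2), continuous q} ->
  {for w, continuous (fun w : phase R => q (w.1.2, w.2))}.
Proof.
move=> cq; have cp : {for w, continuous (fun w : phase R => (w.1.2, w.2))}.
  apply: differentiable_continuous.
  have df : differentiable (fst : phase R -> vec3 R * vec3 R) w.
    by apply: (@linear_differentiable R (phase R) _ fst) => ?; exact: cvg_fst.
  have ds : differentiable (snd : vec3 R * vec3 R -> vec3 R) w.1.
    by apply: (@linear_differentiable R (vec3 R * vec3 R)%type _ snd) => ?; exact: cvg_snd.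
  have d1 := differentiable_comp df ds.
  apply: (@differentiable_pair R (phase R) _ _ (snd \o fst) snd w d1).
  by apply: (@linear_differentiable R (phase R) _ snd) => ?; exact: cvg_snd.
exact: (@continuous_comp _ _ _ (fun w : phase R => (w.1.2, w.2)) q w cp cq).
Qed.

Variables (a b : R).
Hypotheses (a0 : 0 < a) (bT : b < T).

Let mZ := measurable_phase_space openu openx.
Let mu_ := vec3_open_measurable openu.
Let mx_ := vec3_open_measurable openx.
Let mI : measurable (`[a, b]%classic : set (measurableTypeR R)).
Proof. exact: measurable_itv. Qed.
Let mxI : measurable (Omx `*` `[a, b] : set (mvec3 R * measurableTypeR R)).
Proof. exact: measurableX. Qed.

Let DI : Omx `*` `[a, b] `<=` D.
Proof. by move=> [x t] [/= ? /(slab_subset a0 bT)]. Qed.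

Let openD : open D. Proof. by apply: open_setX => //; exact: itv_open. Qed.

Let measurable_slab (q : spacetime R -> R) : (forall y, D y -> {for y, continuous q}) ->
  measurable_fun (Omx `*` `[a, b] : set (mvec3 R * measurableTypeR R)) q.
Proof.
move=> cq; have mD : measurable (D : set (mvec3 R * measurableTypeR R)).
  by apply: measurableX => //; exact: measurable_itv.
exact: measurable_funS mD DI (spacetime_continuous_measurable openD cq).
Qed.

(** Fubini's theorem is applied twice: to the weighted moment for the equality, and to the bare
    moment in [ig1] to know that the integral defining the current converges for almost every (x,
    t). The latter allows the factors depending on (x, t) to leave the integral over u. *)
Lemma current_moment i (q : spacetime R -> R) : (forall y, D y -> {for y, continuous q}) ->
  leb4.-integrable (Omx `*` `[a, b]) (EFin \o (fun y => q y * J i y)) /\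
  \int[leb7]_(w in Z `*` `[a, b])
    (f w * (q (w.1.2, w.2) * (e / m * momentum_ratio i w.1.1))) =
  \int[leb4]_(y in Omx `*` `[a, b]) (q y * J i y).
Proof.
move=> cq.
have cq7 w : Om w -> {for w, continuous
    (fun w : phase R => q (w.1.2, w.2) * (e / m * momentum_ratio i w.1.1))}.
  move=> [[/= Ou Ox] Tt]; apply: continuousM.
    by apply: spacetime_to_phase_continuous; apply: cq.
  by apply: continuousM; [exact: cst_continuous|exact: ratio_continuous].
have ig := integrable_moment openu openx floc fsupp a0 bT cq7.
have ig1 := integrable_moment openu openx floc fsupp a0 bT
  (fun w _ => @ratio_continuous i w).
have [iG _ GE] := prodmA_slice2 mu_ mx_ mI ig.
have [iM aeM _] := prodmA_slice2 mu_ mx_ mI ig1.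
have mM : measurable_fun (Omx `*` `[a, b] : set (mvec3 R * measurableTypeR R))
    (fun y => q y * J i y).
  apply: measurable_funM; first exact: measurable_slab.
  rewrite (_ : J i = fun y => e / m *
     \int[leb3]_(u in Omu) (f (u, y.1, y.2) * momentum_ratio i u)); last first.
    by apply/funext => y; exact: currentE.
  by apply: measurable_funM => //; apply/measurable_EFinP; exact: measurable_int iM.
have aeE : {ae leb4, forall y : spacetime R, (Omx `*` `[a, b]) y ->
    \int[leb3]_(u in Omu) (f (u, y.1, y.2) *
      (q (y.1, y.2) * (e / m * momentum_ratio i u))) = q y * J i y}.
  apply: (ae_sub aeM) => -[x t] iy Dy.
  rewrite currentE mulrA -RintegralZl//; last exact: iy.
  by apply: eq_Rintegral => u _ /=; ring.
split; first exact: integrable_ae_eq mxI mM aeE iG.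
transitivity (\int[leb4]_(y in Omx `*` `[a, b]) \int[leb3]_(u in Omu)
   (f (u, y.1, y.2) * (q (y.1, y.2) * (e / m * momentum_ratio i u)))).
  exact: GE.
apply: Rintegral_ae_eq => //.
by apply/measurable_EFinP; exact: measurable_int iG.
Qed.

Hypothesis sF : smooth Om (force m e c E B).
Hypothesis sv : smooth Om (velocity m c).
Hypothesis vl : vlasov m e c T Omu Omx f E B.
Hypothesis cE : forall i y, D y -> {for y, continuous (component i \o E)}.

Variables (psi : R -> R).
Hypotheses (tpsi : test_function `]0, T[ psi).
Hypothesis psi0 : forall t, ~ `]a, b[%classic t -> psi t = 0.

Let psi_continuous : continuous psi.
Proof.
move=> t; apply: differentiable_continuous.
by apply: Ck_diff; exact: (test_function_Ck 0 tpsi).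
Qed.

Let smooth_component_continuous (F : phase R -> vec3 R) i w : smooth Om F -> Om w ->
  {for w, continuous (component i \o F)}.
Proof.
move=> sF' Ow; apply: differentiable_continuous.
by have [] := smooth_component_c1 i (open_Omega openu openx) sF' Ow.
Qed.

(* The magnetic force is orthogonal to u, hence does no work. *)
Let force_power (w : phase R) :
  \sum_(i < 3) component i (force m e c E B w) * (psi w.2 * (component i w.1.1 /
     (m * gamma m c w.1.1))) =
  \sum_(i < 3) (psi w.2 * (component i \o E) (w.1.2, w.2)) *
    (e / m * momentum_ratio i w.1.1).
Proof.
case: w => -[u x] t /=; rewrite crossZl.
have g0 := gamma_neq0 hm hc u.
under eq_bigr do rewrite !(linearZ, linearD)/=.
rewrite !big_ord_recl !big_ord0 /= /component /= /cross /momentum_ratio /=.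
rewrite /component /= /GRing.scale/=.
by field; rewrite g0 !gt_eqF.
Qed.

Let dot_unit u i : dot u (unit_vec i) = component i u :> R.
Proof. by elim/ord3P: i; rewrite dotE /component /=; ring. Qed.

Let dot0 (u : vec3 R) : dot u 0 = 0.
Proof. by rewrite dotE /= !mulr0 !addr0. Qed.

Lemma kinetic_balance :
  \int[leb7]_(w in Z `*` `[a, b]) (f w * (kinetic_energy m c w.1.1 * 'D_1 psi w.2)) =
  - \sum_(i < 3) \int[leb4]_(y in Omx `*` `[a, b])
      ((psi y.2 * (component i \o E) y) * J i y).
Proof.
have [phi [tphi wp]] := localized_test hm hc openu openx floc fsupp tpsi a0 bT psi0.
have cF i w : Om w -> {for w, continuous (component i \o force m e c E B)}.
  exact: smooth_component_continuous.
have cV i w : Om w -> {for w, continuous (component i \o velocity m c)}.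
  exact: smooth_component_continuous.
have time : weak_pairing T Omu Omx f (0, 0, 1) phi = - \int[leb7]_(w in Z `*` `[a, b])
    (f w * (kinetic_energy m c w.1.1 * 'D_1 psi w.2)).
  have := wp (cst 1) (0, 0, 1) (fun w _ => @cst_continuous _ _ _ w).
  rewrite (_ : (fun w => cst 1 w * f w) = f); last by apply/funext => w; rewrite mul1r.
  move=> ->; congr (- _); apply: eq_Rintegral => w _; congr (_ * _).
  by rewrite /tested_derivative /= dot0 !mul1r !(mul0r, mulr0) addr0.
have space i : weak_pairing T Omu Omx (fun w => component i (velocity m c w) * f w)
    (0, unit_vec i, 0) phi = 0.
  rewrite (wp _ _ (@cV i)).
  apply/eqP; rewrite oppr_eq0; apply/eqP.
  rewrite (@Rintegral_subset _ _ _ _ set0) ?Rintegral_set0//.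
  by move=> w _ _; rewrite /tested_derivative /= dot0 !(mul0r, mulr0) addr0 !mulr0.
have momentum i : weak_pairing T Omu Omx (fun w => component i (force m e c E B w) * f w)
    (unit_vec i, 0, 0) phi =
    - \int[leb7]_(w in Z `*` `[a, b]) (f w * (component i (force m e c E B w) *
        (psi w.2 * (component i w.1.1 / (m * gamma m c w.1.1))))).
  rewrite (wp _ _ (@cF i)); congr (- _); apply: eq_Rintegral => w _; congr (_ * (_ * _)).
  by rewrite /tested_derivative /= dot_unit !(mul0r, mulr0) add0r.
have S0 : \sum_(i < 3) weak_pairing T Omu Omx
    (fun w => component i (velocity m c w) * f w) (0, unit_vec i, 0) phi = 0.
  by apply: big1 => i _; exact: space.
have S1 : \sum_(i < 3) weak_pairing T Omu Omx
    (fun w => component i (force m e c E B w) * f w) (unit_vec i, 0, 0) phi =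
    \sum_(i < 3) - \int[leb7]_(w in Z `*` `[a, b]) (f w * (component i (force m e c E B w) *
        (psi w.2 * (component i w.1.1 / (m * gamma m c w.1.1))))).
  by apply: eq_bigr => i _; exact: momentum.
have combine (A X Y K Y' : R) : A = - X - Y -> A = - K -> X = 0 -> Y = - Y' -> K = - Y'.
  by move=> -> h X0 YE; move: h; rewrite X0 YE oppr0 sub0r opprK => ->; rewrite opprK.
rewrite (combine _ _ _ _ _ (vl tphi) time S0 (etrans S1 (sumrN _ _ _))); congr (- _).
have mZI : measurable (Z `*` `[a, b] : set (mvec3 R * mvec3 R * measurableTypeR R)).
  by apply: measurableX => //; exact: measurable_phase_space.
have cpsi7 w : Om w -> {for w, continuous (fun w : phase R => psi w.2)}.
  move=> _; apply: (@continuous_comp _ _ _ snd psi); first exact: cvg_snd.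
  exact: psi_continuous.
(* The magnetic force drops out only after summation over the components, so the three integrals are
   merged before [force_power] is used pointwise, and the sum is split again on the electric
   side. *)
have sumR (g : 'I_3 -> phase R -> R) :
    (forall i w, Om w -> {for w, continuous (g i)}) ->
    \sum_(i < 3) \int[leb7]_(w in Z `*` `[a, b]) (f w * g i w) =
    \int[leb7]_(w in Z `*` `[a, b]) (f w * \sum_(i < 3) g i w).
  move=> cg.
  have ig i := integrable_moment openu openx floc fsupp a0 bT (@cg i).
  have i12 := integrable_moment openu openx floc fsupp a0 bT
    (fun w Ow => continuousD (cg 1 w Ow) (cg 2 w Ow)).
  have i012 := integrable_moment openu openx floc fsupp a0 bT
    (fun w Ow => continuousD (cg 0 w Ow) (continuousD (cg 1 w Ow) (cg 2 w Ow))).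
  rewrite !big_ord_recl big_ord0 addr0.
  transitivity (\int[leb7]_(w in Z `*` `[a, b]) (f w * (g 0 w + (g 1 w + g 2 w)))).
    under [RHS]eq_Rintegral do rewrite mulrDr.
    rewrite RintegralD//; congr (_ + _).
    under [RHS]eq_Rintegral do rewrite mulrDr.
    by rewrite RintegralD//; congr (_ + _); congr Rintegral; apply/funext => w;
      congr (_ * g _ w); exact/val_inj.
  apply: eq_Rintegral => w _; rewrite !big_ord_recl big_ord0 addr0.
  by congr (_ * (_ + (g _ w + g _ w))); exact/val_inj.
have cEp i y : D y -> {for y, continuous (fun y : spacetime R => psi y.2 * (component i \o E) y)}.
  move=> Dy; apply: continuousM; last exact: cE.
  apply: (@continuous_comp _ _ _ snd psi); first exact: cvg_snd.
  exact: psi_continuous.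
under [RHS]eq_bigr => i _ do rewrite -((current_moment i (cEp i)).2).
rewrite !sumR.
- by apply: eq_Rintegral => w _; rewrite force_power.
- move=> i w Ow; have [[/= _ Ox] Tt] := Ow; apply: continuousM.
    have Dw : D (w.1.2, w.2) by split.
    exact: (@spacetime_to_phase_continuous
      (fun y : spacetime R => psi y.2 * (component i \o E) y) w (cEp i _ Dw)).
  by apply: continuousM; [exact: cst_continuous|exact: ratio_continuous].
- move=> i w Ow; apply: continuousM; first exact: cF.
  apply: continuousM; first exact: cpsi7.
  rewrite (_ : (fun _ => _) = fun w : phase R => m^-1 * momentum_ratio i w.1.1).
    by apply: continuousM; [exact: cst_continuous|exact: ratio_continuous].
  by apply/funext => z; rewrite /momentum_ratio invfM mulrCA.
Qed.

End energy_exchange.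

(** * Balance of the field energy *)

Section integration_tools.
Context d (X : measurableType d) (R : realType) (mu : {measure set X -> \bar R}).

Lemma integrable_mul_bounded (D : set X) (g k : X -> R) (M : R) : measurable D ->
  mu.-integrable D (EFin \o g) -> measurable_fun D k ->
  (forall x, D x -> `|k x| <= M) ->
  mu.-integrable D (EFin \o (fun x => g x * k x)).
Proof.
move=> mD ig mk kM.
have bk : [bounded k x | x in D].
  by exists M; split; [exact: num_real|move=> N MN x Dx /=; exact: le_trans (kM _ Dx) (ltW MN)].
by apply: eq_integrable (integrableMl mD ig mk bk).
Qed.

Lemma integrable_extend (D' D : set X) (h : X -> R) :
  measurable D' -> measurable D -> D' `<=` D ->
  (forall x, D x -> ~ D' x -> h x = 0) ->
  mu.-integrable D' (EFin \o h) -> mu.-integrable D (EFin \o h).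
Proof.
move=> mD' mD sub h0 ih.
have i1 : mu.-integrable D ((EFin \o h) \_ D').
  by apply/(integrable_restrict mu mD' mD); rewrite setIidr.
apply: eq_integrable i1 => // x /set_mem Dx; rewrite patchE.
by case: ifPn => //; rewrite notin_setE => /(h0 _ Dx) /= ->.
Qed.

Lemma Rintegral_ae0 (D : set X) (h : X -> R) : measurable D ->
  measurable_fun D h -> {ae mu, forall x, D x -> h x = 0} ->
  \int[mu]_(x in D) h x = 0.
Proof.
move=> mD mh h0; rewrite (@Rintegral_ae_eq _ _ _ mu _ _ (cst 0))//.
by rewrite Rintegral_cst// mul0r.
Qed.

End integration_tools.

Section null_slices.
Context d1 d2 (X1 : measurableType d1) (X2 : measurableType d2) (R : realType).
Variables (m1 : {sigma_finite_measure set X1 -> \bar R})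
          (m2 : {sigma_finite_measure set X2 -> \bar R}).
Variables (A : set X1) (B : set X2) (g : X1 * X2 -> R).
Hypotheses (mA : measurable A) (mB : measurable B).
Hypothesis ig : (prodm m1 m2).-integrable (A `*` B) (EFin \o g).

(** The vanishing is asked only of integrable slices. This extra premise is what permits nesting: it
    supplies the integrability needed to slice once more. *)
Lemma null_slice1 :
  {ae m1, forall x, A x -> m2.-integrable B (EFin \o (fun y => g (x, y))) ->
     \int[m2]_(y in B) g (x, y) = 0} ->
  \int[prodm m1 m2]_(z in A `*` B) g z = 0.
Proof.
move=> g0; have [iG aeG ->] := prodm_slice1 mA mB ig.
apply: Rintegral_ae0 => //; first by apply/measurable_EFinP; exact: measurable_int iG.
by apply: filterS2 aeG g0 => x h1 h2 Ax; exact: h2 (h1 Ax).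
Qed.

Lemma null_slice2 :
  {ae m2, forall y, B y -> m1.-integrable A (EFin \o (fun x => g (x, y))) ->
     \int[m1]_(x in A) g (x, y) = 0} ->
  \int[prodm m1 m2]_(z in A `*` B) g z = 0.
Proof.
move=> g0; have [iG aeG ->] := prodm_slice2 mA mB ig.
apply: Rintegral_ae0 => //; first by apply/measurable_EFinP; exact: measurable_int iG.
by apply: filterS2 aeG g0 => x h1 h2 Ax; exact: h2 (h1 Ax).
Qed.

End null_slices.

Section fundamental_theorem.
Context {R : realType}.

Lemma Rintegral_derivative0 (F f : R -> R) (a b : R) : a < b ->
  (forall t : R, `[a, b]%classic t -> is_derive t 1 F (f t)) ->
  (forall t, `[a, b]%classic t -> {for t, continuous f}) ->
  F a = F b -> \int[lebesgue_measure]_(t in `[a, b]) f t = 0.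
Proof.
move=> ab dF cf Fab.
have cF t : `[a, b]%classic t -> {for t, continuous F}.
  move=> tab; have [dFt _] := dF t tab.
  exact/differentiable_continuous/derivable1_diffP.
have oc t : t \in `]a, b[ -> `[a, b]%classic t.
  by move=> tab; exact: subset_itv_oo_cc tab.
have aab : `[a, b]%classic a by rewrite /= in_itv/= lexx ltW.
have bab : `[a, b]%classic b by rewrite /= in_itv/= lexx ltW.
rewrite /Rintegral (@continuous_FTC2 R f F a b ab).
- by rewrite -EFinB /= Fab subrr.
- apply/subspace_continuousP => x xab; apply: cvg_within_filter; exact: cf.
- split.
  + by move=> t /oc tab; have [] := dF t tab.
  + exact/cvg_at_right_filter/cF.
  + exact/cvg_at_left_filter/cF.
- by move=> t /oc tab; rewrite derive1E; have [_ ->] := dF t tab.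
Qed.

(** The two difference quotients are the same function of h, so existence of the one directional
    derivative is enough. *)
Lemma is_derive_slice_snd (V W : normedModType R) (F : V * W -> R) x (y v : W) :
  derivable F (x, y) (0, v) ->
  is_derive y v (fun s => F (x, s)) ('D_((0, v) : V * W) F (x, y)).
Proof.
have E (h : R) : F (x, h *: v + y) = F (h *: ((0, v) : V * W) + (x, y)).
  by congr F; rewrite -[RHS]/(h *: 0 + x, h *: v + y) scaler0 add0r.
have E2 : (fun h : R => h^-1 *: (F (x, h *: v + y) - F (x, y))) =
    (fun h : R => h^-1 *: (F (h *: ((0, v) : V * W) + (x, y)) - F (x, y))).
  by apply/funext => h; rewrite E.
move=> dF; apply: DeriveDef; first by rewrite /derivable E2.
by rewrite /derive E2.
Qed.

Lemma is_derive_slice_fst (V W : normedModType R) (F : V * W -> R) (x v : V) y :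
  derivable F (x, y) (v, 0) ->
  is_derive x v (fun s => F (s, y)) ('D_((v, 0) : V * W) F (x, y)).
Proof.
have E (h : R) : F (h *: v + x, y) = F (h *: ((v, 0) : V * W) + (x, y)).
  by congr F; rewrite -[RHS]/(h *: v + x, h *: 0 + y) scaler0 add0r.
have E2 : (fun h : R => h^-1 *: (F (h *: v + x, y) - F (x, y))) =
    (fun h : R => h^-1 *: (F (h *: ((v, 0) : V * W) + (x, y)) - F (x, y))).
  by apply/funext => h; rewrite E.
move=> dF; apply: DeriveDef; first by rewrite /derivable E2.
by rewrite /derive E2.
Qed.

End fundamental_theorem.

(** * Poynting's identity *)

Section poynting.
Context {R : realType}.
Variables (m e c n0 T : R) (Omu Omx : set (vec3 R)) (f : phase R -> R)
  (E B : spacetime R -> vec3 R).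
Hypotheses (hc : 0 < c) (openx : open Omx).

Let D : set (spacetime R) := Omx `*` `]0, T[.
Let J (i : 'I_3) (y : spacetime R) := component i (current m e c Omu f y).
Let poynting (y : spacetime R) := cross (E y) (B y).

Hypotheses (cE : forall i, c1_on D (component i \o E))
           (cB : forall i, c1_on D (component i \o B)).

Lemma sum3 (F : 'I_3 -> R) : \sum_(i < 3) F i = F 0 + F 1 + F 2.
Proof.
rewrite !big_ord_recl big_ord0 addr0 addrA.
by congr (_ + F _ + F _); exact/val_inj.
Qed.

Lemma open_time_cylinder : open D.
Proof. by apply: open_setX => //; exact: itv_open. Qed.

Lemma derive_differentiableD (V : normedModType R) (F G : V -> R) v x :
  differentiable F x -> differentiable G x ->
  'D_v (fun y => F y + G y) x = 'D_v F x + 'D_v G x.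
Proof. by move=> dF dG; rewrite deriveD//; exact: diff_derivable. Qed.

Lemma derive_differentiableN (V : normedModType R) (F : V -> R) v x :
  differentiable F x -> 'D_v (fun y => - F y) x = - 'D_v F x.
Proof. by move=> dF; rewrite deriveN//; exact: diff_derivable. Qed.

Lemma c1_onM (V : normedModType R) (U : set V) (F G : V -> R) : open U ->
  c1_on U F -> c1_on U G -> c1_on U (fun x => F x * G x).
Proof.
move=> oU cF cG x Ux; have [dF dF'] := cF x Ux; have [dG dG'] := cG x Ux.
split; first exact: differentiableM.
move=> v; apply: (@near_eq_continuous _ _ (fun y => F y * 'D_v G y + G y * 'D_v F y)).
  apply: (open_near oU Ux) => y Uy; have [? _] := cF y Uy; have [? _] := cG y Uy.
  by rewrite derive_differentiableM.
by apply: continuousD; apply: continuousM => //; exact: differentiable_continuous.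
Qed.

Let square (F : spacetime R -> vec3 R) (y : spacetime R) : R :=
  (component 0 \o F) y * (component 0 \o F) y +
  ((component 1 \o F) y * (component 1 \o F) y +
   (component 2 \o F) y * (component 2 \o F) y).

Let field_squareE : field_square E B = fun y => square E y + square B y.
Proof.
by apply/funext => y; rewrite /field_square !dotE /square /component /= !addrA.
Qed.

Let c1_square F : (forall i, c1_on D (component i \o F)) -> c1_on D (square F).
Proof.
move=> cF; have oD := open_time_cylinder.
by do ?apply: c1_onD => //; apply: c1_onM.
Qed.

Lemma c1_field_square : c1_on D (field_square E B).
Proof.
rewrite field_squareE; apply: c1_onD; first exact: open_time_cylinder.
  exact: c1_square.
exact: c1_square.
Qed.

Let derive_square F y v : (forall i, c1_on D (component i \o F)) -> D y ->
  'D_v (square F) y = 2 * \sum_(i < 3) component i (F y) * 'D_v (component i \o F) y.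
Proof.
move=> cF Dy; have dF i : differentiable (component i \o F) y by have [] := cF i y Dy.
have dFF i : differentiable (fun y => (component i \o F) y * (component i \o F) y) y.
  exact: differentiableM.
rewrite derive_differentiableD//; last exact: differentiableD.
rewrite derive_differentiableD// !derive_differentiableM// sum3 /=; ring.
Qed.

Let differentiable_field F y : (forall i, c1_on D (component i \o F)) -> D y ->
  differentiable F y.
Proof.
move=> cF Dy; have dF i : differentiable (component i \o F) y by have [] := cF i y Dy.
rewrite (_ : F = fun y => ((component 0 \o F) y, (component 1 \o F) y, (component 2 \o F) y)).
  apply: (@differentiable_pair R (spacetime R) _ _
    (fun y => ((component 0 \o F) y, (component 1 \o F) y)) (component 2 \o F)) => //.
  exact: (@differentiable_pair R (spacetime R) _ _ (component 0 \o F) (component 1 \o F)).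
by apply/funext => z; rewrite /component /=; case: (F z) => -[].
Qed.

Let component_dt F i y : (forall i, c1_on D (component i \o F)) -> D y ->
  component i (dt F y) = 'D_((0, 1) : spacetime R) (component i \o F) y.
Proof.
move=> cF Dy; rewrite /dt derive_component_comp//.
exact: differentiable_field.
Qed.

Let poynting0 : component 0 \o poynting = fun y =>
  (component 1 \o E) y * (component 2 \o B) y +
  - ((component 2 \o E) y * (component 1 \o B) y).
Proof. by []. Qed.

Let poynting1 : component 1 \o poynting = fun y =>
  (component 2 \o E) y * (component 0 \o B) y +
  - ((component 0 \o E) y * (component 2 \o B) y).
Proof. by []. Qed.

Let poynting2 : component 2 \o poynting = fun y =>
  (component 0 \o E) y * (component 1 \o B) y +
  - ((component 1 \o E) y * (component 0 \o B) y).
Proof. by []. Qed.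

Lemma c1_poynting i : c1_on D (component i \o poynting).
Proof.
have oD := open_time_cylinder.
by elim/ord3P: i; [rewrite poynting0|rewrite poynting1|rewrite poynting2];
  apply: c1_onD => //; [|apply: c1_onN => //| |apply: c1_onN => //| |apply: c1_onN => //];
  apply: c1_onM.
Qed.

Let derive_bilinear (F G H K : spacetime R -> R) v y :
  differentiable F y -> differentiable G y ->
  differentiable H y -> differentiable K y ->
  'D_v (fun z => F z * G z + - (H z * K z)) y =
  F y * 'D_v G y + G y * 'D_v F y - (H y * 'D_v K y + K y * 'D_v H y).
Proof.
move=> dF dG dH dK; rewrite derive_differentiableD; last 2 first.
- exact: differentiableM.
- by apply: differentiableN; exact: differentiableM.
rewrite derive_differentiableN; last exact: differentiableM.
by rewrite !derive_differentiableM.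
Qed.

Let divergence_poynting y : D y -> divergence poynting y =
  dot (B y) (curl E y) - dot (E y) (curl B y).
Proof.
move=> Dy.
have dE i : differentiable (component i \o E) y by have [] := cE i Dy.
have dB i : differentiable (component i \o B) y by have [] := cB i Dy.
rewrite /divergence sum3 /partial poynting0 poynting1 poynting2.
rewrite !derive_bilinear// !dotE /curl /partial.
(* Once the components and their partial derivatives are replaced by indexed variables, div (E x B)
   = B . curl E - E . curl B is a polynomial identity. *)
have id (u v : 'I_3 -> R) (du dv : 'I_3 -> 'I_3 -> R) :
    u 1 * dv 2 0 + v 2 * du 1 0 - (u 2 * dv 1 0 + v 1 * du 2 0) +
    (u 2 * dv 0 1 + v 0 * du 2 1 - (u 0 * dv 2 1 + v 2 * du 0 1)) +
    (u 0 * dv 1 2 + v 1 * du 0 2 - (u 1 * dv 0 2 + v 0 * du 1 2)) =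
    v 0 * (du 2 1 - du 1 2) + v 1 * (du 0 2 - du 2 0) + v 2 * (du 1 0 - du 0 1) -
    (u 0 * (dv 2 1 - dv 1 2) + u 1 * (dv 0 2 - dv 2 0) + u 2 * (dv 1 0 - dv 0 1)).
  by ring.
exact: (id (fun i => component i (E y)) (fun i => component i (B y))
  (fun i j => 'D_((unit_vec j, 0) : spacetime R) (component i \o E) y)
  (fun i j => 'D_((unit_vec j, 0) : spacetime R) (component i \o B) y)).
Qed.

(** Ampere's law is paired with E and Faraday's law with B; the two curl terms then form exactly the
    divergence of E x B. Since 2 E . d_t E appears, the source 4 pi J acquires the factor 8 pi. *)
Lemma poynting_balance : maxwell m e c n0 T Omu Omx f E B ->
  {ae leb4, forall y : spacetime R, D y ->
    'D_((0, 1) : spacetime R) (field_square E B) y =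
    - (2 * c) * divergence poynting y -
    8 * pi * \sum_(i < 3) component i (E y) * J i y}.
Proof.
move=> max; apply: (ae_sub max) => y + Dy => /(_ Dy)[ampere faraday _ _].
have c0 : c != 0 by rewrite gt_eqF.
rewrite field_squareE derive_differentiableD; last 2 first.
- by have [] := c1_square cE Dy.
- by have [] := c1_square cB Dy.
rewrite !derive_square// divergence_poynting// !sum3 -!component_dt//.
have am i : component i (dt E y) = c * component i (curl B y) - 4 * pi * J i y.
  have := congr1 (component i) ampere.
  rewrite linearD/= !linearZ/= /GRing.scale/= -/(J i y) => h.
  have -> : component i (curl B y) =
     c^-1 * component i (dt E y) + 4 * pi / c * J i y by rewrite -h; ring.
  by field.
have fa i : component i (dt B y) = - c * component i (curl E y).
  have := congr1 (component i) faraday.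
  rewrite linearD/= !linearZ/= linear0 /GRing.scale/= => h.
  have -> : component i (curl E y) = - (c^-1 * component i (dt B y)).
    by apply/eqP; rewrite -addr_eq0 addrC h.
  by field.
have id (u v tu tv cu cv j : 'I_3 -> R) (p : R) :
    (forall i, tu i = c * cv i - 4 * p * j i) -> (forall i, tv i = - c * cu i) ->
    2 * (u 0 * tu 0 + u 1 * tu 1 + u 2 * tu 2) +
    2 * (v 0 * tv 0 + v 1 * tv 1 + v 2 * tv 2) =
    - (2 * c) * (v 0 * cu 0 + v 1 * cu 1 + v 2 * cu 2 -
                 (u 0 * cv 0 + u 1 * cv 1 + u 2 * cv 2)) -
    8 * p * (u 0 * j 0 + u 1 * j 1 + u 2 * j 2).
  by move=> tuE tvE; rewrite !tuE !tvE; ring.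
rewrite !dotE.
exact: (id (fun i => component i (E y)) (fun i => component i (B y))
  (fun i => component i (dt E y)) (fun i => component i (dt B y))
  (fun i => component i (curl E y)) (fun i => component i (curl B y))
  (fun i => J i y) pi am fa).
Qed.

End poynting.

(** * Integration by parts in time with a spatial weight *)

Section transport.
Context {R : realType}.
Variables (T : R) (Omx : set (vec3 R)) (a b : R) (psi : R -> R).
Hypotheses (openx : open Omx) (a0 : 0 < a) (ab : a < b) (bT : b < T).
Hypothesis Cpsi : forall n, Ck n psi.
Hypothesis psi0 : forall t, ~ `]a, b[%classic t -> psi t = 0.

Let D : set (spacetime R) := Omx `*` `]0, T[.
Let slab : set (mvec3 R * measurableTypeR R) := Omx `*` `[a, b].

Lemma measurable_slab : measurable slab.
Proof.
by apply: measurableX; [exact: vec3_open_measurable|exact: measurable_itv].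
Qed.

Lemma slab_sub : slab `<=` D.
Proof. by move=> [x t] [/= ? /(slab_subset a0 bT)]. Qed.

Lemma measurable_fun_slab (q : spacetime R -> R) :
  (forall y, D y -> {for y, continuous q}) -> measurable_fun slab q.
Proof.
move=> cq; have mD : measurable (D : set (mvec3 R * measurableTypeR R)).
  by apply: measurableX; [exact: vec3_open_measurable|exact: measurable_itv].
have oD : open D by exact: open_time_cylinder.
exact: measurable_funS mD slab_sub (spacetime_continuous_measurable oD cq).
Qed.

Lemma measurable_fun_time (k : R -> R) : continuous k ->
  measurable_fun slab (fun y : mvec3 R * measurableTypeR R => k y.2).
Proof.
move=> ck; apply: measurable_funTS; apply: (@measurableT_comp _ _ _ _ _ _ k) => //.
exact: continuous_measurable_fun.
Qed.

Lemma psi_diff t : differentiable psi t.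
Proof. exact: Ck_diff (Cpsi 0). Qed.

Lemma psi_cont : continuous psi.
Proof. by move=> t; exact: differentiable_continuous (psi_diff t). Qed.

Lemma dpsi_cont : continuous (fun t => 'D_1 psi t).
Proof.
move=> t; apply: differentiable_continuous.
by have [_ C1] := Cpsi 1; exact: (@Ck_diff R R 0 _ t (C1 1)).
Qed.

Lemma continuous_bound_itv (k : R -> R) : continuous k ->
  exists M, forall t, `[a, b]%classic t -> `|k t| <= M.
Proof.
move=> ck; have [M [_ kM]] := @continuous_compact_bounded R R `[a, b] k
  (@segment_compact _ a b) (fun t _ => ck t).
(* Boundedness is formulated for every constant strictly above [M], whence the added 1. *)
by exists (M + 1) => t tab; apply: kM => //; rewrite ltrDl.
Qed.

Lemma integrable_mul_time (g : spacetime R -> R) (k : R -> R) : continuous k ->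
  leb4.-integrable slab (EFin \o g) ->
  leb4.-integrable slab (EFin \o (fun y => g y * k y.2)).
Proof.
move=> ck ig; have [M kM] := continuous_bound_itv ck.
apply: (integrable_mul_bounded (M := M) measurable_slab ig).
  exact: measurable_fun_time.
by move=> y [_ /= y2]; exact: kM.
Qed.

Lemma integrable_mul_space (g : spacetime R -> R) (chi : vec3 R -> R) :
  measurable_fun setT (chi : mvec3 R -> R) -> (forall x, `|chi x| <= 1) ->
  leb4.-integrable slab (EFin \o g) ->
  leb4.-integrable slab (EFin \o (fun y => g y * chi y.1)).
Proof.
move=> mchi chi1 ig; apply: (integrable_mul_bounded (M := 1) measurable_slab ig) => //.
by apply: measurable_funTS; apply: (@measurableT_comp _ _ _ _ _ _ (chi : mvec3 R -> R)).
Qed.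

(** In use, [P] is the field energy density, [V] a multiple of div (E x B) and [W] the power 8 pi E
    . J. Only the product of [V] with the weight is assumed integrable, so that the same statement
    covers a genuine cutoff and the weight 1. *)
Lemma transport_balance (P V W : spacetime R -> R) (chi : vec3 R -> R) :
  c1_on D P -> leb4.-integrable slab (EFin \o P) ->
  leb4.-integrable slab (EFin \o W) ->
  leb4.-integrable slab (EFin \o (fun y => V y * chi y.1)) ->
  {ae leb4, forall y : spacetime R, D y ->
     'D_((0, 1) : spacetime R) P y = - V y - W y} ->
  measurable_fun setT (chi : mvec3 R -> R) -> (forall x, `|chi x| <= 1) ->
  \int[leb4]_(y in slab) (P y * chi y.1 * 'D_1 psi y.2) =
  \int[leb4]_(y in slab) (V y * chi y.1 * psi y.2) +
  \int[leb4]_(y in slab) (W y * chi y.1 * psi y.2).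
Proof.
move=> cP iP iW iV PVW mchi chi1.
pose Q (y : spacetime R) := 'D_((0, 1) : spacetime R) P y.
have mS := measurable_slab.
have i1 : leb4.-integrable slab (EFin \o (fun y => P y * chi y.1 * 'D_1 psi y.2)).
  apply: (integrable_mul_time (g := fun y => P y * chi y.1) dpsi_cont).
  exact: integrable_mul_space.
have iVp : leb4.-integrable slab (EFin \o (fun y => V y * chi y.1 * psi y.2)).
  exact: (integrable_mul_time (g := fun y => V y * chi y.1) psi_cont iV).
have iWp : leb4.-integrable slab (EFin \o (fun y => W y * chi y.1 * psi y.2)).
  apply: (integrable_mul_time (g := fun y => W y * chi y.1) psi_cont).
  exact: integrable_mul_space.
have iVWp : leb4.-integrable slab (EFin \o (fun y =>
    - (V y * chi y.1 * psi y.2 + W y * chi y.1 * psi y.2))).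
  have h := integrableN (integrableD mS iVp iWp).
  by apply: eq_integrable h => // y _ /=; rewrite -EFinD -EFinN.
have mQ : measurable_fun slab (fun y => Q y * chi y.1 * psi y.2).
  apply: measurable_funM; last exact: measurable_fun_time psi_cont.
  apply: measurable_funM.
    by apply: measurable_fun_slab => y Dy; have [_] := cP y Dy; exact.
  by apply: measurable_funTS; apply: (@measurableT_comp _ _ _ _ _ _ (chi : mvec3 R -> R)).
have QE : {ae leb4, forall y : spacetime R, slab y ->
    - (V y * chi y.1 * psi y.2 + W y * chi y.1 * psi y.2) = Q y * chi y.1 * psi y.2}.
  by apply: (ae_sub PVW) => y h /slab_sub /h; rewrite /Q => ->; ring.
(* Integrability of the time derivative of [P] is not given: it is read off from the equation, whose
   right-hand side is integrable after weighting. *)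
have i2 : leb4.-integrable slab (EFin \o (fun y => Q y * chi y.1 * psi y.2)).
  exact: integrable_ae_eq mS mQ QE iVWp.
have i12 : leb4.-integrable slab (EFin \o (fun y =>
    P y * chi y.1 * 'D_1 psi y.2 + Q y * chi y.1 * psi y.2)).
  have h := integrableD mS i1 i2.
  by apply: eq_integrable h => // y _ /=; rewrite -EFinD.
have mx := vec3_open_measurable openx.
have mI : measurable (`[a, b]%classic : set (measurableTypeR R)) by exact: measurable_itv.
have : \int[leb4]_(y in slab) (P y * chi y.1 * 'D_1 psi y.2 + Q y * chi y.1 * psi y.2) = 0.
  apply: (null_slice1 mx mI i12); apply: aeW => x Ox _ /=.
  (* At fixed x the integrand is a time derivative. The boundary terms vanish because psi is zero
     off the open interval, in particular at a and b. *)
  apply: (@Rintegral_derivative0 R (fun t => P (x, t) * psi t * chi x)) => //.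
  - move=> t /(slab_subset a0 bT) tT; have Dxt : D (x, t) by split.
    have [dP _] := cP _ Dxt.
    have dPx := is_derive_slice_snd (diff_derivable (v := ((0, 1) : spacetime R)) dP).
    have dpsi : is_derive t 1 psi ('D_1 psi t).
      exact: derivableP (diff_derivable (v := (1 : R)) (psi_diff t)).
    have dchi := is_derive_cst (chi x) t (1 : R).
    apply: (is_derive_eq (is_deriveM (is_deriveM dPx dpsi) dchi)).
    by rewrite scaler0 add0r /GRing.scale/= /Q; ring.
  - move=> t /(slab_subset a0 bT) tT; have Dxt : D (x, t) by split.
    have [dP cP'] := cP _ Dxt.
    have cx : {for t, continuous (fun t => (x, t) : spacetime R)}.
      apply: differentiable_continuous.
      by apply: (@differentiable_pair R R (vec3 R) R (cst (x : vec3 R)) id).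
    have cPx : {for t, continuous (fun t => P (x, t))}.
      exact: (@continuous_comp _ _ _ (fun t => (x, t) : spacetime R) P t cx
        (differentiable_continuous dP)).
    have cQx : {for t, continuous (fun t => Q (x, t))}.
      exact: (@continuous_comp _ _ _ (fun t => (x, t) : spacetime R) Q t cx (cP' _)).
    apply: continuousD; apply: continuousM; try (apply: continuousM => //; exact: cst_continuous).
      exact: dpsi_cont.
    exact: psi_cont.
  - by rewrite !psi0 ?mulr0 ?mul0r//= in_itv/= ltxx ?andbF.
rewrite RintegralD// -(Rintegral_ae_eq mS _ _ QE).
- have -> : \int[leb4]_(y in slab) (- (V y * chi y.1 * psi y.2 + W y * chi y.1 * psi y.2)) =
      - (\int[leb4]_(y in slab) (V y * chi y.1 * psi y.2) +
         \int[leb4]_(y in slab) (W y * chi y.1 * psi y.2)).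
    rewrite -RintegralD// -mulN1r -RintegralZl//.
      by apply: eq_Rintegral => y _; rewrite mulN1r.
    have h := integrableD mS iVp iWp.
    by apply: eq_integrable h => // y _ /=; rewrite -EFinD.
  by move/eqP; rewrite subr_eq0 => /eqP.
- by apply/measurable_EFinP; exact: measurable_int iVWp.
- exact: mQ.
Qed.

End transport.

(** * Cutoffs in space and the flux at infinity *)

Section space_cutoff.
Context {R : realType}.

Lemma cutoff_derive_bound : exists C : R, 0 <= C /\ forall x, `|'D_1 cutoff x| <= C.
Proof.
have out t : ~ `](-2), 2[%classic t -> cutoff t = 0 :> R.
  move=> /= /negP; rewrite in_itv/= negb_and -!leNgt => h; apply: cutoff_eq0.
  by rewrite ler_normr; case/orP: h => h; apply/orP; [right|left]; lra.
have cd : continuous (fun t : R => 'D_1 cutoff t).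
  move=> t; apply: differentiable_continuous.
  by have [_ C1] := @Ck_cutoff R 1; exact: (@Ck_diff R R 0 _ t (C1 1)).
have [M Mb] := continuous_bound_itv (-2) 2 cd.
exists `|M|; split=> // x; have [xin|xout] := pselect (`[-2, 2]%classic x).
  exact: le_trans (Mb _ xin) (ler_norm _).
by rewrite (test_function_derive_out out xout) normr0.
Qed.

(** A product over coordinates, adapted to cubes: it is 1 on the cube of half-side 1 / k and 0
    outside the one of half-side 2 / k, so small [k] means a large cube. *)
Definition space_cutoff (k : R) (x : vec3 R) : R :=
  cutoff (k * component 0 x) * (cutoff (k * component 1 x) * cutoff (k * component 2 x)).

Let factor (k : R) (i : 'I_3) (x : vec3 R) : R := cutoff (k * component i x).

Let Ck_arg n k i : Ck n (fun x : vec3 R => k * component i x).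
Proof. by apply: Ck_mul; [exact: Ck_cst|exact: Ck_component]. Qed.

Let Ck_factor n k i : Ck n (factor k i).
Proof. exact: (Ck_comp (Ck_cutoff n) (Ck_arg n k i)). Qed.

Lemma Ck_space_cutoff n k : Ck n (space_cutoff k).
Proof. by apply: Ck_mul; [|apply: Ck_mul]; exact: Ck_factor. Qed.

Let factor_norm k i x : `|factor k i x| <= 1.
Proof. by rewrite ger0_norm ?cutoff_ge0 ?cutoff_le1. Qed.

Let norm_mul_le1 (u v : R) : `|u| <= 1 -> `|v| <= 1 -> `|u * v| <= 1.
Proof. by move=> u1 v1; rewrite normrM -[leRHS]mul1r ler_pM. Qed.

Lemma space_cutoff_norm k x : `|space_cutoff k x| <= 1.
Proof.
by apply: norm_mul_le1; last apply: norm_mul_le1; exact: factor_norm.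
Qed.

Lemma space_cutoff_out k i x : 0 < k -> 2 / k <= `|component i x| -> space_cutoff k x = 0.
Proof.
move=> k0 h; have : factor k i x = 0.
  by apply: cutoff_eq0; rewrite normrM gtr0_norm// -ler_pdivrMl// mulrC.
rewrite /space_cutoff -/(factor k 0 x) -/(factor k 1 x) -/(factor k 2 x).
by elim/ord3P: i {h} => ->; rewrite !(mul0r, mulr0).
Qed.

Lemma space_cutoff_in k x : 0 < k -> (forall i, `|component i x| <= k^-1) ->
  space_cutoff k x = 1.
Proof.
move=> k0 h; have f1 i : factor k i x = 1.
  by apply: cutoff_eq1; rewrite normrM gtr0_norm// -ler_pdivlMl// mulr1.
rewrite /space_cutoff -/(factor k 0 x) -/(factor k 1 x) -/(factor k 2 x).
by rewrite !f1 !mulr1.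
Qed.

Let derive_factor k i x v :
  'D_v (factor k i) x = k * component i v * 'D_1 cutoff (k * component i x).
Proof.
rewrite (@derive_comp1 _ _ cutoff (fun x => k * component i x)); first last.
- exact: Ck_diff (Ck_cutoff 0).
- exact: Ck_diff (Ck_arg 0 k i).
congr (_ * _).
rewrite derive_differentiableM; [|exact: differentiable_cst|].
  by rewrite derive_cst mulr0 addr0 derive_component.
exact: Ck_diff (Ck_component 0 i).
Qed.

Lemma space_cutoff_derive_bound : exists C : R, 0 <= C /\
  forall k x j, 0 < k -> `|'D_(unit_vec j) (space_cutoff k) x| <= k * C.
Proof.
have [C [C0 CP]] := cutoff_derive_bound.
(* One [C] for each term of the product rule for three factors, the undifferentiated factors being
   at most 1. *)
exists (3 * C); split; first by rewrite mulr_ge0.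
move=> k x j k0.
have dfac i : differentiable (factor k i) x by exact: Ck_diff (Ck_factor 0 k i).
have bf i : `|'D_(unit_vec j) (factor k i) x| <= k * C.
  rewrite derive_factor !normrM gtr0_norm// -mulrA ler_wpM2l ?(ltW k0)//.
  rewrite -[leRHS]mul1r ler_pM//.
  by elim/ord3P: i; elim/ord3P: j; rewrite /component /= ?normr0 ?normr1.
have bM (u v : R) : `|u| <= 1 -> `|v| <= k * C -> `|u * v| <= k * C.
  by move=> u1 v1; rewrite normrM -[leRHS]mul1r ler_pM.
have d12 : differentiable (fun x => factor k 1 x * factor k 2 x) x.
  exact: differentiableM.
rewrite -[space_cutoff k]/(fun x => factor k 0 x * (factor k 1 x * factor k 2 x)).
rewrite (derive_differentiableM _ (dfac 0) d12).
rewrite (derive_differentiableM _ (dfac 1) (dfac 2)).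
rewrite mulrDr.
have -> : k * (3 * C) = k * C + k * C + k * C by ring.
apply: le_trans (ler_normD _ _) _; apply: lerD.
  apply: le_trans (ler_normD _ _) _; apply: lerD.
  - by apply: (bM _ _) => //; apply: (bM _ _).
  - by apply: (bM _ _) => //; apply: (bM _ _).
by apply: (bM _ _) => //; exact: norm_mul_le1.
Qed.

End space_cutoff.

Section compactly_supported_integrals.
Context {R : realType}.

Lemma Rintegral_derivative_compact (F f : R -> R) (M : R) : 0 < M ->
  (forall t : R, is_derive t 1 F (f t)) -> continuous f ->
  (forall t, M <= `|t| -> F t = 0) ->
  \int[lebesgue_measure]_(t in setT) f t = 0.
Proof.
move=> M0 dF cf F0.
have f0 t : ~ `[-M, M]%classic t -> f t = 0.
  move=> nt; have [_ <-] := dF t.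
  apply: (@test_function_derive_out R F (-M) M) nt => s /= /negP.
  rewrite in_itv/= negb_and -!leNgt => h; apply: F0; rewrite ler_normr.
  by case/orP: h => h; apply/orP; [right|left]; lra.
rewrite (@Rintegral_subset _ (measurableTypeR R) R lebesgue_measure `[-M, M]%classic setT f)//; last first.
  by move=> t _; exact: f0.
have MM : - M < M by lra.
apply: (Rintegral_derivative0 MM (fun t _ => dF t) (fun t _ => cf t)).
by rewrite !F0 ?normrN ?gtr0_norm.
Qed.

(* Fubini with the innermost integral along the i-th axis. *)
Lemma Rintegral_partial_compact (w : vec3 R -> R) (M k : R) (i : 'I_3) : 0 < M ->
  (forall x, differentiable w x) -> continuous (fun x => 'D_(unit_vec i) w x) ->
  (forall x, M <= `|component i x| -> w x = 0) ->
  leb3.-integrable setT (EFin \o (fun x => 'D_(unit_vec i) w x * k)) ->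
  \int[leb3]_(x in setT) ('D_(unit_vec i) w x * k) = 0.
Proof.
move=> M0 dw cw w0.
(* [gam] parametrizes a line parallel to the i-th axis; the fundamental theorem along it is shared
   by the three orders of integration below. *)
have axis (gam : R -> vec3 R) : continuous gam ->
    (forall s, component i (gam s) = s) ->
    (forall s : R, is_derive s 1 (fun s => w (gam s)) ('D_(unit_vec i) w (gam s))) ->
    \int[lebesgue_measure]_(s in setT) ('D_(unit_vec i) w (gam s) * k) = 0.
  move=> cg gi dg.
  have dgk (s : R) : is_derive s 1 (fun s => w (gam s) * k)
      ('D_(unit_vec i) w (gam s) * k).
    have dk := is_derive_cst k s (1 : R).
    apply: (is_derive_eq (is_deriveM (dg s) dk)).
    by rewrite scaler0 add0r /GRing.scale/= mulrC.
  have cgk (s : R) : {for s, continuous (fun s => 'D_(unit_vec i) w (gam s) * k)}.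
    apply: continuousM; last exact: cst_continuous.
    exact: (@continuous_comp _ _ _ gam (fun x => 'D_(unit_vec i) w x) s (cg s) (cw _)).
  apply: (Rintegral_derivative_compact M0 dgk cgk).
  by move=> t Mt; rewrite w0 ?mul0r// gi.
have dd x v : derivable w x v by exact: diff_derivable.
have cpair (V W : normedModType R) (x : V) : continuous (fun s : W => (x, s)).
  move=> s; apply: differentiable_continuous.
  by apply: (@differentiable_pair R W V W (cst x) id).
have cpair' (V W : normedModType R) (y : W) : continuous (fun s : V => (s, y)).
  move=> s; apply: differentiable_continuous.
  by apply: (@differentiable_pair R V V W id (cst y)).
rewrite -setXTT => ig.
elim/ord3P: i axis w0 cw ig => axis w0 cw ig.
- apply: (null_slice2 measurableT measurableT ig); apply: aeW => x3 _.
  rewrite -setXTT => ig2; apply: (null_slice2 measurableT measurableT ig2).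
  apply: aeW => x2 _ _.
  have cg : continuous (fun s : R => (s, x2, x3)).
    move=> s; apply: (@continuous_comp _ _ _ (fun s : R => (s, x2)) (fun p => (p, x3))).
      exact: cpair'.
    exact: cpair'.
  apply: (axis (fun s => (s, x2, x3)) cg) => // s.
  have h := is_derive_slice_fst (dd (s, x2, x3) ((1, 0) : R * R, 0)).
  have [h1 h2] := h.
  have := @is_derive_slice_fst R R R (fun p => w (p, x3)) s 1 x2 h1.
  by rewrite h2.
- apply: (null_slice2 measurableT measurableT ig); apply: aeW => x3 _.
  rewrite -setXTT => ig2; apply: (null_slice1 measurableT measurableT ig2).
  apply: aeW => x1 _ _.
  have cg : continuous (fun s : R => (x1, s, x3)).
    move=> s; apply: (@continuous_comp _ _ _ (fun s : R => (x1, s)) (fun p => (p, x3))).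
      exact: cpair.
    exact: cpair'.
  apply: (axis (fun s => (x1, s, x3)) cg) => // s.
  have h := is_derive_slice_fst (dd (x1, s, x3) ((0, 1) : R * R, 0)).
  have [h1 h2] := h.
  have := @is_derive_slice_snd R R R (fun p => w (p, x3)) x1 s 1 h1.
  by rewrite h2.
- apply: (null_slice1 measurableT measurableT ig); apply: aeW => x12 _ _.
  have cg : continuous (fun s : R => (x12, s) : vec3 R) by exact: cpair.
  apply: (axis (fun s => (x12, s)) cg) => // s.
  exact: (is_derive_slice_snd (dd (x12, s) (0, 1))).
Qed.

End compactly_supported_integrals.

Section whole_space.
Context {R : realType}.
Variables (T a b : R) (psi : R -> R).
Hypotheses (a0 : 0 < a) (ab : a < b) (bT : b < T).
Hypothesis Cpsi : forall n, Ck n psi.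
Hypothesis psi0 : forall t, ~ `]a, b[%classic t -> psi t = 0.

Let D : set (spacetime R) := setT `*` `]0, T[.
Let slab : set (mvec3 R * measurableTypeR R) := setT `*` `[a, b].

Let mS : measurable slab. Proof. exact: measurable_slab openT. Qed.

Let mchi (k : R) : measurable_fun setT (space_cutoff k : mvec3 R -> R).
Proof.
apply: (@borel_continuous_measurable _ (mvec3 R) (Topological.class (vec3 R)) R
  (@compact_base_vec3 R)); first exact: openT.
by move=> x _; apply: differentiable_continuous; exact: Ck_diff (Ck_space_cutoff 0 k).
Qed.

(** No growth condition on [q] is needed: the product vanishes outside a compact box of finite
    measure, on which a continuous function is bounded. *)
Let integrable_cutoff (k : R) (q : spacetime R -> R) : 0 < k ->
  (forall y, D y -> {for y, continuous q}) ->
  leb4.-integrable slab (EFin \o (fun y => q y * space_cutoff k y.1)).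
Proof.
move=> k0 cq; pose I := `[- (2 / k), 2 / k]%classic : set R.
have mI : measurable (I : set (measurableTypeR R)) by exact: measurable_itv.
have mJ : measurable (`[a, b]%classic : set (measurableTypeR R)) by exact: measurable_itv.
pose box : set (mvec3 R * measurableTypeR R) := I `*` I `*` I `*` `[a, b].
have mbox : measurable box by do ! apply: measurableX => //.
have cI : compact I by exact: segment_compact.
have cbox : compact (box : set (spacetime R)).
  by do ! apply: compact_setX => //; exact: segment_compact.
have sub : box `<=` slab by move=> [x t] [/= _ tab].
apply: (integrable_extend mbox mS sub).
  move=> [x t] [/= _ tab] nbox.
  have [i hi] : exists i, 2 / k <= `|component i x|.
    apply: contrapT => h; apply: nbox; split=> //=.
    have hI i : I (component i x).
      have : ~ (2 / k <= `|component i x|) by move=> hi; apply: h; exists i.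
      by move/negP; rewrite -ltNge /I /= in_itv/= ltr_norml => /andP[? ?]; rewrite !ltW.
    by split; [split; [exact: (hI 0)|exact: (hI 1)]|exact: (hI 2)].
  by rewrite (space_cutoff_out k0 hi) mulr0.
apply: measurable_bounded_integrable => //.
- have fI : (lebesgue_measure I < +oo)%E by exact: compact_finite_measure.
  have fJ : (lebesgue_measure (`[a, b]%classic : set R) < +oo)%E.
    by apply: compact_finite_measure; exact: segment_compact.
  have fin d1 d2 (X1 : measurableType d1) (X2 : measurableType d2)
      (m1 : {sigma_finite_measure set X1 -> \bar R})
      (m2 : {sigma_finite_measure set X2 -> \bar R}) A B :
      measurable A -> measurable B -> (m1 A < +oo)%E -> (m2 B < +oo)%E ->
      (prodm m1 m2 (A `*` B) < +oo)%E.
    move=> mA mB fA fB; rewrite /prodm product_measure1E//.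
    by rewrite lte_mul_pinfty// ge0_fin_numE.
  have f2 := fin _ _ _ _ (@lebesgue_measure R) (@lebesgue_measure R) _ _ mI mI fI fI.
  have f3 := fin _ _ _ _ _ (@lebesgue_measure R) _ _ (measurableX mI mI) mI f2 fI.
  exact: fin _ _ _ _ _ (@lebesgue_measure R) _ _ (measurableX (measurableX mI mI) mI) mJ f3 fJ.
- apply: measurable_funS mS sub _; apply: measurable_funM.
    exact: (measurable_fun_slab openT a0 bT cq).
  by apply: measurable_funTS; apply: (@measurableT_comp _ _ _ _ _ _ (space_cutoff k : mvec3 R -> R)).
- apply: (@continuous_compact_bounded R (spacetime R) box) => // y boxy.
  have Dy : D y by apply: (slab_sub a0 bT); exact: sub.
  apply: continuousM; first exact: cq.
  apply: (@continuous_comp _ _ _ fst (space_cutoff k)); first exact: cvg_fst.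
  by apply: differentiable_continuous; exact: Ck_diff (Ck_space_cutoff 0 k).
Qed.

Variables (S : 'I_3 -> spacetime R -> R) (P : spacetime R -> R).
Hypothesis cS : forall i, c1_on D (S i).
Hypothesis SP : forall i y, `|S i y| <= P y.
Hypothesis iP : leb4.-integrable slab (EFin \o P).

Let divS (y : spacetime R) : R := \sum_(i < 3) 'D_((unit_vec i, 0) : spacetime R) (S i) y.

Let oD : open D. Proof. by apply: open_setX; [exact: openT|exact: itv_open]. Qed.

Let dS i y : D y -> differentiable (S i) y.
Proof. by move=> Dy; have [] := cS i Dy. Qed.

Let cdS i y v : D y -> {for y, continuous (fun y => 'D_v (S i) y)}.
Proof. by move=> Dy; have [_] := cS i Dy; exact. Qed.

Let dchi (k : R) (x : vec3 R) : differentiable (space_cutoff k) x.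
Proof. exact: Ck_diff (Ck_space_cutoff 0 k). Qed.

Let cdchi (k : R) (v : vec3 R) : continuous (fun x => 'D_v (space_cutoff k) x : R).
Proof.
move=> x; apply: differentiable_continuous.
by have [_ C1] := @Ck_space_cutoff R 1 k; exact: (@Ck_diff R (vec3 R) 0 _ x (C1 v)).
Qed.

Let flux_derivative (k : R) i (y : spacetime R) : D y ->
  'D_((unit_vec i, 0) : spacetime R) (fun y => S i y * space_cutoff k y.1) y =
  S i y * 'D_(unit_vec i) (space_cutoff k) y.1 +
  space_cutoff k y.1 * 'D_((unit_vec i, 0) : spacetime R) (S i) y.
Proof.
move=> Dy; rewrite derive_differentiableM; [|exact: dS|].
  by rewrite (@derive_fst R (vec3 R) R (space_cutoff k)).
apply: (@differentiable_comp R (spacetime R) _ _ fst (space_cutoff k)) => //.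
by apply: (@linear_differentiable R (spacetime R) _ fst) => ?; exact: cvg_fst.
Qed.

Let grad_integrable (k : R) i : 0 < k ->
  leb4.-integrable slab (EFin \o (fun y => S i y * 'D_(unit_vec i) (space_cutoff k) y.1)).
Proof.
move=> k0; have [C [C0 CP]] := @space_cutoff_derive_bound R.
apply: (integrable_mul_bounded (M := k * C) mS).
- have mSi : measurable_fun slab (S i).
    apply: (measurable_fun_slab openT a0 bT) => y Dy.
    exact: differentiable_continuous (dS i Dy).
  apply: le_integrable iP => //; first exact/measurable_EFinP.
  by move=> y _ /=; rewrite lee_fin (le_trans (SP i y))// ler_norm.
- apply: measurable_funTS.
  apply: (@measurableT_comp _ _ _ _ _ _ ((fun x => 'D_(unit_vec i) (space_cutoff k) x) : mvec3 R -> R)) => //.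
  apply: (@borel_continuous_measurable _ (mvec3 R) (Topological.class (vec3 R)) R
    (@compact_base_vec3 R)); first exact: openT.
  by move=> x _; exact: cdchi.
- by move=> y _; exact: CP.
Qed.

(** Integration by parts in the i-th coordinate. At each time the product of [S i] with the cutoff
    has bounded support in x, so its derivative integrates to zero over space; psi depends on t
    alone and acts as a constant. *)
Let flux_null (k : R) i : 0 < k ->
  \int[leb4]_(y in slab) (space_cutoff k y.1 * 'D_((unit_vec i, 0) : spacetime R) (S i) y * psi y.2) =
  - \int[leb4]_(y in slab) (S i y * 'D_(unit_vec i) (space_cutoff k) y.1 * psi y.2).
Proof.
move=> k0; pose G (y : spacetime R) :=
  'D_((unit_vec i, 0) : spacetime R) (fun y => S i y * space_cutoff k y.1) y * psi y.2.
have i1 := integrable_mul_time openT (psi_cont Cpsi) (grad_integrable i k0).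
have i2 : leb4.-integrable slab (EFin \o (fun y =>
    space_cutoff k y.1 * 'D_((unit_vec i, 0) : spacetime R) (S i) y * psi y.2)).
  have h := @integrable_cutoff k _ k0 (fun y => @cdS i y (unit_vec i, 0)).
  have := integrable_mul_time openT (psi_cont Cpsi) h.
  by apply: eq_integrable => // y _ /=; congr (_ * _)%:E; rewrite mulrC.
have GE y : slab y -> S i y * 'D_(unit_vec i) (space_cutoff k) y.1 * psi y.2 +
    space_cutoff k y.1 * 'D_((unit_vec i, 0) : spacetime R) (S i) y * psi y.2 = G y.
  by move=> /(slab_sub a0 bT) Dy; rewrite /G flux_derivative// mulrDl.
have iG : leb4.-integrable slab (EFin \o G).
  have h := integrableD mS i1 i2.
  by apply: eq_integrable h => // y /set_mem sy /=; rewrite -EFinD GE.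
apply/eqP; rewrite -addr_eq0 addrC -RintegralD//; apply/eqP.
transitivity (\int[leb4]_(y in slab) G y).
  by apply: eq_Rintegral => y /set_mem; exact: GE.
have mJ : measurable (`[a, b]%classic : set (measurableTypeR R)) by exact: measurable_itv.
apply: (null_slice2 (@measurableT _ (mvec3 R)) mJ iG); apply: aeW => t /(slab_subset a0 bT) tT.
have Dx (x : vec3 R) : D (x, t) by split.
pose iota (x : vec3 R) : spacetime R := (x, t).
have diota x : differentiable iota x.
  by apply: (@differentiable_pair R (vec3 R) (vec3 R) R id (cst t)).
pose w (x : vec3 R) := S i (x, t) * space_cutoff k x.
have dSx x : differentiable (fun x => S i (x, t)) x.
  exact: (@differentiable_comp R (vec3 R) (spacetime R) R iota (S i) x (diota x) (dS i (Dx x))).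
have dw x : differentiable w x by apply: differentiableM.
have dwE x : 'D_(unit_vec i) w x = S i (x, t) * 'D_(unit_vec i) (space_cutoff k) x +
    space_cutoff k x * 'D_((unit_vec i, 0) : spacetime R) (S i) (x, t).
  rewrite derive_differentiableM//; congr (_ + _ * _).
  have [_ h] := is_derive_slice_fst
    (diff_derivable (v := ((unit_vec i, 0) : spacetime R)) (dS i (Dx x))).
  exact: h.
have GwE x : G (x, t) = 'D_(unit_vec i) w x * psi t.
  by rewrite /G flux_derivative//= dwE.
have cdw : continuous (fun x => 'D_(unit_vec i) w x).
  rewrite (_ : (fun x => 'D_(unit_vec i) w x) = fun x =>
    S i (iota x) * 'D_(unit_vec i) (space_cutoff k) x +
    space_cutoff k x * 'D_((unit_vec i, 0) : spacetime R) (S i) (iota x)); last first.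
    by apply/funext => x; rewrite dwE.
  have c1 x : {for x, continuous (fun x => S i (iota x))}.
    exact: differentiable_continuous (dSx x).
  have c2 x : {for x, continuous (fun x =>
      'D_((unit_vec i, 0) : spacetime R) (S i) (iota x))}.
    exact: (@continuous_comp _ _ _ iota (fun y => 'D_((unit_vec i, 0) : spacetime R) (S i) y) x
      (differentiable_continuous (diota x)) (@cdS i _ _ (Dx x))).
  have c3 x : {for x, continuous (space_cutoff k)} by exact: differentiable_continuous (dchi k x).
  have c4 x : {for x, continuous (fun x => 'D_(unit_vec i) (space_cutoff k) x)} by exact: cdchi.
  move=> x; exact: (continuousD (continuousM (c1 x) (c4 x)) (continuousM (c3 x) (c2 x))).
have M0 : 0 < 2 / k by exact: divr_gt0.
have w0 x : 2 / k <= `|component i x| -> w x = 0.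
  by move=> h; rewrite /w (space_cutoff_out k0 h) mulr0.
have -> : (fun x => G (x, t)) = (fun x => 'D_(unit_vec i) w x * psi t).
  by apply/funext => x; exact: GwE.
exact: (Rintegral_partial_compact M0 dw cdw w0).
Qed.

Let divS_cont y : D y -> {for y, continuous divS}.
Proof.
move=> Dy.
have h := continuousD (continuousD (@cdS 0 y (unit_vec 0, 0) Dy)
  (@cdS 1 y (unit_vec 1, 0) Dy)) (@cdS 2 y (unit_vec 2, 0) Dy).
rewrite (_ : divS = (fun y => 'D_((unit_vec 0, 0) : spacetime R) (S 0) y) +
  (fun y => 'D_((unit_vec 1, 0) : spacetime R) (S 1) y) +
  (fun y => 'D_((unit_vec 2, 0) : spacetime R) (S 2) y)); first exact: h.
by apply/funext => z; rewrite /divS sum3.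
Qed.

Lemma flux_bound : exists K : R, 0 <= K /\ forall k : R, 0 < k ->
  leb4.-integrable slab (EFin \o (fun y => divS y * space_cutoff k y.1)) /\
  `|\int[leb4]_(y in slab) (divS y * space_cutoff k y.1 * psi y.2)| <= k * K.
Proof.
have [C [C0 CP]] := @space_cutoff_derive_bound R.
have [M Mpsi] := continuous_bound_itv a b (psi_cont Cpsi).
have M0 : 0 <= M.
  by apply: le_trans (Mpsi a _); rewrite //= in_itv/= lexx ltW.
have IP0 : 0 <= \int[leb4]_(y in slab) P y.
  by apply: Rintegral_ge0 => y _; exact: le_trans (normr_ge0 _) (SP 0 y).
(* [C] bounds the gradient of the cutoff up to the factor [k], [M] bounds psi on the window, and 3
   counts the directions; the remaining integral of [P] dominates that of each component of the
   flux. *)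
exists (3 * (C * M * \int[leb4]_(y in slab) P y)); split.
  by rewrite !mulr_ge0.
move=> k k0; split; first exact: integrable_cutoff divS_cont.
pose g i (y : spacetime R) := space_cutoff k y.1 *
  'D_((unit_vec i, 0) : spacetime R) (S i) y * psi y.2.
have ig i : leb4.-integrable slab (EFin \o g i).
  have h := @integrable_cutoff k _ k0 (fun y => @cdS i y (unit_vec i, 0)).
  have := integrable_mul_time openT (psi_cont Cpsi) h.
  by apply: eq_integrable => // y _ /=; congr (_ * _)%:E; rewrite mulrC.
have bound i : `|\int[leb4]_(y in slab) g i y| <=
    k * (C * M * \int[leb4]_(y in slab) P y).
  rewrite flux_null// normrN.
  have iSi := integrable_mul_time openT (psi_cont Cpsi) (grad_integrable i k0).
  apply: le_trans (le_normr_Rintegral mS iSi) _.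
  have -> : k * (C * M * \int[leb4]_(y in slab) P y) =
      \int[leb4]_(y in slab) (k * (C * M) * P y).
    by rewrite RintegralZl//; ring.
  apply: le_Rintegral => //.
  - exact: integrable_norm iSi.
  - have := integrableZl mS (k * (C * M)) iP.
    by apply: eq_integrable => // y _ /=; rewrite -EFinM.
  - move=> y [_ y2] /=; rewrite (_ : k * (C * M) * P y = P y * (k * C) * M); last by ring.
    rewrite !normrM; apply: ler_pM; rewrite ?mulr_ge0//; last exact: Mpsi.
    by apply: ler_pM; rewrite ?normr_ge0 ?SP// CP.
have sumE : \int[leb4]_(y in slab) (divS y * space_cutoff k y.1 * psi y.2) =
    \int[leb4]_(y in slab) g 0 y + \int[leb4]_(y in slab) g 1 y +
    \int[leb4]_(y in slab) g 2 y.
  have i01 : leb4.-integrable slab (EFin \o (fun y => g 0 y + g 1 y)).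
    by have h := integrableD mS (ig 0) (ig 1); apply: eq_integrable h => // y _ /=.
  rewrite -RintegralD// -RintegralD//.
  by apply: eq_Rintegral => y _; rewrite /g /divS sum3; ring.
rewrite sumE.
have -> : k * (3 * (C * M * \int[leb4]_(y in slab) P y)) =
    k * (C * M * \int[leb4]_(y in slab) P y) + k * (C * M * \int[leb4]_(y in slab) P y) +
    k * (C * M * \int[leb4]_(y in slab) P y) by ring.
apply: le_trans (ler_normD _ _) _; apply: lerD => //.
by apply: le_trans (ler_normD _ _) _; apply: lerD.
Qed.

(** The successor keeps the scale positive at n = 0; the cutoff equals 1 on the cube of half-side n
    + 1. *)
Let cutoff_seq (n : nat) : vec3 R -> R := space_cutoff (n.+1%:R^-1).

Let cutoff_seq_cvg (g : spacetime R -> R) : leb4.-integrable slab (EFin \o g) ->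
  \int[leb4]_(y in slab) (g y * cutoff_seq n y.1) @[n --> \oo] -->
  \int[leb4]_(y in slab) g y.
Proof.
move=> ig.
have mg : measurable_fun slab g by apply/measurable_EFinP; exact: measurable_int ig.
have ign n : leb4.-integrable slab (EFin \o (fun y => g y * cutoff_seq n y.1)).
  exact: (integrable_mul_space openT (mchi _) (space_cutoff_norm _) ig).
have finE q : leb4.-integrable slab (EFin \o q) ->
    (\int[leb4]_(y in slab) (q y)%:E = (\int[leb4]_(y in slab) q y)%:E)%E.
  by move=> iq; rewrite /Rintegral fineK//; exact: integrable_fin_num.
have lim y : (g y * cutoff_seq n y.1)%:E @[n --> \oo] --> (g y)%:E.
  apply: cvg_EFin; first by near=> n.
  (* At a given point the sequence is eventually constant. The sum of the coordinates in absolute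
     value gives one threshold for all three of them. *)
  have eq1 : \forall n \near \oo, g y = g y * cutoff_seq n y.1.
    near=> n; rewrite /cutoff_seq space_cutoff_in ?mulr1 ?invr_gt0// invrK => i.
    have : `|component 0 y.1| + `|component 1 y.1| + `|component 2 y.1| <= n%:R.
      by near: n; exact: nbhs_infty_ger.
    have hn : n%:R <= n.+1%:R :> R by rewrite ler_nat.
    move: hn (normr_ge0 (component 0 y.1)) (normr_ge0 (component 1 y.1))
      (normr_ge0 (component 2 y.1)).
    by elim/ord3P: i => *; lra.
  by apply: cvg_trans (near_eq_cvg eq1) _; exact: cvg_cst.
have dom y : forall n, slab y ->
    (`|(g y * cutoff_seq n y.1)%:E| <= (EFin \o (Num.norm \o g)) y)%E.
  move=> n _; rewrite /= lee_fin normrM -[leRHS]mulr1 ler_wpM2l//.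
  exact: space_cutoff_norm.
have [_ _ h] := @dominated_convergence _ _ R leb4 slab mS
  (fun n y => (g y * cutoff_seq n y.1)%:E) (EFin \o g) (EFin \o (Num.norm \o g))
  (fun n => measurable_int _ (ign n)) (measurable_int _ ig)
  (aeW leb4 (fun y _ => lim y)) (integrable_norm ig)
  (aeW leb4 dom).
rewrite finE// in h.
exact: (fine_cvg h).
Unshelve. all: by end_near. Qed.

(** Since [divS] is known to be integrable only after multiplication by a cutoff, the limit is taken
    in the other two integrals, where dominated convergence applies, while the flux is merely shown
    to be small. *)
Lemma whole_space_balance (v : R) (W : spacetime R -> R) :
  c1_on D P -> leb4.-integrable slab (EFin \o W) ->
  {ae leb4, forall y : spacetime R, D y ->
     'D_((0, 1) : spacetime R) P y = - (v * divS y) - W y} ->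
  \int[leb4]_(y in slab) (P y * 'D_1 psi y.2) =
  \int[leb4]_(y in slab) (W y * psi y.2).
Proof.
move=> cP iW PVW; have [K [K0 KP]] := flux_bound.
have iPp := integrable_mul_time openT (dpsi_cont Cpsi) iP.
have iWp := integrable_mul_time openT (psi_cont Cpsi) iW.
have k0 n : 0 < n.+1%:R^-1 :> R by rewrite invr_gt0.
have bal n : \int[leb4]_(y in slab) (P y * 'D_1 psi y.2 * cutoff_seq n y.1) -
    \int[leb4]_(y in slab) (W y * psi y.2 * cutoff_seq n y.1) =
    v * \int[leb4]_(y in slab) (divS y * cutoff_seq n y.1 * psi y.2).
  have [iV _] := KP _ (k0 n).
  have iVv : leb4.-integrable slab (EFin \o (fun y => v * divS y * cutoff_seq n y.1)).
    have := integrableZl mS v iV.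
    by apply: eq_integrable => // y _ /=; rewrite -EFinM mulrA.
  have := transport_balance openT a0 ab bT Cpsi psi0 cP iP iW iVv PVW (mchi _)
    (space_cutoff_norm _).
  have iVp := integrable_mul_time openT (psi_cont Cpsi) iV.
  rewrite -RintegralZl//.
  under eq_Rintegral do rewrite mulrAC.
  move=> ->; rewrite -addrA; under [X in _ + (X - _)]eq_Rintegral do rewrite mulrAC.
  rewrite subrr addr0; apply: eq_Rintegral => y _; ring.
have l1 := cutoff_seq_cvg iPp.
have l2 := cutoff_seq_cvg iWp.
have l3 : (fun n => \int[leb4]_(y in slab) (P y * 'D_1 psi y.2 * cutoff_seq n y.1) -
    \int[leb4]_(y in slab) (W y * psi y.2 * cutoff_seq n y.1)) @ \oo -->
    (\int[leb4]_(y in slab) (P y * 'D_1 psi y.2) -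
     \int[leb4]_(y in slab) (W y * psi y.2)).
  exact: (cvgB l1 l2).
(* The same sequence equals [v] times the cut-off flux, hence is at most |v| K / (n + 1); uniqueness
   of limits then identifies the limit in [l3] with zero. *)
have l4 : (fun n => \int[leb4]_(y in slab) (P y * 'D_1 psi y.2 * cutoff_seq n y.1) -
    \int[leb4]_(y in slab) (W y * psi y.2 * cutoff_seq n y.1)) @ \oo --> (0 : R).
  have hk : (fun n => n.+1%:R^-1 * (`|v| * K)) @ \oo --> (0 : R).
    rewrite -[X in _ --> X](mul0r (`|v| * K)).
    by apply: cvgMr_tmp; exact: cvg_harmonic.
  apply/norm_cvg0P; apply: (squeeze_cvgr _ (cvg_cst 0) hk).
  apply: nearW => n; rewrite normr_ge0 /= bal normrM.
  have [_ h] := KP _ (k0 n).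
  apply: le_trans (ler_wpM2l (normr_ge0 v) h) _.
  by rewrite mulrCA.
apply/eqP; rewrite -subr_eq0; apply/eqP.
by rewrite -(cvg_lim (@Rhausdorff R) l3) (cvg_lim (@Rhausdorff R) l4).
Qed.

End whole_space.

Section weighted_slices.
Context d1 d2 (X1 : measurableType d1) (X2 : measurableType d2) (R : realType).
Variables (m1 : {sigma_finite_measure set X1 -> \bar R})
          (m2 : {sigma_finite_measure set X2 -> \bar R}).

(** Integrability of the weighted function gives the iterated integral; that of [g] makes almost
    every slice integrable, so that [k y] can leave the inner integral. *)
Lemma prodm_slice2_weight (A : set X1) (B : set X2) (g : X1 * X2 -> R) (k : X2 -> R) :
  measurable A -> measurable B -> measurable_fun B k ->
  (prodm m1 m2).-integrable (A `*` B) (EFin \o g) ->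
  (prodm m1 m2).-integrable (A `*` B) (EFin \o (fun z => g z * k z.2)) ->
  \int[prodm m1 m2]_(z in A `*` B) (g z * k z.2) =
  \int[m2]_(y in B) ((\int[m1]_(x in A) g (x, y)) * k y).
Proof.
move=> mA mB mk ig igk.
have [iG aeG _] := prodm_slice2 mA mB ig.
have [iGk _ ->] := prodm_slice2 mA mB igk.
apply: Rintegral_ae_eq => //.
- by apply/measurable_EFinP; exact: measurable_int iGk.
- by apply: measurable_funM => //; apply/measurable_EFinP; exact: measurable_int iG.
- by apply: filterS aeG => y h By /=; rewrite RintegralZr//; exact: h.
Qed.

End weighted_slices.

Section bounded_domain.
Context {R : realType}.
Variables (T : R) (Omx : set (vec3 R)) (a b : R) (psi : R -> R).
Hypotheses (openx : open Omx) (a0 : 0 < a) (ab : a < b) (bT : b < T).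
Hypothesis Cpsi : forall n, Ck n psi.
Hypothesis psi0 : forall t, ~ `]a, b[%classic t -> psi t = 0.

Let D : set (spacetime R) := Omx `*` `]0, T[.
Let slab : set (mvec3 R * measurableTypeR R) := Omx `*` `[a, b].

(** Here the weight in space is the constant 1, since [S] itself is integrable. As psi depends on
    time only, the flux term is an integral over t of vanishing spatial integrals. *)
Lemma no_flux_balance (v : R) (P S W : spacetime R -> R) :
  c1_on D P -> leb4.-integrable slab (EFin \o P) ->
  leb4.-integrable slab (EFin \o W) -> leb4.-integrable slab (EFin \o S) ->
  {ae leb4, forall y : spacetime R, D y ->
     'D_((0, 1) : spacetime R) P y = - (v * S y) - W y} ->
  {ae @lebesgue_measure R, forall t : R, `]0, T[%classic t ->
     \int[leb3]_(x in Omx) S (x, t) = 0} ->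
  \int[leb4]_(y in slab) (P y * 'D_1 psi y.2) =
  \int[leb4]_(y in slab) (W y * psi y.2).
Proof.
move=> cP iP iW iS PSW S0; have mS := measurable_slab a b openx.
have iSv : leb4.-integrable slab (EFin \o (fun y => v * S y * (cst 1 y.1 : R))).
  have := integrableZl mS v iS.
  by apply: eq_integrable => // y _ /=; rewrite -EFinM mulr1.
have one1 (x : vec3 R) : `|cst 1 x : R| <= 1 by rewrite normr1.
have m1 : measurable_fun setT (cst 1 : mvec3 R -> R) by exact: measurable_cst.
have := transport_balance openx a0 ab bT Cpsi psi0 cP iP iW iSv PSW m1 one1.
under eq_Rintegral do rewrite /= mulr1.
move=> ->.
have iSp := integrable_mul_time openx (psi_cont Cpsi) iS.
have mI : measurable (`[a, b]%classic : set (measurableTypeR R)) by exact: measurable_itv.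
have mpsi : measurable_fun (`[a, b]%classic : set (measurableTypeR R)) psi.
  by apply: measurable_funTS; exact: continuous_measurable_fun (psi_cont Cpsi).
have flux0 : \int[leb4]_(y in slab) (S y * psi y.2) = 0.
  rewrite (prodm_slice2_weight (vec3_open_measurable openx) mI mpsi iS iSp).
  have [iG _ _] := prodm_slice2 (vec3_open_measurable openx) mI iS.
  apply: Rintegral_ae0 => //.
    by apply: measurable_funM => //; apply/measurable_EFinP; exact: measurable_int iG.
  by apply: (ae_sub S0) => t h /(slab_subset a0 bT) /h ->; rewrite mul0r.
rewrite [X in X + _](_ : _ = 0) ?add0r.
  by apply: eq_Rintegral => y _; rewrite mulr1.
transitivity (v * \int[leb4]_(y in slab) (S y * psi y.2)); last by rewrite flux0 mulr0.
by rewrite -RintegralZl//; apply: eq_Rintegral => y _; rewrite mulr1 mulrA.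
Qed.

End bounded_domain.

(** * Conservation of the total energy *)

Section total_energy.
Context {R : realType}.
Variables (m e c n0 T : R) (Omu Omx : set (vec3 R)) (f : phase R -> R)
  (E B : spacetime R -> vec3 R).
Hypotheses (hm : 0 < m) (he : e != 0) (hc : 0 < c).
Hypotheses (openu : open Omu) (openx : open Omx) (neu : Omu !=set0).
Hypothesis fsol : distributional_solution m e c n0 T Omu Omx f E B.
Hypothesis fsupp : compactly_supported T Omu Omx f.
Hypothesis EBfin : finite_field_energy T Omx E B.
Hypothesis EBflux : Omx <> setT -> no_net_poynting_flux T Omx E B.

Let D : set (spacetime R) := Omx `*` `]0, T[.
Let J (i : 'I_3) (y : spacetime R) := component i (current m e c Omu f y).
Let poynting (y : spacetime R) := cross (E y) (B y).

Let floc : phase_locally_integrable T Omu Omx f. Proof. by case: fsol. Qed.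
Let sv : smooth (Omega T Omu Omx) (velocity m c). Proof. by case: fsol. Qed.
Let sF : smooth (Omega T Omu Omx) (force m e c E B). Proof. by case: fsol. Qed.
Let max : maxwell m e c n0 T Omu Omx f E B. Proof. by case: fsol. Qed.
Let vl : vlasov m e c T Omu Omx f E B. Proof. by case: fsol. Qed.

Let cE i : c1_on D (component i \o E).
Proof. exact: c1_electric hm he hc openu openx neu sF i. Qed.

Let cB i : c1_on D (component i \o B).
Proof. exact: c1_magnetic hm he hc openu openx neu sF i. Qed.

Let contE i y : D y -> {for y, continuous (component i \o E)}.
Proof. by move=> Dy; have [dE _] := cE i Dy; exact: differentiable_continuous dE. Qed.

Lemma poynting_le_field_square i y : `|component i (poynting y)| <= field_square E B y.
Proof.
(* Twice the inequality 2 |pq| <= p^2 + q^2; [x] and [z] stand for the components of E and B that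
   are absent from the given component of E x B. *)
have sq (p q r s x z : R) : `|p * q - r * s| <=
    p * p + r * r + x * x + (q * q + s * s + z * z).
  have := sqr_ge0 (p + q); have := sqr_ge0 (p - q).
  have := sqr_ge0 (r + s); have := sqr_ge0 (r - s).
  have := sqr_ge0 x; have := sqr_ge0 z; have := sqr_ge0 p; have := sqr_ge0 q.
  have := sqr_ge0 r; have := sqr_ge0 s.
  by rewrite !expr2 ler_norml => *; apply/andP; split; nra.
rewrite /field_square !dotE /poynting /cross; elim/ord3P: i; rewrite /component /=.
- apply: le_trans (sq _ _ _ _ (E y).1.1 (B y).1.1) _; lra.
- apply: le_trans (sq _ _ _ _ (E y).1.2 (B y).1.2) _; lra.
- apply: le_trans (sq _ _ _ _ (E y).2 (B y).2) _; lra.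
Qed.

Section time_window.
Variables (a b : R).
Hypotheses (a0 : 0 < a) (bT : b < T).

Let slab : set (mvec3 R * measurableTypeR R) := Omx `*` `[a, b].
Let Z := Omu `*` Omx.

Let mZ := measurable_phase_space openu openx.
Let mx_ := vec3_open_measurable openx.
Let mI : measurable (`[a, b]%classic : set (measurableTypeR R)).
Proof. exact: measurable_itv. Qed.

Let kinetic (t : R) := \int[leb6]_(z in Z) (f (z, t) * kinetic_energy m c z.1).
Let field (t : R) := \int[leb3]_(x in Omx) field_square E B (x, t).

Let energyE t : energy m c Omu Omx f E B t = kinetic t + (8 * pi)^-1 * field t.
Proof.
rewrite /energy; congr (_ + _); apply: eq_Rintegral => z _.
by rewrite /kinetic_energy !mulrA.
Qed.

Let kinetic_cont (w : phase R) :
  {for w, continuous (fun w : phase R => kinetic_energy m c w.1.1)}.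
Proof.
have C1 := @Ck_fst R (vec3 R) (vec3 R) 0 _ (Ck_kinetic_energy hm hc 0).
exact: differentiable_continuous (Ck_diff w (@Ck_fst R (vec3 R * vec3 R)%type R 0 _ C1)).
Qed.

Let integrable_kinetic := integrable_moment openu openx floc fsupp a0 bT
  (fun w _ => @kinetic_cont w).

Let integrable_field : leb4.-integrable slab (EFin \o field_square E B).
Proof. exact: EBfin. Qed.

Lemma integrable_energy :
  lebesgue_measure.-integrable `[a, b] (EFin \o energy m c Omu Omx f E B).
Proof.
have [iK _ _] := prodm_slice2 mZ mI integrable_kinetic.
have [iF _ _] := prodm_slice2 mx_ mI integrable_field.
have h := integrableD mI iK (integrableZl mI (8 * pi)^-1 iF).
by apply: eq_integrable h => // t _ /=; rewrite energyE EFinD EFinM.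
Qed.

Let W (y : spacetime R) := 8 * pi * \sum_(i < 3) component i (E y) * J i y.

Let integrable_work i : leb4.-integrable slab (EFin \o (fun y => component i (E y) * J i y)).
Proof.
have [h _] := current_moment e hm hc openu openx floc fsupp a0 bT i (@contE i).
exact: h.
Qed.

Let integrable_W : leb4.-integrable slab (EFin \o W).
Proof.
have mS := measurable_slab a b openx.
have h01 := integrableD mS (integrable_work 0) (integrable_work 1).
have h := integrableZl mS (8 * pi) (integrableD mS h01 (integrable_work 2)).
by apply: eq_integrable h => // y _ /=; rewrite /W sum3.
Qed.

Variable psi : R -> R.
Hypotheses (ab : a < b) (tpsi : test_function `]0, T[ psi).
Hypothesis psi0 : forall t, ~ `]a, b[%classic t -> psi t = 0.

Let Cpsi n : Ck n psi. Proof. exact: test_function_Ck tpsi. Qed.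

Let field_balance : \int[leb4]_(y in slab) (field_square E B y * 'D_1 psi y.2) =
  \int[leb4]_(y in slab) (W y * psi y.2).
Proof.
have cP := c1_field_square openx cE cB.
have PVW : {ae leb4, forall y : spacetime R, D y ->
    'D_((0, 1) : spacetime R) (field_square E B) y =
    - (2 * c * divergence poynting y) - W y}.
  apply: (ae_sub (poynting_balance hc openx cE cB max)) => y h Dy.
  by rewrite h// mulNr.
have [xT|xT] := pselect (Omx = setT); last first.
  have [iS S0] := EBflux xT.
  exact: (no_flux_balance openx a0 ab bT Cpsi psi0 cP integrable_field integrable_W
    (iS a b a0 bT) PVW S0).
have cS i := c1_poynting openx cE cB i.
move: cP PVW cS integrable_field integrable_W; rewrite /slab /D xT => cP PVW cS iP iW.
exact: (whole_space_balance a0 ab bT Cpsi psi0 cS poynting_le_field_square iP cP iW PVW).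
Qed.

Lemma energy_balance :
  \int[lebesgue_measure]_(t in `[a, b]) (energy m c Omu Omx f E B t * 'D_1 psi t) = 0.
Proof.
have cdpsi := dpsi_cont Cpsi.
have mdpsi : measurable_fun (`[a, b]%classic : set (measurableTypeR R)) (fun t => 'D_1 psi t).
  by apply: measurable_funTS; exact: continuous_measurable_fun cdpsi.
have ck w : Omega T Omu Omx w -> {for w, continuous
    (fun w : phase R => kinetic_energy m c w.1.1 * 'D_1 psi w.2)}.
  move=> _; apply: continuousM; first exact: kinetic_cont.
  apply: (@continuous_comp _ _ _ snd (fun t => 'D_1 psi t)); first exact: cvg_snd.
  exact: cdpsi.
have iKp : leb7.-integrable (Z `*` `[a, b])
    (EFin \o (fun w => f w * kinetic_energy m c w.1.1 * 'D_1 psi w.2)).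
  have := integrable_moment openu openx floc fsupp a0 bT ck.
  by apply: eq_integrable => [|w _ /=]; [exact: measurableX|rewrite mulrA].
have iFp := integrable_mul_time openx cdpsi integrable_field.
have KE := prodm_slice2_weight mZ mI mdpsi integrable_kinetic iKp.
have FE := prodm_slice2_weight mx_ mI mdpsi integrable_field iFp.
have [M Mb] := continuous_bound_itv a b cdpsi.
have [iK _ _] := prodm_slice2 mZ mI integrable_kinetic.
have [iF _ _] := prodm_slice2 mx_ mI integrable_field.
have iKd := integrable_mul_bounded mI iK mdpsi Mb.
have iFd := integrable_mul_bounded mI iF mdpsi Mb.
(* The work of the i-th component of E, weighted by psi. It enters the kinetic part with factor -1
   and the field part with factor 8 pi, which the normalization of the field energy cancels. *)
pose A i := \int[leb4]_(y in slab) ((psi y.2 * (component i \o E) y) * J i y).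
have KA : \int[lebesgue_measure]_(t in `[a, b]) (kinetic t * 'D_1 psi t) =
    - \sum_(i < 3) A i.
  rewrite -(kinetic_balance hm hc openu openx floc fsupp a0 bT sF sv vl contE tpsi psi0).
  rewrite -[LHS]KE; apply: eq_Rintegral => w _; by rewrite mulrA.
have FA : \int[lebesgue_measure]_(t in `[a, b]) (field t * 'D_1 psi t) =
    8 * pi * \sum_(i < 3) A i.
  rewrite -[LHS]FE -[LHS]/(\int[leb4]_(y in slab) (field_square E B y * 'D_1 psi y.2)).
  rewrite field_balance.
  have mS := measurable_slab a b openx.
  have iA i : leb4.-integrable slab
      (EFin \o (fun y => (psi y.2 * (component i \o E) y) * J i y)).
    have := integrable_mul_time openx (psi_cont Cpsi) (integrable_work i).
    by apply: eq_integrable => // y _ /=; congr (_%:E); ring.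
  have i01 := integrableD mS (iA 0) (iA 1).
  have i012 := integrableD mS i01 (iA 2).
  rewrite sum3 /A -RintegralD// -RintegralD// -RintegralZl//.
  by apply: eq_Rintegral => y _; rewrite /W sum3 /=; ring.
transitivity (\int[lebesgue_measure]_(t in `[a, b]) (kinetic t * 'D_1 psi t) +
   (8 * pi)^-1 * \int[lebesgue_measure]_(t in `[a, b]) (field t * 'D_1 psi t)).
  rewrite -RintegralZl// -RintegralD//.
    by apply: eq_Rintegral => t _; rewrite energyE mulrDl mulrA.
  have := integrableZl mI (8 * pi)^-1 iFd.
  by apply: eq_integrable => // t _ /=; rewrite -EFinM.
have pi0 : pi != 0 :> R by rewrite gt_eqF// pi_gt0.
by rewrite KA FA mulKf ?addNr// mulf_neq0.
Qed.

End time_window.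
End total_energy.

Unset Implicit Arguments.

(** The energy at a given time is an integral over a slice of a locally integrable function, hence
    meaningful for almost every time only. Its conservation is therefore stated as the vanishing of
    its distributional derivative. *)
Theorem proposition4p1 (R : realType) (m e c n0 T : R)
    (Omu Omx : set (vec3 R))
    (f : phase R -> R) (E B : spacetime R -> vec3 R)
    (hm : 0 < m) (he : e != 0) (hc : 0 < c) (hT : 0 < T)
    (openu : open Omu) (openx : open Omx) (neu : Omu !=set0)
    (fsol : distributional_solution m e c n0 T Omu Omx f E B)
    (fsupp : compactly_supported T Omu Omx f)
    (EBfin : finite_field_energy T Omx E B)
    (EBflux : Omx <> setT -> no_net_poynting_flux T Omx E B) :
  is_weak_derivative `]0, T[ (energy m c Omu Omx f E B) (cst 0).
Proof.
have measE (a b : R) (a0 : 0 < a) (bT : b < T) :=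
  integrable_energy hm hc openu openx fsol fsupp EBfin a0 bT.
have sub a b : 0 < a -> b < T -> `]a, b[%classic `<=` `]0, T[%classic.
  by move=> a0 bT t tab; apply: (slab_subset a0 bT); exact: subset_itv_oo_cc tab.
split.
(* A compact set of times lies in some window [a, b] inside the open interval, and on such a window
   the energy is integrable. *)
- have mloc (K : set R) : compact K -> K `<=` `]0, T[ ->
      lebesgue_measure.-integrable K (EFin \o energy m c Omu Omx f E B).
    move=> cK KT; have [a [b [a0 ab bT Kab]]] := compact_in_oo hT cK KT.
    apply: (integrableS _ _ _ (measE a b a0 bT)).
    + exact: measurable_itv.
    + exact: compact_measurable.
    + by move=> t /Kab; exact: subset_itv_oo_cc.
  split; [|exact: itv_open|].
    apply: (@borel_measurable_fun_local _ (measurableTypeR R) (Topological.class R) R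
      (compact_base_R R)); first exact: itv_open.
    by move=> K cK _ KT; apply/measurable_EFinP; exact: measurable_int (mloc K cK KT).
  by move=> K KT cK; have /integrableP[] := mloc K cK KT.
- apply: open_integrable_locally; first exact: itv_open.
  exact: integrable0.
- move=> psi tpsi; have [a [b [a0 ab bT psi0]]] := test_function_support hT tpsi.
  rewrite (_ : \int[lebesgue_measure]_(t in `]0, T[) (cst 0 t * psi t) = 0); last first.
    transitivity (\int[lebesgue_measure]_(t in `]0, T[) (0 : R)).
      by apply: eq_Rintegral => t _; rewrite mul0r.
    by rewrite Rintegral_cst ?mul0r//; exact: measurable_itv.
  rewrite oppr0.
  (* Outside the window the derivative of psi vanishes, so nothing is required of the energy near
     the times 0 and T. *)
  rewrite (@Rintegral_subset _ (measurableTypeR R) R lebesgue_measure `[a, b]%classic).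
  + rewrite -[RHS](energy_balance hm he hc openu openx neu fsol fsupp EBfin EBflux
      a0 bT ab tpsi psi0).
    by apply: eq_Rintegral => t _; rewrite derive1E.
  + exact: slab_subset.
  + move=> t _ nt; rewrite derive1E (test_function_derive_out psi0 nt) mulr0//.
Qed.
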